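(* Let $f(s)=\sum_{n=1}^\infty a_nn^{-s}$ be a Dirichlet series in $\mathcal{N}_u$. Then the formal power series $(\mathcal{B}f)(\zeta)=\sum_{n=1}^\infty a_n\zeta^{\alpha(n)}$ converges at every point of $\mathbb{D}_1^\infty$. Moreover, $\mathcal{B}f\in N(\mathbb{D}_1^\infty)$ and $\|\mathcal{B}f\|_0=\|f\|_0$. Therefore, the Bohr transform $\mathcal{B}$ can be extended to an isometry from $\mathcal{N}$ to $N(\mathbb{D}_1^\infty)$.
   Context: $p_j$ denotes the $j$-th prime. For $n\in\mathbb{N}=\{1,2,\ldots\}$ with prime factorization $n=p_1^{\alpha_1}\cdots p_k^{\alpha_k}$, set $\alpha(n)=(\alpha_1,\ldots,\alpha_k,0,\ldots)$ and, for a complex sequence $\zeta$, $\zeta^{\alpha(n)}=\zeta_1^{\alpha_1}\cdots\zeta_k^{\alpha_k}$. The Bohr transform of a Dirichlet series $f(s)=\sum a_nn^{-s}$ is the formal power series $(\mathcal{B}f)(\zeta)=\sum_{n=1}^\infty a_n\zeta^{\alpha(n)}$. The abscissa of uniform convergence $\sigma_u(f)\in[-\infty,\infty]$ is the infimum of $\sigma\in\mathbb{R}$ such that $\sum a_nn^{-s}$ converges uniformly on $\{\mathrm{Re}\,s>\sigma\}$. For $\sigma\in\mathbb{R}$, $f_\sigma(s)=\sum a_nn^{-(s+\sigma)}$. If $\sigma_u(f)<0$, set $\|f\|_0=\lim_{T\to\infty}\frac1{2T}\int_{-T}^T\log(1+|f(it)|)dt$ (the limit exists). $\mathcal{N}_u$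 is the class of Dirichlet series $f$ with $\sigma_u(f)\le0$ and $\limsup_{\sigma\to0^+}\|f_\sigma\|_0<\infty$; for $f\in\mathcal{N}_u$ one sets $\|f\|_0=\sup_{\sigma>0}\|f_\sigma\|_0$ (equal to the limsup, since $\|f_\sigma\|_0$ is non-increasing in $\sigma$), and $d_0(f,g)=\|f-g\|_0$ is a metric on $\mathcal{N}_u$. The Nevanlinna-Dirichlet class $\mathcal{N}$ is the completion of $\mathcal{N}_u$ in this metric. $\mathbb{T}^\infty$ is the countably infinite product of unit circles with Haar probability measure $m_\infty$. $\mathbb{D}_1^\infty=\{\zeta\in\ell^1:|\zeta_n|<1\text{ for all }n\}$, a domain in the Banach space $\ell^1$. A function $F:\mathbb{D}_1^\infty\to\mathbb{C}$ is holomorphic if it is locally bounded and, for all $x_0\in\mathbb{D}_1^\infty$, $x\in\ell^1$, $z\mapsto F(x_0+zx)$ is holomorphic where $x_0+zx\in\mathbb{D}_1^\infty$. With $F_{[r]}(w)=F(rw_1,\ldots,r^nw_n,\ldots)$ for $0<r<1$, $w\in\mathbb{T}^\infty$, the Nevanlinna class $N(\mathbb{D}_1^\infty)$ is the set of holomorphic $F$ with $\sup_{0<r<1}\int_{\mathbb{T}^\infty}\log^+|F_{[r]}|dm_\infty<\infty$, with $\|F\|_0=\sup_{0<r<1}\int_{\mathbb{T}^\infty}\log(1+|F_{[r]}|)dm_\infty$ and metric $d_0(F,G)=\|F-G\|_0$. *)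

(* Defs.v *)
From HB Require Import structures.
From mathcomp Require Import all_boot all_order all_algebra.
From mathcomp Require Import complex.
From mathcomp Require Import all_classical all_reals all_analysis.

Set Implicit Arguments.
Unset Strict Implicit.
Unset Printing Implicit Defensive.

Import Order.TTheory GRing.Theory Num.Theory.
Import numFieldNormedType.Exports.
Import ComplexField.Normc.

Local Open Scope classical_set_scope.
Local Open Scope ring_scope.
Local Open Scope complex_scope.

(* [C] is normed over itself, so that [derivable f z 1] for [f : C -> C] is
   complex differentiability. The library modulus [`|z|] is [C]-valued; the
   real-valued modulus is [normc z]. *)
HB.instance Definition _ (R : realType) := NormedModule.copy R[i] R[i]^o.

Section Dirichlet.
Variable R : realType.
Local Notation C := R[i].
Implicit Types (s z : C) (n : nat) (sigma : R).

Definition cexp z : C :=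
  (expR (complex.Re z))%:C * (cos (complex.Im z) +i* sin (complex.Im z)).

(* n^(-s); only used for n >= 1 *)
Definition npow n s : C := cexp (- (s * (ln n%:R)%:C)).

(* [a : dseries] is the series \sum_(n >= 1) a_n n^(-s); indices are shifted:
   [a n] is the coefficient a_(n+1). *)
Definition dseries := nat -> C.
Implicit Types a : dseries.

Definition dterm a s n : C := a n * npow n.+1 s.

Definition dsum a s : C := limn (series (dterm a s)).

Definition unif_cvg_right a sigma : Prop :=
  exists f : C -> C,
    {uniform [set s : C | sigma < complex.Re s],
      (fun n s => series (dterm a s) n) @ \oo --> f}.

Definition abscissa_u a : \bar R :=
  ereal_inf [set sigma%:E | sigma in unif_cvg_right a].

(* the coefficients of f_sigma *)
Definition dshift sigma a : dseries := fun n => a n * npow n.+1 sigma%:C.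

(* ||f||_0 when sigma_u(f) < 0 *)
Definition mean_log a : \bar R :=
  lim ((fun T : R => ((2 * T)^-1)%:E *
       \int[lebesgue_measure]_(t in `[(- T)%R, T])
          (ln (1 + normc (dsum a (0 +i* t))))%:E)%E @ +oo%R).

Definition Nu : set dseries := [set a |
  (abscissa_u a <= 0)%E /\
  (limf_esup (fun sigma => mean_log (dshift sigma a)) (0 : R)^'+ < +oo)%E].

(* ||f||_0 on N_u *)
Definition norm0 a : \bar R :=
  ereal_sup [set mean_log (dshift sigma a) | sigma in [set x : R | 0 < x]].

(* [N], with [iota], is the completion of N_u for d_0(f, g) = ||f - g||_0 *)
Record is_completion (N : metricType R) (iota : Nu -> N) : Prop := {
  completion_isometry : forall f g : Nu,
    (mdist (iota f) (iota g))%:E = norm0 (val f \- val g) ;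
  completion_dense : dense (range iota) ;
  completion_complete : forall F : set_system N,
    ProperFilter F -> cauchy F -> exists x : N, F --> x }.

End Dirichlet.

Section Bohr.
Variable R : realType.
Local Notation C := R[i].
Implicit Types (a : dseries R) (zeta : nat -> C) (n j : nat).

Lemma next_prime_subproof n : exists p, prime p && (n < p)%N.
Proof. by case: (prime_above n) => p ltnp prp; exists p; rewrite prp. Qed.

Definition next_prime n : nat := ex_minn (next_prime_subproof n).

(* 0-based: [nth_prime 0 = 2], i.e. [nth_prime j] is p_(j+1) *)
Definition nth_prime j : nat := iter j.+1 next_prime 0%N.

(* zeta^alpha(n), for n >= 1; since nth_prime j > j, the primes
   nth_prime 0, ..., nth_prime (n - 1) include all prime divisors of n. *)
Definition bohr_monomial n zeta : C :=
  \prod_(j < n) zeta j ^+ logn (nth_prime j) n.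

Definition bohr_term a zeta n : C := a n * bohr_monomial n.+1 zeta.

Definition bohr a zeta : C := limn (series (bohr_term a zeta)).

End Bohr.

Section Nevanlinna.
Variable R : realType.
Local Notation C := R[i].

Definition norm1 (x : nat -> C) : \bar R := (\sum_(0 <= n <oo) (normc (x n))%:E)%E.

Definition ell1 : set (nat -> C) := [set x | (norm1 x < +oo)%E].

Definition Dinf1 : set (nat -> C) :=
  [set x | ell1 x /\ forall n, normc (x n) < 1].

(* A function on D_1^oo is a total function, of which only the values on [Dinf1]
   matter. *)
Definition locally_bounded (F : (nat -> C) -> C) : Prop :=
  forall x0, Dinf1 x0 -> exists2 e : R, 0 < e & exists M : R,
    forall x, Dinf1 x -> (norm1 (x \- x0)%R < e%:E)%E -> normc (F x) <= M.

Definition holomorphic (F : (nat -> C) -> C) : Prop :=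
  locally_bounded F /\
  forall x0 x, Dinf1 x0 -> ell1 x ->
    forall z : C, Dinf1 (fun n => x0 n + z * x n) ->
      derivable (fun z : C => F (fun n => x0 n + z * x n)) z 1.

Definition unit_circle : set C := [set z | normc z = 1].
Definition circle : Type := unit_circle.
HB.instance Definition _ := Topological.on circle.

Lemma circle1 : (1 : C) \in unit_circle.
Proof. by rewrite inE; exact: normc1. Qed.

HB.instance Definition _ := isPointed.Build circle (exist _ 1 circle1).

Lemma circleM (u v : circle) : val u * val v \in unit_circle.
Proof.
case: u v => [u /= /set_mem hu] [v /= /set_mem hv].
by rewrite inE /unit_circle /= normcM hu hv mulr1.
Qed.

Definition circle_mul (u v : circle) : circle :=
  exist (fun z => z \in unit_circle) _ (circleM u v).

Definition Tinf := prod_topology (fun _ : nat => circle).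
HB.instance Definition _ := Pointed.on Tinf.
HB.instance Definition _ := Topological.on Tinf.
Definition Tinf_borel := g_sigma_algebraType (@open Tinf).
HB.instance Definition _ := Measurable.on Tinf_borel.

Definition Tinf_mul (u w : Tinf) : Tinf := fun n => circle_mul (u n) (w n).

(* The Haar probability measure is the translation-invariant Borel
   probability measure. *)
Definition is_haar (m : probability Tinf_borel R) : Prop :=
  forall (u : Tinf) (A : set Tinf_borel), measurable A ->
    m (Tinf_mul u @^-1` A) = m A.

(* F_[r](w) = F(r w_1, r^2 w_2, ...) *)
Definition dilate (F : (nat -> C) -> C) (r : R) (w : Tinf) : C :=
  F (fun n => (r ^+ n.+1)%:C * val (w n)).

(* [ln 0 = 0] in the library, so this is log^+ also at 0 *)
Definition logp (x : R) : R := Num.max 0 (ln x).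

Variable m : probability Tinf_borel R.

Definition nevanlinna : set ((nat -> C) -> C) := [set F |
  holomorphic F /\
  (ereal_sup [set \int[m]_w (logp (normc (dilate F r w)))%:E
              | r in [set r : R | (0 < r < 1)%R]] < +oo)%E].

Definition nevanlinna_norm0 (F : (nat -> C) -> C) : \bar R :=
  ereal_sup [set (\int[m]_w (ln (1 + normc (dilate F r w)))%:E)%E
             | r in [set r : R | (0 < r < 1)%R]].

End Nevanlinna.

(* Main.v *)
Require Import Defs.
From HB Require Import structures.
From mathcomp Require Import all_boot all_order all_algebra.
From mathcomp Require Import complex.
From mathcomp Require Import all_classical all_reals all_analysis.
From mathcomp Require Import measurable_realfun.
From mathcomp Require Import ring lra.
Set Implicit Arguments.
Unset Strict Implicit.
Unset Printing Implicit Defensive.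
Import Order.TTheory GRing.Theory Num.Theory.
Import numFieldNormedType.Exports.
Import ComplexField.Normc.
Local Open Scope classical_set_scope.
Local Open Scope ring_scope.
Local Open Scope complex_scope.

(** Bohr's point of view: a Dirichlet series is a power series in infinitely many
    variables, in which the [j]-th variable takes the value [p_j ^ (- s)]. By unique
    factorization ([chi_neg], [chi_line]), a character of the torus other than the
    constant one has mean zero both for the Haar measure ([mean_chi]) and along the
    vertical line ([time_mean_chi]), so that the vertical line is equidistributed in
    the torus. For a finite sum [P], the square of [|P|] is a trigonometric polynomial
    on the torus; hence [log (1 + |P|)] is a uniform limit of trigonometric polynomials
    ([ln1D_psum_approx]), and its time mean is its mean over the torus
    ([time_mean_psum]). Uniform convergence of the Dirichlet series on the line then
    shows that the norm of a shifted series is the limit of the torus means of its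
    partial sums ([cvg_mean_log]).

    The function [log (1 + |P|)] is subharmonic in each variable, so that a harmonic
    majorant of it on the torus is one in the polydisc ([majorant_polydisc]). There are
    two consequences. First, the torus means increase with the radii
    ([lmean_contract]). Secondly, Harnack's inequality bounds [log (1 + |P|)] in the
    polydisc by its mean, and Cauchy's estimate bounds the coefficients
    ([le_coef_lmean]). Thus a series of norm at most [K] satisfies explicit estimates
    of its coefficients on every polydisc, called [coef_bound] below. All of this
    concerns polynomials in finitely many variables, and the analysis is done for
    polynomials in one variable, with means over the first coordinate of the torus in
    place of contour integrals.

    The coefficient bounds suffice for absolute convergence, locally uniform on the
    domain ([local_bound]). The difficulty is that a fixed polydisc gives no control of
    infinitely many variables, because the product of the Harnack constants
    [(1 + r_j) / (1 - r_j)] must converge. The radii are therefore chosen for each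
    monomial separately: close to [1] for finitely many variables, and of sum [1 / 2],
    proportional to the exponents, for the others. The resulting majorant is the
    product of a geometric series and of a multinomial series in the small variables,
    and it converges at every summable point. Holomorphy follows from the same bound
    ([bohr_holomorphic]).

    For the equality of the norms, the radii [r, r ^ 2, ...] are compared with
    [p_j ^ (- sigma)]. Finitely many variables suffice up to a small error, and for
    these each family of radii dominates the other when its parameter is close enough
    to its limit ([dmean_le_norm0], [norm0_le_dmean]).

    Finally, the coefficient bounds are linear in the norm near [0], so that the
    coefficients are continuous for the metric. A point of the completion thus has
    coefficients, which satisfy the same bounds ([completion_coef]); its image is the
    sum of the corresponding power series, and distances pass to the limit
    ([completion_norm]). *)

(** * Complex moduli and the function [log (1 + x)] *)

Section ComplexPrelim.
Variable R : realType.
Local Notation C := R[i].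
Implicit Types (z w : C) (x : R).

Lemma normc_ge0 z : 0 <= normc z.
Proof. by case: z => a b; rewrite sqrtr_ge0. Qed.

Lemma normc_absE z : `|z| = (normc z)%:C.
Proof. by []. Qed.

Lemma ler_normcD z w : normc (z + w) <= normc z + normc w.
Proof. exact: (@le_normcD R z w). Qed.

Lemma normc_opp z : normc (- z) = normc z.
Proof. exact: (@normcN R z). Qed.

Lemma normc_distC z w : normc (z - w) = normc (w - z).
Proof. by rewrite -normc_opp opprB. Qed.

Lemma ler_normc_sum (I : Type) (r : seq I) (P : pred I) (F : I -> C) :
  normc (\sum_(i <- r | P i) F i) <= \sum_(i <- r | P i) normc (F i).
Proof.
elim/big_rec2 : _ => [|i y1 y2 _ h]; first by rewrite normc0.
by apply: le_trans (ler_normcD _ _) _; rewrite lerD2l.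
Qed.

Lemma normcX z n : normc (z ^+ n) = normc z ^+ n.
Proof. by elim: n => [|n ih]; rewrite ?expr0 ?normc1// !exprS normcM ih. Qed.

Lemma normc_real x : normc x%:C = `|x|.
Proof. by rewrite /= expr0n addr0 sqrtr_sqr. Qed.

Lemma normc_conj z : normc z^*%C = normc z.
Proof. by case: z => a b /=; rewrite sqrrN. Qed.

Lemma normc_eq0P z : (normc z == 0) = (z == 0).
Proof.
by apply/eqP/eqP => [/eq0_normc//|->]; rewrite normc0.
Qed.

Lemma ler_Re_normc z : complex.Re z <= normc z.
Proof.
case: z => a b /=; apply: le_trans (ler_norm a) _.
by rewrite -sqrtr_sqr ler_wsqrtr// lerDl sqr_ge0.
Qed.

Lemma ler_absRe_normc z : `|complex.Re z| <= normc z.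
Proof.
by rewrite ler_norml ler_Re_normc andbT lerNl -(normc_opp z) -raddfN ler_Re_normc.
Qed.

Lemma ler_absIm_normc z : `|complex.Im z| <= normc z.
Proof.
case: z => a b /=; rewrite -sqrtr_sqr ler_wsqrtr// lerDr sqr_ge0//.
Qed.

Lemma normc_le_ReIm z : normc z <= `|complex.Re z| + `|complex.Im z|.
Proof.
case: z => a b /=; rewrite -[leRHS]ger0_norm ?addr_ge0// -sqrtr_sqr ler_wsqrtr//.
rewrite sqrrD !real_normK ?num_real// lerD2r lerDl mulrn_wge0// mulr_ge0//.
Qed.

Lemma Re_add z w : complex.Re (z + w) = complex.Re z + complex.Re w.
Proof. by case: z; case: w. Qed.

Lemma Im_add z w : complex.Im (z + w) = complex.Im z + complex.Im w.
Proof. by case: z; case: w. Qed.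

Lemma Re_opp z : complex.Re (- z) = - complex.Re z.
Proof. by case: z. Qed.

Lemma Im_opp z : complex.Im (- z) = - complex.Im z.
Proof. by case: z. Qed.

Lemma Re_mul z w : complex.Re (z * w) =
  complex.Re z * complex.Re w - complex.Im z * complex.Im w.
Proof. by case: z; case: w. Qed.

Lemma Im_mul z w : complex.Im (z * w) =
  complex.Re z * complex.Im w + complex.Im z * complex.Re w.
Proof. by case: z; case: w. Qed.

Lemma Re_conj z : complex.Re z^*%C = complex.Re z.
Proof. by case: z. Qed.

Lemma Re_realM x z : complex.Re (x%:C * z) = x * complex.Re z.
Proof. by rewrite Re_mul /= mul0r subr0. Qed.

Lemma mulc_conj z : z * z^*%C = (normc z ^+ 2)%:C.
Proof. by rewrite -sqr_normc normc_absE rmorphXn. Qed.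

(** A rotation turns a modulus into a real part, which is linear. *)
Lemma exists_phase z : exists2 c : C, normc c = 1 & c * z = (normc z)%:C.
Proof.
have [->|z0] := eqVneq z 0; first by exists 1; rewrite ?normc1 ?normc0 ?mulr0.
have nz0 : normc z != 0 by rewrite normc_eq0P.
exists (z^*%C * ((normc z)^-1)%:C).
  by rewrite normcM normc_conj normc_real ger0_norm ?invr_ge0 ?normc_ge0// mulfV.
rewrite mulrAC [z^*%C * z]mulrC mulc_conj -rmorphM /= expr2 -mulrA mulfV ?mulr1//.
Qed.

Lemma ln1D_ge0 x : 0 <= x -> 0 <= ln (1 + x).
Proof. by move=> x0; rewrite ln_ge0// lerDl. Qed.

Lemma le_ln1D x (y : R) : 0 <= x -> x <= y -> ln (1 + x) <= ln (1 + y).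
Proof.
move=> x0 xy; rewrite ler_ln ?posrE ?lerD2l// ltr_pwDl//.
exact: le_trans x0 xy.
Qed.

Lemma ln1D_le x : 0 <= x -> ln (1 + x) <= x.
Proof.
move=> x0; have := le_ln1Dx; move=> /(_ R x) -> //.
by rewrite (lt_le_trans _ x0)// ltrN10.
Qed.

Lemma ln1D_add x (y : R) : 0 <= x -> 0 <= y ->
  ln (1 + (x + y)) <= ln (1 + x) + ln (1 + y).
Proof.
move=> x0 y0.
rewrite -lnM ?posrE ?ltr_pwDl// ler_ln ?posrE ?mulr_gt0 ?ltr_pwDl ?addr_ge0//.
have := mulr_ge0 x0 y0; nra.
Qed.

Lemma ln1D_normcD z w :
  ln (1 + normc (z + w)) <= ln (1 + normc z) + ln (1 + normc w).
Proof.
apply: le_trans (ln1D_add (normc_ge0 z) (normc_ge0 w)).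
by rewrite le_ln1D ?normc_ge0 ?ler_normcD.
Qed.

Lemma ln1D_normc_le z w (e : R) : normc (z - w) <= e ->
  ln (1 + normc z) <= ln (1 + normc w) + e.
Proof.
move=> h; rewrite -{1}(subrK w z) (addrC (z - w)).
apply: le_trans (ln1D_normcD _ _) _; rewrite lerD2l.
exact: le_trans (ln1D_le (normc_ge0 _)) h.
Qed.

End ComplexPrelim.

(** * Monomials indexed by integers *)

Section Primes.
Implicit Types (n j k p : nat).

Lemma next_primeP n :
  [/\ prime (next_prime n), (n < next_prime n)%N &
      forall p, prime p -> (n < p)%N -> (next_prime n <= p)%N].
Proof.
rewrite /next_prime; case: ex_minnP => q /andP[prq ltnq] minq; split=> // p prp ltnp.
by apply: minq; rewrite prp.
Qed.

Lemma nth_primeS j : nth_prime j.+1 = next_prime (nth_prime j).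
Proof. by []. Qed.

Lemma nth_prime_prime j : prime (nth_prime j).
Proof. by rewrite /nth_prime iterS; case: (next_primeP (iter j next_prime 0%N)). Qed.

Lemma nth_prime_ltS j : (nth_prime j < nth_prime j.+1)%N.
Proof. by rewrite nth_primeS; case: (next_primeP (nth_prime j)). Qed.

Lemma nth_prime_mono : {mono nth_prime : i j / (i < j)%N >-> (i < j)%N}.
Proof. by apply: leW_mono; apply: leq_mono; apply: homo_ltn nth_prime_ltS; exact: ltn_trans. Qed.

Lemma nth_prime_inj : injective nth_prime.
Proof.
move=> i j e; apply/eqP; rewrite eqn_leq leqNgt -nth_prime_mono e ltnn/=.
by rewrite leqNgt -nth_prime_mono e ltnn.
Qed.

Lemma nth_prime_gtn j : (j < nth_prime j)%N.
Proof.
elim: j => [|j ih]; first exact: prime_gt0 (nth_prime_prime 0).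
exact: leq_ltn_trans ih (nth_prime_ltS j).
Qed.

Lemma nth_prime_surj p : prime p -> exists j, nth_prime j = p.
Proof.
move=> prp.
suff h : forall j, (forall i, (i < j)%N -> nth_prime i != p) -> (iter j next_prime 0 < p)%N.
  apply: contrapT => nex.
  have := h p.+1 _; rewrite ltnNge (ltnW (nth_prime_gtn p))/= => H.
  by suff : false by []; apply: H => i _; apply/eqP => e; apply: nex; exists i.
elim=> [|j ih] H; first exact: prime_gt0.
have /ih lt : forall i, (i < j)%N -> nth_prime i != p.
  by move=> i ij; apply: H; exact: ltnW.
rewrite iterS ltn_neqAle; apply/andP; split; first exact: (H j).
by case: (next_primeP (iter j next_prime 0%N)) => _ _; apply.
Qed.

Lemma logn_nth_prime_small j n : (n <= j)%N -> logn (nth_prime j) n = 0%N.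
Proof.
move=> nj; rewrite lognE; case: ifP => // /and3P[_ n0 dv].
by have := dvdn_leq n0 dv; rewrite leqNgt (leq_ltn_trans nj (nth_prime_gtn j)).
Qed.

Lemma coprime_logn n m j : coprime n m ->
  logn (nth_prime j) n = 0%N \/ logn (nth_prime j) m = 0%N.
Proof.
move=> cop; have prp := nth_prime_prime j; set p := nth_prime j in prp *.
have [|n0] := posnP (logn p n); [by left|right].
rewrite lognE prp /=; case: ifP => // /andP[_ pm].
have pn : (p %| n)%N by move: n0; rewrite logn_gt0 mem_primes => /and3P[].
have : (p %| gcdn n m)%N by rewrite dvdn_gcd pn.
by rewrite (eqP cop) Euclid_dvd1.
Qed.

(** Unique factorization. *)
Lemma logn_nth_prime_inj n m : (0 < n)%N -> (0 < m)%N ->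
  (forall j, logn (nth_prime j) n = logn (nth_prime j) m) -> n = m.
Proof.
move=> n0 m0 h; apply: eqn_from_log => // p.
have [/nth_prime_surj[j <-]|np] := boolP (prime p); first exact: h.
by rewrite lognE (negbTE np)/= lognE (negbTE np).
Qed.

End Primes.

Section Monom.
Implicit Types (S : comNzRingType) (n m j k K : nat).

(** The Bohr monomial over an arbitrary commutative ring, so that the radii of
    polydiscs, which are real, and their points, which are complex, obey the same
    rules. *)
Definition monom S n (x : nat -> S) : S :=
  \prod_(j < n) x j ^+ logn (nth_prime j) n.

Lemma bohr_monomialE (R : realType) n (x : nat -> R[i]) :
  bohr_monomial n x = monom n x.
Proof. by []. Qed.

Lemma monom_widen S K n (x : nat -> S) : (n <= K)%N ->
  monom n x = \prod_(j < K) x j ^+ logn (nth_prime j) n.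
Proof.
move=> nK; rewrite /monom (big_ord_widen K (fun j => x j ^+ logn (nth_prime j) n) nK).
rewrite [RHS](bigID (fun j : 'I_K => (j < n)%N))/= [X in _ * X]big1 ?mulr1//.
by move=> j; rewrite -leqNgt => nj; rewrite logn_nth_prime_small// expr0.
Qed.

Lemma eq_monom S n (x y : nat -> S) :
  (forall j, (0 < logn (nth_prime j) n)%N -> x j = y j) -> monom n x = monom n y.
Proof.
move=> h; apply: eq_bigr => j _.
by have [->|/h->//] := posnP (logn (nth_prime j) n).
Qed.

Lemma monom1 S (x : nat -> S) : monom 1 x = 1.
Proof. by rewrite /monom big_ord_recl big_ord0 mulr1 logn1 expr0. Qed.

Lemma monomM S n m (x : nat -> S) : (0 < n)%N -> (0 < m)%N ->
  monom (n * m) x = monom n x * monom m x.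
Proof.
move=> n0 m0; rewrite (@monom_widen _ (n * m) n) ?leq_pmulr//.
rewrite (@monom_widen _ (n * m) m) ?leq_pmull// (@monom_widen _ (n * m))//.
by rewrite -big_split/=; apply: eq_bigr => j _; rewrite lognM// exprD.
Qed.

Lemma monom_expn S n k (x : nat -> S) : (0 < n)%N ->
  monom (n ^ k) x = monom n x ^+ k.
Proof.
move=> n0; elim: k => [|k ih]; first by rewrite expn0 expr0 monom1.
by rewrite expnS monomM ?expn_gt0 ?n0// ih exprS.
Qed.

Lemma monom_prime S j (x : nat -> S) : monom (nth_prime j) x = x j.
Proof.
rewrite /monom (bigD1 (Ordinal (nth_prime_gtn j)))//= big1 ?mulr1 => [|i ij].
  by rewrite logn_prime ?nth_prime_prime// eqxx expr1.
rewrite logn_prime ?nth_prime_prime// (inj_eq nth_prime_inj).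
case: eqVneq => [e|//]; rewrite ?expr0//.
by case/negP: ij; apply/eqP/val_inj; rewrite /= e.
Qed.

Lemma monom_mul S n (x y : nat -> S) :
  monom n (fun j => x j * y j) = monom n x * monom n y.
Proof. by rewrite -big_split/=; apply: eq_bigr => j _; rewrite exprMn. Qed.

Lemma monom_morph S (S' : comNzRingType) (f : S -> S') n x :
  {morph f : a b / a * b} -> f 1 = 1 -> f (monom n x) = monom n (fun j => f (x j)).
Proof.
move=> fM f1; rewrite /monom (big_morph f fM f1); apply: eq_bigr => j _.
by elim: (logn _ _) => [|k ih]; rewrite ?expr0// !exprS fM ih.
Qed.

(** A completely multiplicative function is determined by its values at the
    primes. *)
Lemma monom_mult S (g : nat -> S) n : (0 < n)%N ->
  g 1%N = 1 -> (forall a b, (0 < a)%N -> (0 < b)%N -> g (a * b)%N = g a * g b) ->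
  monom n (fun j => g (nth_prime j)) = g n.
Proof.
move=> + g1 gM; elim/ltn_ind: n => n ih n0.
have [n1|n1] := leqP n 1.
  have -> : n = 1%N by apply/eqP; rewrite eqn_leq n1.
  by rewrite monom1 g1.
have [j pE] := nth_prime_surj (pdiv_prime n1).
have := pdiv_dvd n; rewrite -pE => /dvdnP[k nE].
have k0 : (0 < k)%N by move: n0; rewrite nE; case: (k).
have p0 := prime_gt0 (nth_prime_prime j).
rewrite nE monomM// gM// monom_prime ih//.
by rewrite nE ltn_Pmulr// prime_gt1// nth_prime_prime.
Qed.

Definition upd S (x : nat -> S) j (z : S) : nat -> S :=
  fun i => if i == j then z else x i.

Lemma monom_upd S n (x : nat -> S) j (z : S) :
  monom n (upd x j z) = z ^+ logn (nth_prime j) n * monom n (upd x j 1).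
Proof.
rewrite (@monom_widen _ (maxn n j.+1)) ?leq_maxl//.
rewrite (@monom_widen _ (maxn n j.+1)) ?leq_maxl//.
have jK : (j < maxn n j.+1)%N by rewrite leq_max ltnSn orbT.
rewrite (bigD1 (Ordinal jK))//= [in RHS](bigD1 (Ordinal jK))//=.
rewrite /upd eqxx expr1n mul1r; congr (_ * _); apply: eq_bigr => i ij.
by case: eqVneq => // e; case/negP: ij; apply/eqP/val_inj.
Qed.

End Monom.

Section RealMonom.
Variable R : realType.
Local Notation C := R[i].
Implicit Types (n : nat) (x y : nat -> R) (z : nat -> C).

Lemma monom_ge0 n x : (forall j, 0 <= x j) -> 0 <= monom n x.
Proof. by move=> x0; apply: prodr_ge0 => j _; rewrite exprn_ge0. Qed.

Lemma monom_gt0 n x : (forall j, 0 < x j) -> 0 < monom n x.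
Proof. by move=> x0; apply: prodr_gt0 => j _; rewrite exprn_gt0. Qed.

Lemma le_monom n x y : (forall j, 0 <= x j <= y j) -> monom n x <= monom n y.
Proof.
move=> xy; apply: ler_prod => j _; have /andP[x0 xyj] := xy j.
by rewrite exprn_ge0//= lerXn2r// nnegrE (le_trans x0).
Qed.

Lemma normc_monom n z : normc (monom n z) = monom n (fun j => normc (z j)).
Proof. by apply: monom_morph; [exact: normcM|exact: normc1]. Qed.

Lemma monom_real n x : (monom n x)%:C = monom n (fun j => (x j)%:C).
Proof. by apply: monom_morph; [exact: rmorphM|exact: rmorph1]. Qed.

Lemma monom_unit n z : (forall j, normc (z j) = 1) -> normc (monom n z) = 1.
Proof.
by move=> z1; rewrite normc_monom /monom big1// => j _; rewrite z1 expr1n.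
Qed.

End RealMonom.

(** * Polynomial approximation *)

Section Bernstein.
Variable R : realType.
Implicit Types (g h : nat -> R) (x c : R) (n k : nat).

(** The Bernstein polynomial of [g]: the mean of [g] at the endpoint of a random
    walk with [n] steps of length [0] or [1], as a polynomial in the probability of
    a step of length [1]. Conditioning on the first step avoids binomial
    coefficients. *)
Fixpoint bernstein n g : {poly R} :=
  if n is n'.+1 then
    (1 - 'X) * bernstein n' g + 'X * bernstein n' (fun k => g k.+1)
  else (g 0%N)%:P.

Lemma bernsteinS n g x : (bernstein n.+1 g).[x] =
  (1 - x) * (bernstein n g).[x] + x * (bernstein n (fun k => g k.+1)).[x].
Proof. by rewrite /= hornerD !hornerM hornerD hornerN hornerX hornerC. Qed.

Lemma bernstein_le n g h x : 0 <= x <= 1 ->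
  (forall k, (k <= n)%N -> g k <= h k) -> (bernstein n g).[x] <= (bernstein n h).[x].
Proof.
move=> /andP[x0 x1]; elim: n g h => [|n ih] g h gh; first by rewrite !hornerC gh.
by rewrite !bernsteinS lerD// ler_wpM2l ?subr_ge0// ih// => k kn; apply: gh; rewrite // ltnW.
Qed.

Lemma bernsteinD n g h x :
  (bernstein n (fun k => g k + h k)).[x] = (bernstein n g).[x] + (bernstein n h).[x].
Proof.
elim: n g h => [|n ih] g h; first by rewrite !hornerC.
rewrite !bernsteinS.
rewrite (ih g h) (ih (fun k => g k.+1) (fun k => h k.+1)).
by ring.
Qed.

Lemma bernsteinZ n g c x :
  (bernstein n (fun k => c * g k)).[x] = c * (bernstein n g).[x].
Proof.
elim: n g => [|n ih] g; first by rewrite !hornerC.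
by rewrite !bernsteinS (ih g) (ih (fun k => g k.+1)); ring.
Qed.

Lemma bernstein_cst n c x : (bernstein n (fun=> c)).[x] = c.
Proof. elim: n => [|n ih]; first by rewrite !hornerC.
by rewrite !bernsteinS ih; ring. Qed.

Lemma bernstein_sqr n c x :
  (bernstein n (fun k => (k%:R - c) ^+ 2)).[x] = n%:R * (x * (1 - x)) + (n%:R * x - c) ^+ 2.
Proof.
elim: n c => [|n ih] c; first by rewrite hornerC mul0r add0r; ring.
have e : (fun k => (k.+1%:R - c) ^+ 2) = (fun k => (k%:R - (c - 1)) ^+ 2) :> (nat -> R).
  by apply/funext => k; rewrite -natr1; congr (_ ^+ 2); ring.
by rewrite bernsteinS e !ih -natr1; ring.
Qed.

(** Chebyshev's inequality: a modulus of continuity of quadratic type bounds the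
    error of the Bernstein polynomials by their variance, at most [1 / n]. *)
Lemma bernstein_approx (f : R -> R) (eta K : R) : 0 < eta -> 0 <= K ->
  (forall u v : R, 0 <= u <= 1 -> 0 <= v <= 1 -> `|f u - f v| <= eta + K * (u - v) ^+ 2) ->
  exists q : {poly R}, forall x, 0 <= x <= 1 -> `|f x - q.[x]| <= 2 * eta.
Proof.
move=> eta0 K0 fK; pose n := (Num.truncn (K / eta)).+1.
have n0 : 0 < n%:R :> R by rewrite ltr0n.
have Kn : K / n%:R <= eta.
  rewrite ler_pdivrMr// mulrC -ler_pdivrMr// ltW//.
  by rewrite /n truncnS_gt.
exists (bernstein n (fun k => f (k%:R / n%:R))) => x x01.
have kn1 k : (k <= n)%N -> 0 <= (k%:R / n%:R : R) <= 1.
  by move=> kn; rewrite divr_ge0//= ler_pdivrMr// mul1r ler_nat.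
pose V := (bernstein n (fun k => eta + K * (x - k%:R / n%:R) ^+ 2)).[x].
have VE : V <= 2 * eta.
  rewrite /V bernsteinD bernstein_cst bernsteinZ.
  have -> : (fun k => (x - k%:R / n%:R) ^+ 2) =
            (fun k => n%:R ^- 2 * (k%:R - n%:R * x) ^+ 2) :> (nat -> R).
    by apply/funext => k; field; rewrite gt_eqF.
  rewrite bernsteinZ bernstein_sqr.
  have -> : K * (n%:R ^- 2 * (n%:R * (x * (1 - x)) + (n%:R * x - n%:R * x) ^+ 2)) =
            K / n%:R * (x * (1 - x)) by field; rewrite gt_eqF.
  have Kn0 : 0 <= K / n%:R by rewrite divr_ge0// ltW.
  case/andP: x01 => x0 x1.
  have xx : x * (1 - x) <= 1 by nra.
  have : K / n%:R * (x * (1 - x)) <= K / n%:R by rewrite ler_piMr.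
  lra.
have fx : f x = (bernstein n (fun=> f x)).[x] by rewrite bernstein_cst.
rewrite ler_norml; apply/andP; split.
  rewrite lerNl opprB lerBlDr; apply: le_trans (_ : V + f x <= _); last by rewrite lerD2r.
  rewrite [in leRHS]fx -bernsteinD; apply: bernstein_le => // k kn.
  have := fK _ _ x01 (kn1 k kn); rewrite ler_norml; lra.
rewrite lerBlDr.
apply: le_trans (_ : V + (bernstein n (fun k => f (k%:R / n%:R))).[x] <= _); last by rewrite lerD2r.
rewrite [in leLHS]fx -bernsteinD; apply: bernstein_le => // k kn.
have := fK _ _ x01 (kn1 k kn); rewrite ler_norml; lra.
Qed.

Lemma ln1D_lipschitz x y : 0 <= x -> 0 <= y ->
  `|ln (1 + x) - ln (1 + y)| <= `|x - y|.
Proof.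
wlog xy : x y / y <= x => [H x0 y0|x0 y0].
  have [/H|/ltW/H] := leP y x; first exact.
  by rewrite distrC (distrC y x); apply.
have e : x = y + (x - y) by ring.
rewrite !ger0_norm ?subr_ge0 ?le_ln1D// [in leLHS]e lerBlDl.
apply: le_trans (ln1D_add _ _) _; rewrite ?subr_ge0// lerD2l ln1D_le// subr_ge0//.
Qed.

(** The argument is squared because the square of the modulus of a trigonometric
    polynomial is again one, while the modulus is not. *)
Lemma ln1D_approx (M e : R) : 0 < M -> 0 < e ->
  exists q : {poly R}, forall x, 0 <= x <= M -> `|ln (1 + x) - q.[x ^+ 2]| <= e.
Proof.
move=> M0 e0; pose f u := ln (1 + M * Num.sqrt u).
pose eta := e / 2; pose K := M ^+ 4 / eta ^+ 3.
have eta0 : 0 < eta by rewrite divr_gt0.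
have [||u v /andP[u0 u1] /andP[v0 v1]|q qP] := @bernstein_approx f eta K => //.
- by rewrite divr_ge0 ?exprn_ge0 ?(ltW M0) ?(ltW eta0)//.
- apply: le_trans (ln1D_lipschitz _ _) _; rewrite ?mulr_ge0 ?sqrtr_ge0 ?(ltW M0)//.
  rewrite -{2}(sqr_sqrtr u0) -{2}(sqr_sqrtr v0).
  have := sqrtr_ge0 u; have := sqrtr_ge0 v.
  move: (Num.sqrt u) (Num.sqrt v) => a b b0 a0; rewrite -mulrBr normrM gtr0_norm//.
  pose d : R := `|a - b|.
  have d0 : 0 <= d by rewrite /d normr_ge0.
  (* with [d = |a - b|]: either [M d <= eta], or [M d <= (M d) ^ 4 / eta ^ 3] *)
  have dle : d ^+ 4 <= (a ^+ 2 - b ^+ 2) ^+ 2.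
    rewrite -[leRHS]real_normK ?num_real// subr_sqr normrM -/d.
    rewrite (_ : d ^+ 4 = (d * d) ^+ 2); last by ring.
    rewrite lerXn2r ?nnegrE ?mulr_ge0// ler_wpM2l// /d.
    by rewrite (ger0_norm (addr_ge0 a0 b0)) ler_norml; lra.
  have [le|/ltW le] := leP (M * d) eta.
    by rewrite -/d (le_trans le)// lerDl mulr_ge0// ?sqr_ge0// divr_ge0 ?exprn_ge0 ?(ltW M0) ?(ltW eta0)//.
  rewrite -/d; apply: le_trans (_ : K * d ^+ 4 <= _).
    rewrite /K mulrAC -exprMn ler_pdivlMr ?exprn_gt0//.
    rewrite [leRHS]exprS ler_wpM2l ?mulr_ge0 ?(ltW M0)//.
    by rewrite lerXn2r ?nnegrE// ?(ltW eta0)// mulr_ge0// ltW.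
  rewrite ler_wpDl ?(ltW eta0)// ler_wpM2l// divr_ge0 ?exprn_ge0 ?(ltW M0) ?(ltW eta0)//.
exists (q \Po (M ^- 2 *: 'X)) => x /andP[x0 xM].
have xM1 : 0 <= (x / M) ^+ 2 <= 1.
  rewrite sqr_ge0/= expr_le1 ?divr_ge0 ?(ltW M0)//.
  by rewrite ler_pdivrMr// mul1r.
have := qP _ xM1; rewrite /f sqrtr_sqr (ger0_norm (divr_ge0 x0 (ltW M0))).
rewrite mulrCA divff ?gt_eqF// mulr1 horner_comp hornerZ hornerX /eta.
rewrite (_ : M ^- 2 * x ^+ 2 = (x / M) ^+ 2); last by rewrite exprMn exprVn mulrC.
by rewrite [2 * _]mulrC divfK.
Qed.

End Bernstein.

(** * Means over the torus and over intervals *)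

Section ComplexMeasurable.
Context d (T : measurableType d) (R : realType).
Local Notation C := R[i].
Implicit Types (f g : T -> C).

Definition cmeasurable f : Prop :=
  measurable_fun setT (fun x => complex.Re (f x)) /\
  measurable_fun setT (fun x => complex.Im (f x)).

Lemma cmeasurable_cst (c : C) : cmeasurable (fun=> c).
Proof. by split; exact: measurable_cst. Qed.

Lemma cmeasurableD f g : cmeasurable f -> cmeasurable g ->
  cmeasurable (fun x => f x + g x).
Proof.
move=> [f1 f2] [g1 g2]; split.
  by under eq_fun do rewrite Re_add; exact: measurable_funD.
by under eq_fun do rewrite Im_add; exact: measurable_funD.
Qed.

Lemma cmeasurableM f g : cmeasurable f -> cmeasurable g ->
  cmeasurable (fun x => f x * g x).
Proof.
move=> [f1 f2] [g1 g2]; split.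
  by under eq_fun do rewrite Re_mul; apply: measurable_funB; exact: measurable_funM.
by under eq_fun do rewrite Im_mul; apply: measurable_funD; exact: measurable_funM.
Qed.

Lemma cmeasurable_conj f : cmeasurable f -> cmeasurable (fun x => (f x)^*%C).
Proof.
move=> [f1 f2]; split; first by under eq_fun do rewrite Re_conj.
have -> : (fun x => complex.Im (f x)^*%C) = (fun x => - complex.Im (f x)).
  by apply/funext => x; case: (f x).
exact: measurableT_comp.
Qed.

Lemma cmeasurable_sum (I : Type) (r : seq I) (P : pred I) (F : I -> T -> C) :
  (forall i, cmeasurable (F i)) -> cmeasurable (fun x => \sum_(i <- r | P i) F i x).
Proof.
move=> mF; elim: r => [|i r ih].
  by under eq_fun do rewrite big_nil; exact: cmeasurable_cst.
have [Pi|Pi] := boolP (P i).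
  by under eq_fun do rewrite big_cons Pi; exact: cmeasurableD.
by under eq_fun do rewrite big_cons (negbTE Pi).
Qed.

Lemma cmeasurableX f n : cmeasurable f -> cmeasurable (fun x => f x ^+ n).
Proof.
move=> mf; elim: n => [|n ih]; first by under eq_fun do rewrite expr0; exact: cmeasurable_cst.
by under eq_fun do rewrite exprS; exact: cmeasurableM.
Qed.

Lemma cmeasurable_monom n (z : T -> nat -> C) :
  (forall j, cmeasurable (fun x => z x j)) -> cmeasurable (fun x => monom n (z x)).
Proof.
move=> mz; rewrite /monom; elim: (index_enum _) => [|i r ih].
  by under eq_fun do rewrite big_nil; exact: cmeasurable_cst.
by under eq_fun do rewrite big_cons; apply: cmeasurableM => //; exact: cmeasurableX.
Qed.

Lemma measurable_normc f : cmeasurable f -> measurable_fun setT (fun x => normc (f x)).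
Proof.
move=> [f1 f2].
have -> : (fun x => normc (f x)) =
  Num.sqrt \o (fun x => complex.Re (f x) ^+ 2 + complex.Im (f x) ^+ 2).
  by apply/funext => x /=; case: (f x).
apply: (@measurableT_comp _ _ _ _ _ _ (@Num.sqrt R)); first by apply: continuous_measurable_fun; exact: sqrt_continuous.
by apply: measurable_funD; exact: measurable_funX.
Qed.

Lemma measurable_ln1D_normc f : cmeasurable f ->
  measurable_fun setT (fun x => ln (1 + normc (f x))).
Proof.
move=> mf; apply: (@measurableT_comp _ _ _ _ _ _ (@ln R)); first exact: measurable_ln.
by apply: measurable_funD => //; exact: measurable_normc.
Qed.

Lemma cmeasurable_cvg (F : nat -> T -> C) f : (forall n, cmeasurable (F n)) ->
  (forall x e, 0 < e -> exists N, forall n, (N <= n)%N -> normc (F n x - f x) <= e) ->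
  cmeasurable f.
Proof.
move=> mF Ff; split.
  apply: (@measurable_fun_cvg _ _ _ _ (fun n x => complex.Re (F n x))) => [n|x _].
    by case: (mF n).
  apply/cvgrPdist_le => e e0; have [N NP] := Ff x e e0.
  exists N => // n /= /NP; apply: le_trans.
  by rewrite distrC -Re_opp -Re_add ler_absRe_normc.
apply: (@measurable_fun_cvg _ _ _ _ (fun n x => complex.Im (F n x))) => [n|x _].
  by case: (mF n).
apply/cvgrPdist_le => e e0; have [N NP] := Ff x e e0.
exists N => // n /= /NP; apply: le_trans.
by rewrite distrC -Im_opp -Im_add ler_absIm_normc.
Qed.

End ComplexMeasurable.

Section Mean.
Context d (T : measurableType d) (R : realType).
Variables (mu : {measure set T -> \bar R}) (D : set T).
Hypotheses (mD : measurable D) (muD0 : (0 < mu D)%E) (muDoo : (mu D < +oo)%E).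
Implicit Types (f g : T -> R).

(** Every function whose mean is taken is of this kind; on a set of finite measure,
    such functions are integrable. *)
Definition tame f : Prop :=
  measurable_fun setT f /\ exists M, forall x, `|f x| <= M.

Definition mean f : R := (fine (mu D))^-1 * Rintegral mu D f.

Lemma tame_integrable f : tame f -> mu.-integrable D (EFin \o f).
Proof.
move=> [mf [M fM]]; apply: measurable_bounded_integrable => //.
  exact: measurable_funTS.
by exists M; split; [exact: num_real|move=> y My x _; apply: le_trans (fM x) (ltW My)].
Qed.

Lemma fine_mu_gt0 : 0 < fine (mu D).
Proof. by rewrite fine_gt0// muD0 muDoo. Qed.

Lemma mean_le f g : tame f -> tame g -> (forall x, f x <= g x) -> mean f <= mean g.
Proof.
move=> tf tg fg; rewrite /mean ler_wpM2l ?invr_ge0 ?(ltW fine_mu_gt0)//.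
by apply: le_Rintegral => //; exact: tame_integrable.
Qed.

Lemma mean_cst c : mean (fun=> c) = c.
Proof.
by rewrite /mean Rintegral_cst// mulrCA mulVf ?mulr1// gt_eqF// fine_mu_gt0.
Qed.

Lemma meanD f g : tame f -> tame g -> mean (fun x => f x + g x) = mean f + mean g.
Proof.
move=> tf tg; rewrite /mean -mulrDr; congr (_ * _).
by rewrite -RintegralD//; exact: tame_integrable.
Qed.

Lemma tame_cst c : tame (fun=> c).
Proof. by split; [exact: measurable_cst|exists `|c|]. Qed.

Lemma tameD f g : tame f -> tame g -> tame (fun x => f x + g x).
Proof.
move=> [mf [M fM]] [mg [K gK]]; split; first exact: measurable_funD.
by exists (M + K) => x; apply: le_trans (ler_normD _ _) (lerD _ _).
Qed.

Lemma meanDc f c : tame f -> mean (fun x => f x + c) = mean f + c.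
Proof. by move=> tf; rewrite meanD ?mean_cst//; exact: tame_cst. Qed.

Lemma mean_dist f g e : tame f -> tame g -> (forall x, `|f x - g x| <= e) ->
  `|mean f - mean g| <= e.
Proof.
move=> tf tg fg; rewrite ler_distl lerBlDr -!meanDc//; apply/andP; split;
  apply: mean_le => //; try (by apply: tameD => //; exact: tame_cst);
  by move=> x; move: (fg x); rewrite ler_distl lerBlDr => /andP[].
Qed.

Lemma tame_Re_normc (F : T -> R[i]) M : cmeasurable F -> (forall x, normc (F x) <= M) ->
  tame (fun x => complex.Re (F x)).
Proof.
move=> [mF _] FM; split=> //; exists M => x.
exact: le_trans (ler_absRe_normc _) (FM x).
Qed.

Lemma tame_ln1D_normc (F : T -> R[i]) M : cmeasurable F -> (forall x, normc (F x) <= M) ->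
  tame (fun x => ln (1 + normc (F x))).
Proof.
move=> mF FM; split; first exact: measurable_ln1D_normc.
exists M => x; rewrite ger0_norm ?ln1D_ge0 ?normc_ge0//.
exact: le_trans (ln1D_le (normc_ge0 _)) (FM x).
Qed.

End Mean.

(** * Characters of the infinite torus *)

Section Characters.
Variable R : realType.
Local Notation C := R[i].
Implicit Types (x t : R) (z : nat -> C) (n k : nat).

Definition cis x : C := cos x +i* sin x.

Lemma cis0 : cis 0 = 1.
Proof. by rewrite /cis cos0 sin0. Qed.

Lemma cisD x t : cis (x + t) = cis x * cis t.
Proof. by rewrite /cis cosD sinD; simpc; congr (_ +i* _); rewrite addrC mulrC. Qed.

Lemma cis_pi : cis pi = -1.
Proof. by rewrite /cis cospi sinpi; apply/eqP; rewrite eq_complex /= oppr0 !eqxx. Qed.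

Lemma normc_cis x : normc (cis x) = 1.
Proof. by rewrite /= cos2Dsin2 sqrtr1. Qed.

Lemma conj_cis x : (cis x)^*%C = cis (- x).
Proof. by rewrite /cis cosN sinN. Qed.

Lemma cisX x k : cis x ^+ k = cis (k%:R * x).
Proof.
elim: k => [|k ih]; first by rewrite expr0 mul0r cis0.
by rewrite exprS ih -cisD -natr1 mulrDl mul1r addrC.
Qed.

(** On the torus, this is the character attached to the rational [n / k]. *)
Definition chi n k z : C := monom n z * (monom k z)^*%C.

Lemma chi_mul n k z z' : chi n k (fun j => z j * z' j) = chi n k z * chi n k z'.
Proof. by rewrite /chi !monom_mul rmorphM/= mulrACA. Qed.

Lemma normc_chi n k z : (forall j, normc (z j) = 1) -> normc (chi n k z) = 1.
Proof. by move=> z1; rewrite normcM normc_conj !monom_unit// mulr1. Qed.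

Lemma chi_diag n z : (forall j, normc (z j) = 1) -> chi n n z = 1.
Proof. by move=> z1; rewrite /chi mulc_conj monom_unit// expr1n. Qed.

(** Distinct integers have distinct exponents at some prime; rotating that one
    coordinate negates the character. *)
Lemma chi_neg n k : (0 < n)%N -> (0 < k)%N -> n != k ->
  exists2 z, forall j, normc (z j) = 1 & chi n k z = -1.
Proof.
move=> n0 k0 nk.
have [j ej] : exists j, logn (nth_prime j) n != logn (nth_prime j) k.
  apply: contrapT => H; case/eqP: nk; apply: logn_nth_prime_inj => // j.
  by apply/eqP; apply: contrapT => h; apply: H; exists j; apply/negP.
set e := logn _ n in ej; set e' := logn _ k in ej.
have ee0 : e%:R - e'%:R != 0 :> R by rewrite subr_eq0 eqr_nat.
pose theta := pi / (e%:R - e'%:R) : R.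
exists (upd (fun=> 1) j (cis theta)) => [i|].
  by rewrite /upd; case: eqP => _; rewrite ?normc_cis ?normc1.
have u1 i : monom i (upd (fun=> 1 : C) j 1) = 1.
  by rewrite /monom big1// => l _; rewrite /upd; case: ifP => _; rewrite expr1n.
rewrite /chi (monom_upd n) (monom_upd k) !u1 !mulr1 -/e -/e' !cisX conj_cis -cisD -mulrBl.
by rewrite /theta mulrC divfK// cis_pi.
Qed.

(** Trigonometric polynomials are lists of coefficients with characters, rather than
    functions on the torus, because their extension to the polydisc and their mean
    are read off such a list. *)
Definition tpoly := seq (C * (nat * nat)).
Implicit Types s : tpoly.

Definition teval s z : C := \sum_(t <- s) t.1 * chi t.2.1 t.2.2 z.

(** Away from the torus, the real part of [teval] is harmonic in each variable when
    no term contains a variable both directly and conjugated. *)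
Definition reduced s : bool :=
  all (fun a : C * (nat * nat) => [&& (0 < a.2.1)%N, (0 < a.2.2)%N & coprime a.2.1 a.2.2]) s.

Definition tpositive s : bool := all (fun a : C * (nat * nat) => (0 < a.2.1)%N && (0 < a.2.2)%N) s.

Definition tmean s : C := \sum_(t <- s | t.2.1 == t.2.2) t.1.

Lemma reduced_positive s : reduced s -> tpositive s.
Proof. by apply: sub_all => t /and3P[-> ->]. Qed.

Lemma normc_teval s z : (forall j, normc (z j) = 1) ->
  normc (teval s z) <= \sum_(t <- s) normc t.1.
Proof.
move=> z1; apply: le_trans (ler_normc_sum _ _ _) _; apply: ler_sum => t _.
by rewrite normcM normc_chi// mulr1.
Qed.

(** A reduced character other than the constant one vanishes at the origin. *)
Lemma teval0 s : reduced s -> teval s (fun=> 0) = tmean s.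
Proof.
move=> rs; rewrite /teval /tmean [RHS]big_mkcond/= !big_seq; apply: eq_bigr => t ts.
have /and3P[n0 k0 cop] := allP rs t ts.
have mon0 n : (0 < n)%N -> monom n (fun=> 0 : C) = (n == 1%N)%:R.
  move=> n0'; have [->|n1] := eqVneq n 1%N; first by rewrite monom1.
  have n1' : (1 < n)%N by rewrite ltn_neqAle eq_sym n1.
  have [j pE] := nth_prime_surj (pdiv_prime n1').
  have jn : (j < n)%N.
    apply: leq_trans (nth_prime_gtn j) _; rewrite pE; exact: dvdn_leq (pdiv_dvd n).
  rewrite /monom (bigD1 (Ordinal jn))//= expr0n (_ : _ == _ = false) ?mul0r//.
  by apply/negbTE; rewrite -lt0n logn_gt0 pE mem_primes pdiv_prime// n0' pdiv_dvd.
rewrite /chi !mon0// rmorph_nat -natrM mulnb.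
have -> : (t.2.1 == 1%N) && (t.2.2 == 1%N) = (t.2.1 == t.2.2).
  apply/andP/eqP => [[/eqP-> /eqP->//]|e].
  by move: cop; rewrite e /coprime gcdnn => ->.
by case: eqP; rewrite ?mulr1 ?mulr0.
Qed.

End Characters.

Section Torus.
Variable R : realType.
Local Notation C := R[i].
Implicit Types (w u : Tinf R) (z : nat -> C).

Definition tpoint w : nat -> C := fun j => val (w j).

Lemma normc_tpoint w j : normc (tpoint w j) = 1.
Proof. by rewrite /tpoint; case: (w j) => z /=; rewrite inE. Qed.

Definition circle_of (z : C) (h : normc z = 1) : circle R :=
  exist (fun y : C => y \in @unit_circle R) z (mem_set h).

Lemma tpoint_surj z : (forall j, normc (z j) = 1) -> exists w, tpoint w = z.
Proof. by move=> h; exists (fun j => circle_of (h j)); apply/funext. Qed.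

Lemma tpoint_mul u w : tpoint (Tinf_mul u w) = fun j => tpoint u j * tpoint w j.
Proof. by []. Qed.

Lemma Tinf_coord_continuous j : continuous (fun w : Tinf R => w j).
Proof. exact: (@proj_continuous nat (fun=> circle R) j). Qed.

Lemma circle_val_continuous : continuous (fun v : circle R => val v : C).
Proof. exact: initial_continuous. Qed.

Lemma tpoint_continuous j : continuous (fun w : Tinf R => tpoint w j).
Proof.
move=> w; apply: (@continuous_comp _ _ _ (fun w : Tinf R => w j) (fun v => val v : C)).
  exact: Tinf_coord_continuous.
exact: circle_val_continuous.
Qed.

Lemma Tinf_continuous_measurable (f : Tinf R -> R) : continuous f ->
  measurable_fun setT (f : Tinf_borel R -> R).
Proof.
move=> /continuousP cf; apply: (measurability _ (RGenOInfty.measurableE R)).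
move=> _ [_ [x ->] <-]; rewrite setTI; apply: sub_sigma_algebra.
exact: cf.
Qed.

Lemma near_normc (z : C) (e : R) : 0 < e ->
  \forall t \near z, normc (z - t) < e.
Proof.
move=> e0; apply/(@nbhs_ballP C (C^o)); exists e%:C => /=; first by rewrite ltcR.
by move=> y; rewrite /ball /= ltcR.
Qed.

Lemma Re_continuous : continuous (fun z : C => complex.Re z).
Proof.
move=> z; apply/(@cvgrPdist_le _ _ _ _ (nbhs_filter (z : C^o))) => e e0.
apply: filterS (near_normc z e0) => y /ltW.
by apply: le_trans; rewrite -Re_opp -Re_add ler_absRe_normc.
Qed.

Lemma Im_continuous : continuous (fun z : C => complex.Im z).
Proof.
move=> z; apply/(@cvgrPdist_le _ _ _ _ (nbhs_filter (z : C^o))) => e e0.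
apply: filterS (near_normc z e0) => y /ltW.
by apply: le_trans; rewrite -Im_opp -Im_add ler_absIm_normc.
Qed.

Lemma cmeasurable_tpoint j : cmeasurable (fun w : Tinf_borel R => tpoint w j).
Proof.
split; apply: Tinf_continuous_measurable => w.
  by apply: (continuous_comp (@tpoint_continuous j w)); exact: Re_continuous.
by apply: (continuous_comp (@tpoint_continuous j w)); exact: Im_continuous.
Qed.

Lemma Tinf_mul_continuous u : continuous (Tinf_mul u).
Proof.
move=> w; pose G : set_system (nat -> circle R) := fmap (Tinf_mul u) (nbhs (w : Tinf R)).
have F : Filter (nbhs (w : Tinf R)) by exact: nbhs_filter.
have FG : Filter G by exact: fmap_filter.
have [_] := @cvg_sup _ _ (fun i : nat => Topological.class
  (initial_topology (fun f : nat -> circle R => f i))) G (Tinf_mul u w) FG.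
apply=> j; have := @continuous_comp_initial (nat -> circle R) (Tinf R) _
  (fun f : nat -> circle R => f j) (Tinf_mul u).
apply.
apply: (@continuous_comp_initial _ _ _ (fun v : circle R => val v : C)
  (fun w : Tinf R => Tinf_mul u w j)).
move=> w'; rewrite /comp /=.
have mc : {for tpoint w' j, continuous (fun z : C => val (u j) * z)}.
  exact: (@mulrl_continuous C (val (u j)) (tpoint w' j)).
exact: (@continuous_comp (Tinf R) C C (fun w => tpoint w j) _ w'
  (@tpoint_continuous j w') mc).
Qed.

Lemma measurable_Tinf_mul u :
  measurable_fun setT (Tinf_mul u : Tinf_borel R -> Tinf_borel R).
Proof.
apply: (@measurability _ _ (Tinf_borel R) (Tinf_borel R) setT (Tinf_mul u)
  (@open (Tinf R)) erefl).
move=> _ [A oA <-]; rewrite setTI; apply: sub_sigma_algebra.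
by have /continuousP := @Tinf_mul_continuous u; exact.
Qed.

Variable m : probability (Tinf_borel R) R.
Hypothesis hm : is_haar m.

Lemma m_setT_gt0 : (0 < m setT)%E.
Proof. by rewrite probability_setT. Qed.

Lemma m_setT_lty : (m setT < +oo)%E.
Proof. by rewrite probability_setT ltry. Qed.

Lemma mean_Tinf_mul u (f : Tinf_borel R -> R) : tame f ->
  mean m setT (fun w => f (Tinf_mul u w)) = mean m setT f.
Proof.
move=> tf; rewrite /mean /Rintegral; congr (_ * fine _).
have tfu : tame (fun w : Tinf_borel R => f (Tinf_mul u w)).
  case: tf => mf [M fM]; split; last by exists M.
  exact: (measurableT_comp mf (measurable_Tinf_mul u)).
have iu := tame_integrable measurableT m_setT_lty tfu.
have [mf _] := tf.
rewrite -(@integral_pushforward _ _ _ _ _ _ (measurable_Tinf_mul u) m setT (EFin \o f))//; last first.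
  exact/measurable_EFinP.
apply: eq_measure_integral => [|mphi A mA _]; first exact: measurable_Tinf_mul.
exact: hm.
Qed.

(** Characters have mean zero: a rotation that negates the character preserves the
    mean. *)
Lemma mean_chi c n k : (0 < n)%N -> (0 < k)%N ->
  mean m setT (fun w => complex.Re (c * chi n k (tpoint w))) =
  if n == k then complex.Re c else 0.
Proof.
move=> n0 k0; case: eqVneq => [<-|nk].
  have -> : (fun w => complex.Re (c * chi n n (tpoint w))) = (fun=> complex.Re c).
    by apply/funext => w; rewrite chi_diag ?mulr1//; exact: normc_tpoint.
  exact: (mean_cst measurableT m_setT_gt0 m_setT_lty).
have [z /tpoint_surj[u <-] uN] := chi_neg R n0 k0 nk.
set f := fun w => _.
have tf : tame (f : Tinf_borel R -> R).
  apply: (@tame_Re_normc _ _ _ _ (normc c)).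
    apply: cmeasurableM; first exact: cmeasurable_cst.
    apply: cmeasurableM; first exact: cmeasurable_monom cmeasurable_tpoint.
    by apply: cmeasurable_conj; exact: cmeasurable_monom cmeasurable_tpoint.
  by move=> w; rewrite normcM normc_chi ?mulr1//; exact: normc_tpoint.
have := mean_Tinf_mul u tf.
have -> : (fun w => f (Tinf_mul u w)) = (fun w => -1 * f w).
  apply/funext => w; rewrite /f tpoint_mul chi_mul uN (mulN1r (chi _ _ _)) mulrN.
  by rewrite Re_opp mulN1r.
have -> : mean m setT (fun w => -1 * f w) = - mean m setT f.
  rewrite /mean RintegralZl//; last exact: (tame_integrable measurableT m_setT_lty tf).
  by rewrite mulrCA mulN1r.
lra.
Qed.

Lemma cmeasurable_teval s : cmeasurable (fun w : Tinf_borel R => teval s (tpoint w)).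
Proof.
apply: cmeasurable_sum => t; apply: cmeasurableM; first exact: cmeasurable_cst.
apply: cmeasurableM; first exact: cmeasurable_monom cmeasurable_tpoint.
by apply: cmeasurable_conj; exact: cmeasurable_monom cmeasurable_tpoint.
Qed.

Lemma tame_teval s : tame (fun w : Tinf_borel R => complex.Re (teval s (tpoint w))).
Proof.
apply: tame_Re_normc; first exact: cmeasurable_teval.
by move=> w; apply: normc_teval; exact: normc_tpoint.
Qed.

Lemma mean_teval s : tpositive s ->
  mean m setT (fun w => complex.Re (teval s (tpoint w))) = complex.Re (tmean s).
Proof.
elim: s => [|t s ih] /=.
  move=> _; rewrite /teval /tmean big_nil.
  under eq_fun do rewrite big_nil; exact: (mean_cst measurableT m_setT_gt0 m_setT_lty).
move=> /andP[/andP[n0 k0] /ih {}ih].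
transitivity (mean m setT (fun w => complex.Re (t.1 * chi t.2.1 t.2.2 (tpoint w)) +
   complex.Re (teval s (tpoint w)))).
  by congr mean; apply/funext => w; rewrite /teval big_cons Re_add.
rewrite (meanD measurableT m_setT_lty) ?mean_chi ?ih//; last exact: tame_teval.
  by rewrite /tmean big_cons; case: ifP; rewrite ?Re_add ?add0r.
have := tame_teval [:: t]; rewrite /teval.
by under eq_fun do rewrite big_seq1.
Qed.

End Torus.

(** * Polynomials on the unit disc *)

Section Disc.
Variable R : realType.
Local Notation C := R[i].
Variable m : probability (Tinf_borel R) R.
Hypothesis hm : is_haar m.
Implicit Types (p q : {poly C}) (z v c : C) (w : Tinf R).

Lemma tame_poly c p k : tame (fun w : Tinf_borel R =>
  complex.Re (c * p.[tpoint w 0] * (tpoint w 0)^*%C ^+ k)).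
Proof.
apply: (@tame_Re_normc _ _ _ _ (normc c * \sum_(i < size p) normc p`_i)).
  apply: cmeasurableM; last by apply/cmeasurableX/cmeasurable_conj/cmeasurable_tpoint.
  apply: cmeasurableM; first exact: cmeasurable_cst.
  under eq_fun do rewrite horner_coef; apply: cmeasurable_sum => i.
  apply: cmeasurableM; first exact: cmeasurable_cst.
  by apply/cmeasurableX/cmeasurable_tpoint.
move=> w; rewrite !normcM normcX normc_conj normc_tpoint expr1n mulr1.
rewrite ler_wpM2l ?normc_ge0// horner_coef; apply: le_trans (ler_normc_sum _ _ _) _.
by apply: ler_sum => i _; rewrite normcM normcX normc_tpoint expr1n mulr1.
Qed.

Lemma mean_coef c p k :
  mean m setT (fun w => complex.Re (c * p.[tpoint w 0] * (tpoint w 0)^*%C ^+ k)) =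
  complex.Re (c * p`_k).
Proof.
have p0 i : (0 < nth_prime 0 ^ i)%N by rewrite expn_gt0 prime_gt0// nth_prime_prime.
pose s : tpoly R := [seq (c * p`_i, (nth_prime 0 ^ i, nth_prime 0 ^ k)%N) | i <- iota 0 (size p)].
have -> : (fun w => complex.Re (c * p.[tpoint w 0] * (tpoint w 0)^*%C ^+ k)) =
          (fun w => complex.Re (teval s (tpoint w))).
  apply/funext => w; congr complex.Re.
  rewrite /teval big_map horner_coef mulr_sumr mulr_suml -(subn0 (size p)) big_mkord.
  rewrite subn0; apply: eq_bigr => i _; rewrite /chi/= !monom_expn ?prime_gt0 ?nth_prime_prime//.
  by rewrite !monom_prime rmorphXn/= !mulrA.
rewrite mean_teval//; last by apply/allP => _ /mapP[i _ ->] /=; rewrite !p0.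
congr complex.Re; rewrite /tmean big_map /=.
under eq_bigl do rewrite eqn_exp2l ?prime_gt1 ?nth_prime_prime//.
have [kp|kp] := ltnP k (size p).
  rewrite -big_filter (_ : [seq i <- iota 0 (size p) | i == k] = [:: k]) ?big_seq1//.
  by rewrite filter_pred1_uniq ?iota_uniq// mem_iota.
rewrite nth_default// mulr0 big_seq_cond big1// => i /andP[].
by rewrite mem_iota /= add0n => ip /eqP e; move: kp; rewrite -e leqNgt ip.
Qed.

(** Cauchy's estimate. *)
Lemma le_coef p M k : (forall z, normc z = 1 -> normc p.[z] <= M) -> normc p`_k <= M.
Proof.
move=> pM; have [c c1 cp] := exists_phase p`_k.
have <- : complex.Re (c * p`_k) = normc p`_k by rewrite cp.
rewrite -mean_coef -[leRHS](mean_cst measurableT (m_setT_gt0 m) (m_setT_lty m)).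
apply: mean_le => //; [exact: m_setT_gt0|exact: m_setT_lty|exact: tame_poly|exact: tame_cst|].
move=> w; apply: le_trans (ler_Re_normc _) _.
rewrite !normcM normcX normc_conj normc_tpoint expr1n mulr1 c1 mul1r.
by apply: pM; exact: normc_tpoint.
Qed.

Lemma le_of_exp_le_linear (x M a : R) : 0 <= x -> 0 <= M -> 0 <= a ->
  (forall K : nat, x ^+ K <= M ^+ K * (a * K%:R + 1)) -> x <= M.
Proof.
move=> x0 M0 a0 H; rewrite leNgt; apply/negP => Mx.
have [e|M0'] := eqVneq M 0.
  by have := H 1%N; rewrite e expr1 expr0n mul0r leNgt -e Mx.
have {M0 M0'} M0 : 0 < M by rewrite lt_def M0'.
pose d := x / M - 1.
have d0 : 0 < d by rewrite subr_gt0 ltr_pdivlMr// mul1r.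
pose K := (Num.truncn (2 * a / d ^+ 2)).+1.
have KP : 2 * a < K%:R * d ^+ 2.
  by rewrite -ltr_pdivrMr ?exprn_gt0// /K truncnS_gt.
have K0 : 0 < K%:R :> R by rewrite ltr0n.
have bern : 1 + K%:R * d <= (x / M) ^+ K.
  have -> : x / M = 1 + d by rewrite /d; ring.
  elim: (K) => [|k ih]; first by rewrite expr0 mul0r addr0.
  rewrite exprS -natr1; apply: le_trans (_ : (1 + d) * (1 + k%:R * d) <= _).
    have : 0 <= k%:R * d * d by rewrite !mulr_ge0// ltW.
    lra.
  by rewrite ler_wpM2l// addr_ge0// ltW.
have := H (2 * K)%N.
rewrite -ler_pdivrMl ?exprn_gt0// mulrC -expr_div_n mulnC exprM natrM.
have : (1 + K%:R * d) ^+ 2 <= (x / M) ^+ K ^+ 2.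
  rewrite lerXn2r ?nnegrE ?(le_trans _ bern)// addr_ge0// mulr_ge0// ltW//.
move=> h1 h2; have := le_trans h1 h2.
have : K%:R * (2 * a) < K%:R * (K%:R * d ^+ 2) by rewrite ltr_pM2l.
have : 0 < K%:R * d by rewrite mulr_gt0.
nra.
Qed.

(** The maximum principle, by the power trick: Cauchy's estimate loses a factor
    [size p], which is negligible in the [K]-th root of the estimate for
    [p ^+ K]. *)
Lemma max_modulus p M z : 0 <= M -> (forall v, normc v = 1 -> normc p.[v] <= M) ->
  normc z <= 1 -> normc p.[z] <= M.
Proof.
move=> M0 pM z1.
have crude q M' : 0 <= M' -> (forall v, normc v = 1 -> normc q.[v] <= M') ->
    normc q.[z] <= M' * (size q)%:R.
  move=> M'0 qM; rewrite horner_coef; apply: le_trans (ler_normc_sum _ _ _) _.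
  rewrite mulr_natr -[X in _ *+ X]card_ord -sumr_const; apply: ler_sum => i _.
  rewrite normcM normcX; apply: le_trans (_ : M' * 1 <= _); last by rewrite mulr1.
  by rewrite ler_pM ?normc_ge0 ?exprn_ge0 ?normc_ge0 ?le_coef// exprn_ile1 ?normc_ge0.
apply: (@le_of_exp_le_linear _ _ (size p).-1%:R) => //; first exact: normc_ge0.
move=> K; rewrite -normcX -horner_exp.
apply: le_trans (crude _ (M ^+ K) _ _) _; first by rewrite exprn_ge0.
  by move=> v v1; rewrite horner_exp normcX lerXn2r ?nnegrE ?normc_ge0// pM.
rewrite ler_wpM2l ?exprn_ge0// -natrM natr1 ler_nat.
exact: size_poly_exp_leq.
Qed.

Lemma poly_bounded_disc q : exists2 B, 0 <= B & forall z, normc z <= 1 -> normc q.[z] <= B.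
Proof.
exists (\sum_(i < size q) normc q`_i); first by apply: sumr_ge0 => i _; exact: normc_ge0.
move=> z z1; rewrite horner_coef; apply: le_trans (ler_normc_sum _ _ _) _.
apply: ler_sum => i _; rewrite normcM normcX ler_piMr ?normc_ge0//.
by rewrite exprn_ile1// normc_ge0.
Qed.

Lemma normc_1B_le c : normc (1 - c) <= expR (- complex.Re c + normc c ^+ 2 / 2).
Proof.
rewrite -[leLHS]ger0_norm ?normc_ge0// -[leRHS]ger0_norm ?expR_ge0//.
rewrite -ler_sqr ?nnegrE ?normr_ge0// !real_normK ?num_real//.
have -> : normc (1 - c) ^+ 2 = 1 + (- (2 * complex.Re c) + normc c ^+ 2).
  case: c => a b /=; rewrite !sqr_sqrtr ?addr_ge0 ?sqr_ge0//; ring.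
have -> : expR (- complex.Re c + normc c ^+ 2 / 2) ^+ 2 =
          expR (- (2 * complex.Re c) + normc c ^+ 2).
  by rewrite expr2 -expRD; congr expR; field.
exact: expR_ge1Dx.
Qed.

Lemma expR_le_1B (y : R) : `|y| <= 1 / 2 -> expR (- y - 2 * y ^+ 2) <= 1 - y.
Proof.
rewrite ler_norml => /andP[y1 y2].
have y0 : 0 < 1 - y by lra.
apply: le_trans (_ : expR (- (y / (1 - y))) <= _).
  rewrite ler_expR -opprD lerN2 ler_pdivrMr//.
  have : 0 <= y ^+ 2 * (1 - 2 * y) by rewrite mulr_ge0 ?sqr_ge0//; lra.
  rewrite expr2; lra.
rewrite expRN -[leRHS]invrK lef_pV2 ?posrE ?expR_gt0 ?invr_gt0//.
have e : (1 - y)^-1 = 1 + y / (1 - y) by field; rewrite gt_eqF.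
by rewrite [leLHS]e expR_ge1Dx.
Qed.

Lemma le_of_forall_inv (x y A : R) (K0 : nat) :
  (forall K, (K0 <= K)%N -> (0 < K)%N -> x <= y + A / K%:R) -> x <= y.
Proof.
move=> H; rewrite leNgt; apply/negP => yx.
pose K := maxn K0 (Num.truncn (`|A| / (x - y))).+1.
have xy0 : 0 < x - y by rewrite subr_gt0.
have K1 : (0 < K)%N by rewrite leq_max orbT.
have := H K (leq_maxl _ _) K1.
have : A / K%:R < x - y.
  rewrite ltr_pdivrMr ?ltr0n// mulrC -ltr_pdivrMr//.
  apply: le_lt_trans (_ : `|A| / (x - y) < _); first by rewrite ler_wpM2r ?ler_norm ?invr_ge0 ?ltW.
  apply: lt_le_trans (truncnS_gt _) _.
  by rewrite ler_nat leq_maxr.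
lra.
Qed.

(** [log (1 + |p|)] is subharmonic. At the point [z] it is the logarithm of the
    modulus of [h = 1 + c p] for a suitable rotation [c], and the maximum principle
    applies to [h e^(-q)], with the exponential replaced by the polynomials
    [(1 - q / K) ^ K]. *)
Lemma ln1D_normc_subharmonic p q :
  (forall z, normc z = 1 -> ln (1 + normc p.[z]) <= complex.Re q.[z]) ->
  forall z, normc z <= 1 -> ln (1 + normc p.[z]) <= complex.Re q.[z].
Proof.
move=> pq z z1; have [c c1 cp] := exists_phase p.[z].
have [B B0 qB] := poly_bounded_disc q.
set x := complex.Re q.[z].
have pos1 (y : C) : 0 < 1 + normc y by rewrite ltr_pwDl// normc_ge0.
apply: (@le_of_forall_inv _ _ (2 * x ^+ 2 + B ^+ 2 / 2) (Num.truncn (2 * `|x|)).+1).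
move=> K KK0 K0.
have K0' : 0 < K%:R :> R by rewrite ltr0n.
have xK : `|x / K%:R| <= 1 / 2.
  rewrite normrM normfV (ger0_norm (ltW K0')) ler_pdivrMr// mul1r.
  rewrite mulrC ler_pdivlMr// mulrC ltW//.
  by apply: lt_le_trans (truncnS_gt _) _; rewrite ler_nat.
pose g := (1 + c *: p) * (1 - (K%:R^-1)%:C *: q) ^+ K.
have gE v : g.[v] = (1 + c * p.[v]) * (1 - (K%:R^-1)%:C * q.[v]) ^+ K.
  by rewrite /g hornerM horner_exp !hornerE.
have qK v : normc v <= 1 -> normc ((K%:R^-1)%:C * q.[v]) ^+ 2 / 2 <= B ^+ 2 / (2 * K%:R ^+ 2).
  move=> v1; rewrite normcM normc_real ger0_norm ?invr_ge0 ?(ltW K0')// exprMn exprVn.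
  have -> : B ^+ 2 / (2 * K%:R ^+ 2) = K%:R ^- 2 * B ^+ 2 / 2 by field; rewrite gt_eqF.
  rewrite ler_pM2r ?invr_gt0// ler_pM2l ?invr_gt0 ?exprn_gt0//.
  by rewrite lerXn2r ?nnegrE ?normc_ge0// qB.
have gle v : normc v = 1 -> normc g.[v] <= expR (B ^+ 2 / 2 / K%:R).
  move=> v1; rewrite gE normcM normcX.
  have h1 : normc (1 + c * p.[v]) <= expR (complex.Re q.[v]).
    apply: le_trans (_ : 1 + normc p.[v] <= _).
      by apply: le_trans (ler_normcD _ _) _; rewrite normc1 normcM c1 mul1r.
    by rewrite -[leLHS]lnK ?posrE// ler_expR pq.
  have h2 : normc (1 - (K%:R^-1)%:C * q.[v]) ^+ K <=
      expR (- complex.Re q.[v] + B ^+ 2 / 2 / K%:R).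
    have -> : - complex.Re q.[v] + B ^+ 2 / 2 / K%:R =
        K%:R * (- complex.Re ((K%:R^-1)%:C * q.[v]) + B ^+ 2 / (2 * K%:R ^+ 2)).
      by rewrite Re_realM; field; rewrite gt_eqF.
    rewrite expRM_natl lerXn2r ?nnegrE ?normc_ge0 ?expR_ge0//.
    by apply: le_trans (normc_1B_le _) _; rewrite ler_expR lerD2l qK// v1.
  apply: le_trans (ler_pM (normc_ge0 _) (exprn_ge0 _ (normc_ge0 _)) h1 h2) _.
  by rewrite -expRD addrA subrr add0r.
have := max_modulus (expR_ge0 _) gle z1.
rewrite gE normcM normcX cp.
have -> : normc (1 + (normc p.[z])%:C) = 1 + normc p.[z].
  by rewrite -(rmorph1 (real_complex R)) -rmorphD normc_real ger0_norm// ltW.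
have low : expR (- x - 2 * x ^+ 2 / K%:R) <= normc (1 - (K%:R^-1)%:C * q.[z]) ^+ K.
  have -> : - x - 2 * x ^+ 2 / K%:R = K%:R * (- (x / K%:R) - 2 * (x / K%:R) ^+ 2).
    by field; rewrite gt_eqF.
  rewrite expRM_natl lerXn2r ?nnegrE ?normc_ge0 ?expR_ge0//.
  apply: le_trans (expR_le_1B xK) _; apply: le_trans (ler_Re_normc _).
  by rewrite Re_add Re_opp Re_realM /= -/x mulrC.
move=> H.
have {H} : (1 + normc p.[z]) * expR (- x - 2 * x ^+ 2 / K%:R) <= expR (B ^+ 2 / 2 / K%:R).
  by apply: le_trans H; rewrite ler_wpM2l// ltW.
rewrite -[X in X * _]lnK ?posrE// -expRD ler_expR; lra.
Qed.

(** Harnack's inequality. A polynomial with positive real part on the circle has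
    coefficients at most twice the real part of its constant term. *)
Lemma harnack_disc q : (forall z, normc z = 1 -> 0 <= complex.Re q.[z]) ->
  forall z, normc z < 1 ->
  complex.Re q.[z] <= (1 + normc z) / (1 - normc z) * complex.Re q.[0].
Proof.
move=> q0 z z1.
have mT0 := m_setT_gt0 m; have mToo := m_setT_lty m.
have coef k : (0 < k)%N -> normc q`_k <= 2 * complex.Re q`_0.
  move=> k0; have [c c1 cq] := exists_phase q`_k.
  pose f (c : C) p i (w : Tinf_borel R) :=
    complex.Re (c * p.[tpoint w 0] * (tpoint w 0)^*%C ^+ i).
  have : 0 <= mean m setT (fun w => f 1 q 0%N w +
      (f (- c / 2) q k w + f (- c^*%C / 2) (q * 'X^k) 0%N w)).
    rewrite -(mean_cst measurableT mT0 mToo 0).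
    apply: mean_le => //; first exact: tame_cst.
      by apply: tameD; [|apply: tameD]; exact: tame_poly.
    move=> w; have v1 := normc_tpoint w 0; rewrite /f.
    set v := tpoint w 0 in v1 *; rewrite !expr0 !mulr1 mul1r hornerM hornerXn.
    (* with [A = c conj v ^ k], the products are [- q A / 2] and [- q conj A / 2] *)
    have -> : complex.Re q.[v] + (complex.Re (- c / 2 * q.[v] * v^*%C ^+ k) +
        complex.Re (- c^*%C / 2 * (q.[v] * v ^+ k))) =
        complex.Re q.[v] * (1 - complex.Re (c * v^*%C ^+ k)).
      have -> : - c / 2 * q.[v] * v^*%C ^+ k = ((- 1 / 2 : R)%:C) * (q.[v] * (c * v^*%C ^+ k)).
        rewrite rmorphM rmorphN rmorph1 fmorphV rmorph_nat /=; ring.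
      have -> : - c^*%C / 2 * (q.[v] * v ^+ k) =
          ((- 1 / 2 : R)%:C) * (q.[v] * (c * v^*%C ^+ k)^*%C).
        rewrite rmorphM rmorphN rmorph1 fmorphV rmorph_nat /= rmorphM/= rmorphXn/= conjcK; ring.
      rewrite !Re_realM !(Re_mul q.[v]).
      by move: (c * v^*%C ^+ k) (q.[v]) => [a b] [a' b'] /=; field.
    rewrite mulr_ge0 ?q0// subr_ge0; apply: le_trans (ler_Re_normc _) _.
    by rewrite normcM normcX normc_conj v1 expr1n mulr1 c1.
  rewrite !(meanD measurableT mToo); try exact: tame_poly; last first.
    by apply: tameD; exact: tame_poly.
  rewrite !mean_coef coefMXn k0 mulr0 /= addr0 mul1r.
  have -> : - c / 2 * q`_k = ((- 1 / 2 : R)%:C) * (c * q`_k).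
    by rewrite rmorphM rmorphN rmorph1 fmorphV rmorph_nat /=; ring.
  rewrite Re_realM cq /=; lra.
have q00 : 0 <= complex.Re q`_0.
  have := normc_ge0 q`_1; have := coef 1%N isT; lra.
set r := normc z in z1 *.
have r0 : 0 <= r := normc_ge0 z.
have r1 : 0 < 1 - r by rewrite subr_gt0.
rewrite horner_coef0.
have geo n : \sum_(i < n) r ^+ i.+1 <= r / (1 - r).
  have e : (\sum_(i < n) r ^+ i.+1) * (1 - r) = r - r ^+ n.+1.
    elim: n => [|n ih]; first by rewrite big_ord0 mul0r expr1 subrr.
    by rewrite big_ord_recr /= mulrDl ih !exprS; ring.
  by rewrite ler_pdivlMr// e lerBlDr lerDl exprn_ge0.
case: (size q =P 0%N) => [s0|/eqP s0].
  have -> : q = 0 by apply/eqP; rewrite -size_poly_eq0 s0.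
  by rewrite horner0 coef0 mulr0.
have -> : (1 + r) / (1 - r) = 1 + 2 * (r / (1 - r)) by field; rewrite gt_eqF.
rewrite horner_coef -(prednK (_ : 0 < size q)%N) ?lt0n//.
rewrite big_ord_recl expr0 mulr1 Re_add mulrDl mul1r lerD2l.
apply: le_trans (ler_Re_normc _) _; apply: le_trans (ler_normc_sum _ _ _) _.
apply: le_trans (_ : \sum_(i < (size q).-1) (2 * complex.Re q`_0) * r ^+ i.+1 <= _).
  by apply: ler_sum => i _; rewrite normcM normcX ler_wpM2r ?exprn_ge0 ?coef.
rewrite -mulr_sumr [leRHS]mulrAC ler_wpM2l ?mulr_ge0//; exact: geo.
Qed.

End Disc.

(** * Trigonometric polynomials in many variables *)

Section ManyVariables.
Variable R : realType.
Local Notation C := R[i].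
Implicit Types (b : nat -> C) (s : tpoly R) (z t : nat -> C) (r : nat -> R).

Definition psum b N z : C := \sum_(n < N) b n * monom n.+1 z.

Lemma psumE b N z : series (bohr_term b z) N = psum b N z.
Proof. by rewrite /series/= big_mkord. Qed.

Definition trunc K (S : comNzRingType) (z : nat -> S) : nat -> S :=
  fun j => if (j < K)%N then z j else 0.

Lemma monom_trunc K (S : comNzRingType) n (z : nat -> S) : (n <= K)%N ->
  monom n (trunc K z) = monom n z.
Proof.
move=> nK; apply: eq_bigr => j _; rewrite /trunc.
by rewrite (leq_trans (ltn_ord j) nK).
Qed.

Lemma psum_mul b N z t :
  psum b N (fun j => t j * z j) = psum (fun n => b n * monom n.+1 t) N z.
Proof. by apply: eq_bigr => n _; rewrite monom_mul mulrA. Qed.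

Lemma eq_psum b N z z' : (forall j, (j < N)%N -> z j = z' j) -> psum b N z = psum b N z'.
Proof.
move=> zz'; apply: eq_bigr => n _; congr (_ * _); apply: eq_bigr => j _.
by rewrite zz'// (leq_trans (ltn_ord j)).
Qed.

Lemma teval_finite s : exists K, forall z z', (forall j, (j < K)%N -> z j = z' j) ->
  teval s z = teval s z'.
Proof.
elim: s => [|a s [K KP]]; first by exists 0%N => z z' _; rewrite /teval !big_nil.
exists (maxn K (maxn a.2.1 a.2.2)) => z z' zz'; rewrite /teval !big_cons; congr (_ + _).
  congr (_ * (_ * conjc _)); apply: eq_bigr => j _; rewrite zz'//.
    by rewrite !leq_max (ltn_ord j) orbT.
  by rewrite !leq_max (ltn_ord j) !orbT.
by apply: KP => j jK; rewrite zz'// leq_max jK.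
Qed.

Lemma upd_id (S : comNzRingType) (z : nat -> S) j : upd z j (z j) = z.
Proof. by apply/funext => i; rewrite /upd; case: eqP => [->|]. Qed.

Lemma psum_upd b N z j : exists p : {poly C}, forall v, psum b N (upd z j v) = p.[v].
Proof.
exists (\sum_(n < N) (b n * monom n.+1 (upd z j 1)) *: 'X^(logn (nth_prime j) n.+1)).
move=> v; rewrite horner_sum; apply: eq_bigr => n _.
by rewrite hornerZ hornerXn (monom_upd _ _ _ v) mulrCA mulrC.
Qed.

(** In a reduced trigonometric polynomial each variable occurs only directly or
    only conjugated in each term, so that the real part is, in each variable, the
    real part of a polynomial. *)
Lemma teval_upd s z j : reduced s ->
  exists q : {poly C}, forall v, complex.Re (teval s (upd z j v)) = complex.Re q.[v].
Proof.
elim: s => [_|a s ih /= /andP[/and3P[n0 k0 cop] /ih[q qP]]].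
  by exists 0 => v; rewrite /teval big_nil horner0.
pose A := monom a.2.1 (upd z j 1); pose B := monom a.2.2 (upd z j 1).
pose e := logn (nth_prime j) a.2.1; pose e' := logn (nth_prime j) a.2.2.
case: (coprime_logn j cop) => e0.
  exists ((a.1 * A * B^*%C)^*%C *: 'X^e' + q) => v.
  rewrite /teval big_cons Re_add hornerD Re_add; congr (_ + _); last exact: qP.
  rewrite hornerZ hornerXn /chi (monom_upd a.2.1) (monom_upd a.2.2) e0 expr0 mul1r.
  rewrite -/A -/B -/e' -[LHS]Re_conj; congr complex.Re.
  by rewrite !rmorphM/= !conjcK; ring.
exists ((a.1 * A * B^*%C) *: 'X^e + q) => v.
rewrite /teval big_cons Re_add hornerD Re_add; congr (_ + _); last exact: qP.
rewrite hornerZ hornerXn /chi (monom_upd a.2.1) (monom_upd a.2.2) e0 expr0 mul1r.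
by rewrite -/A -/B -/e; congr complex.Re; ring.
Qed.

Variable m : probability (Tinf_borel R) R.
Hypothesis hm : is_haar m.

(** A harmonic majorant of [log (1 + |P|)] on the torus is one on the polydisc: the
    variables are moved into the disc one at a time. *)
Lemma majorant_polydisc b N s : reduced s ->
  (forall z, (forall j, normc (z j) = 1) ->
    ln (1 + normc (psum b N z)) <= complex.Re (teval s z)) ->
  forall z, (forall j, normc (z j) <= 1) ->
    ln (1 + normc (psum b N z)) <= complex.Re (teval s z).
Proof.
move=> rs H.
have step K : forall z, (forall j, normc (z j) <= 1) ->
    (forall j, (K <= j)%N -> normc (z j) = 1) ->
    ln (1 + normc (psum b N z)) <= complex.Re (teval s z).
  elim: K => [z _ z1|K ih z z1 zK]; first by apply: H => j; exact: z1.
  have [p pE] := psum_upd b N z K; have [q qE] := teval_upd z K rs.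
  rewrite -{1 2}(upd_id z K) pE qE; apply: (ln1D_normc_subharmonic hm) => // v v1.
  rewrite -pE -qE; apply: ih => j; rewrite /upd; case: eqP => //; rewrite ?v1//.
  by move=> jK Kj; apply: zK; rewrite ltn_neqAle Kj andbT eq_sym; apply/eqP.
move=> z z1; have [K KP] := teval_finite s.
pose z' j := if (j < maxn K N)%N then z j else 1.
have -> : psum b N z = psum b N z'.
  by apply: eq_psum => j jN; rewrite /z' leq_max jN orbT.
have -> : teval s z = teval s z'.
  by apply: KP => j jN; rewrite /z' leq_max jN.
apply: (step (maxn K N)) => j; rewrite /z'; first by case: ifP; rewrite ?normc1.
by rewrite leqNgt => /negbTE->; rewrite normc1.
Qed.

Definition harnack (r : R) : R := (1 + r) / (1 - r).

Lemma harnack_ge1 (r : R) : 0 <= r < 1 -> 1 <= harnack r.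
Proof. by move=> /andP[r0 r1]; rewrite /harnack ler_pdivlMr ?mul1r; lra. Qed.

(** Harnack's inequality is applied to one variable at a time, the later variables
    being set to [0]. *)
Lemma harnack_polydisc s : reduced s ->
  (forall z, (forall j, normc (z j) = 1) -> 0 <= complex.Re (teval s z)) ->
  forall K z, (forall j, normc (z j) < 1) ->
  complex.Re (teval s (trunc K z)) <=
    (\prod_(j < K) harnack (normc (z j))) * complex.Re (tmean s).
Proof.
move=> rs s0 K z z1.
have pos z' : (forall j, normc (z' j) <= 1) -> 0 <= complex.Re (teval s z').
  have p0 y : ln (1 + normc (psum (fun=> 0) 0 y)) = 0.
    by rewrite /psum big_ord0 normc0 addr0 ln1.
  move=> z'1; rewrite -(p0 z'); apply: majorant_polydisc => // y y1.
  by rewrite p0 s0.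
have tz i K' : normc (trunc K' z i) <= 1.
  by rewrite /trunc; case: ifP => _; rewrite ?normc0// ltW.
elim: K => [|K ih]; first by rewrite big_ord0 mul1r -teval0.
have [q qE] := teval_upd (trunc K.+1 z) K rs.
rewrite -(upd_id (trunc K.+1 z) K) qE.
have zK : trunc K.+1 z K = z K by rewrite /trunc ltnSn.
apply: le_trans (harnack_disc hm (q := q) _ _) _.
- move=> v v1; rewrite -qE; apply: pos => j; rewrite /upd; case: eqP => // _.
  by rewrite v1.
- by rewrite zK.
rewrite -qE zK big_ord_recr /= [X in _ <= X * _]mulrC -[leRHS]mulrA ler_wpM2l//.
  by rewrite (le_trans ler01)// harnack_ge1// normc_ge0 z1.
rewrite (_ : upd _ _ _ = trunc K z)//; apply/funext => j.
rewrite /upd /trunc ltnS; case: eqP => [->|/eqP jK]; first by rewrite ltnn.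
by rewrite ltn_neqAle jK.
Qed.

(** Conjugates are inverses on the torus, so that common factors cancel. *)
Lemma chi_reduce n k : (0 < n)%N -> (0 < k)%N ->
  exists n' k', [/\ (0 < n')%N, (0 < k')%N, coprime n' k' &
    forall z, (forall j, normc (z j) = 1) -> chi n' k' z = chi n k z].
Proof.
move=> n0 k0; pose g := gcdn n k.
have g0 : (0 < g)%N by rewrite gcdn_gt0 n0.
have [n' nE] : exists n', n = (n' * g)%N by apply/dvdnP; rewrite dvdn_gcdl.
have [k' kE] : exists k', k = (k' * g)%N by apply/dvdnP; rewrite dvdn_gcdr.
have n'0 : (0 < n')%N by move: n0; rewrite nE muln_gt0 => /andP[].
have k'0 : (0 < k')%N by move: k0; rewrite kE muln_gt0 => /andP[].
exists n', k'; split=> //.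
  rewrite /coprime -(eqn_pmul2r g0) mul1n -{2}/g /g {2}nE {2}kE.
  by rewrite muln_gcdl -nE -kE.
move=> z z1; rewrite /chi nE kE !monomM// rmorphM/= mulrACA.
by rewrite mulc_conj monom_unit// expr1n mulr1.
Qed.

Definition trigonometric (f : (nat -> C) -> C) : Prop :=
  exists2 s, reduced s & forall z, (forall j, normc (z j) = 1) -> f z = teval s z.

Lemma trigonometric_chi c n k : (0 < n)%N -> (0 < k)%N ->
  trigonometric (fun z => c * chi n k z).
Proof.
move=> n0 k0; have [n' [k' [n'0 k'0 cop E]]] := chi_reduce n0 k0.
exists [:: (c, (n', k'))]; first by rewrite /= n'0 k'0 cop.
by move=> z z1; rewrite /teval big_seq1 /= E.
Qed.

Lemma trigonometric0 : trigonometric (fun=> 0).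
Proof. by exists [::] => // z _; rewrite /teval big_nil. Qed.

Lemma trigonometricD f g : trigonometric f -> trigonometric g ->
  trigonometric (fun z => f z + g z).
Proof.
move=> [s rs fE] [s' rs' gE]; exists (s ++ s'); first by rewrite /reduced all_cat; apply/andP.
by move=> z z1; rewrite fE// gE// /teval big_cat.
Qed.

Lemma trigonometric_sum (I : eqType) (l : seq I) (F : I -> (nat -> C) -> C) :
  (forall i, i \in l -> trigonometric (F i)) -> trigonometric (fun z => \sum_(i <- l) F i z).
Proof.
elim: l => [_|i l ih H]; first by under eq_fun do rewrite big_nil; exact: trigonometric0.
under eq_fun do rewrite big_cons; apply: trigonometricD; first by apply: H; rewrite inE eqxx.
by apply: ih => k kl; apply: H; rewrite inE kl orbT.
Qed.

Lemma eq_trigonometric f g : (forall z, (forall j, normc (z j) = 1) -> f z = g z) ->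
  trigonometric f -> trigonometric g.
Proof. by move=> fg [s rs fE]; exists s => // z z1; rewrite -fg// fE. Qed.

Lemma trigonometricM f g : trigonometric f -> trigonometric g ->
  trigonometric (fun z => f z * g z).
Proof.
move=> [s rs fE] [s' rs' gE].
apply: (@eq_trigonometric (fun z => \sum_(a <- s) \sum_(a' <- s')
    (a.1 * a'.1) * chi (a.2.1 * a'.2.1) (a.2.2 * a'.2.2) z)); last first.
  apply: trigonometric_sum => a /(allP (reduced_positive rs))/andP[n0 k0].
  apply: trigonometric_sum => a' /(allP (reduced_positive rs'))/andP[n0' k0'].
  by apply: trigonometric_chi; rewrite muln_gt0 ?n0 ?k0.
move=> z z1; rewrite fE// gE// /teval mulr_suml !big_seq; apply: eq_bigr => a as_.
have /andP[n0 k0] := allP (reduced_positive rs) a as_.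
rewrite mulr_sumr !big_seq; apply: eq_bigr => a' as'.
have /andP[n0' k0'] := allP (reduced_positive rs') a' as'.
by rewrite /chi !monomM// rmorphM/=; ring.
Qed.

Lemma trigonometric_cst c : trigonometric (fun=> c).
Proof.
apply: (@eq_trigonometric (fun z => c * chi 1 1 z)); last exact: trigonometric_chi.
by move=> z z1; rewrite chi_diag// mulr1.
Qed.

Lemma trigonometric_psum b N : trigonometric (psum b N).
Proof.
apply: (@eq_trigonometric (fun z => \sum_(n <- index_enum 'I_N) b n * chi n.+1 1 z)).
  by move=> z z1; apply: eq_bigr => n _; rewrite /chi monom1 rmorph1 mulr1.
by apply: trigonometric_sum => n _; exact: trigonometric_chi.
Qed.

Lemma trigonometric_psum_conj b N : trigonometric (fun z => (psum b N z)^*%C).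
Proof.
apply: (@eq_trigonometric (fun z => \sum_(n <- index_enum 'I_N) (b n)^*%C * chi 1 n.+1 z)).
  move=> z z1; rewrite /psum rmorph_sum; apply: eq_bigr => n _.
  by rewrite /chi monom1 mul1r rmorphM.
by apply: trigonometric_sum => n _; exact: trigonometric_chi.
Qed.

Lemma trigonometric_horner (q : {poly R}) f : trigonometric f ->
  trigonometric (fun z => (map_poly (real_complex R) q).[f z]).
Proof.
move=> tf; elim/poly_ind: q => [|q c ih].
  by under eq_fun do rewrite rmorph0 horner0; exact: trigonometric0.
under eq_fun do rewrite rmorphD rmorphM/= map_polyX map_polyC hornerMXaddC.
by apply: trigonometricD; [exact: trigonometricM|exact: trigonometric_cst].
Qed.

Lemma normc_psum_torus b N z : (forall j, normc (z j) = 1) ->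
  normc (psum b N z) <= \sum_(n < N) normc (b n).
Proof.
move=> z1; apply: le_trans (ler_normc_sum _ _ _) _; apply: ler_sum => n _.
by rewrite normcM monom_unit// mulr1.
Qed.

(** On the torus, [log (1 + |P|)] is a uniform limit of trigonometric polynomials:
    [P] times its conjugate is one, and [log (1 + sqrt x)] is a limit of
    polynomials. *)
Lemma ln1D_psum_approx b N (e : R) : 0 < e ->
  exists2 s, reduced s & forall z, (forall j, normc (z j) = 1) ->
    `|ln (1 + normc (psum b N z)) - complex.Re (teval s z)| <= e.
Proof.
move=> e0; pose M := 1 + \sum_(n < N) normc (b n).
have M0 : 0 < M by rewrite ltr_pwDl// sumr_ge0// => n _; exact: normc_ge0.
have [q qP] := ln1D_approx M0 e0.
have [s rs sE] := trigonometric_horner q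
  (trigonometricM (trigonometric_psum b N) (trigonometric_psum_conj b N)).
exists s => // z z1; rewrite -sE// mulc_conj horner_map /=; apply: qP.
rewrite normc_ge0 /=; apply: le_trans (normc_psum_torus _ _ z1) _.
by rewrite lerDr.
Qed.

Definition lmean b N : R := mean m setT (fun w => ln (1 + normc (psum b N (tpoint w)))).

Lemma cmeasurable_psum b N : cmeasurable (fun w : Tinf_borel R => psum b N (tpoint w)).
Proof.
apply: cmeasurable_sum => n; apply: cmeasurableM; first exact: cmeasurable_cst.
exact: cmeasurable_monom (@cmeasurable_tpoint R).
Qed.

Lemma tame_ln1D_psum b N :
  tame (fun w : Tinf_borel R => ln (1 + normc (psum b N (tpoint w)))).
Proof.
apply: tame_ln1D_normc; first exact: cmeasurable_psum.
by move=> w; apply: normc_psum_torus; exact: normc_tpoint.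
Qed.

(** A small constant turns the approximation of [ln1D_psum_approx] into a majorant. *)
Lemma ln1D_psum_majorant b N (e : R) : 0 < e ->
  exists s, [/\ reduced s, complex.Re (tmean s) <= lmean b N + e &
    forall z, (forall j, normc (z j) = 1) ->
      ln (1 + normc (psum b N z)) <= complex.Re (teval s z)].
Proof.
move=> e0; have e20 : 0 < e / 2 by rewrite divr_gt0.
have [s rs sP] := ln1D_psum_approx b N e20.
pose s' : tpoly R := ((e / 2)%:C, (1%N, 1%N)) :: s.
have s'E z : (forall j, normc (z j) = 1) ->
    complex.Re (teval s' z) = e / 2 + complex.Re (teval s z).
  by move=> z1; rewrite /teval big_cons Re_add /= chi_diag// mulr1.
exists s'; split=> //.
  rewrite -(mean_teval hm); last exact: (@reduced_positive _ s').
  rewrite /lmean -meanDc//; [|exact: m_setT_gt0|exact: m_setT_lty|exact: tame_ln1D_psum].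
  apply: mean_le => //; [exact: m_setT_gt0|exact: m_setT_lty|exact: tame_teval| |].
    by apply: tameD; [exact: tame_ln1D_psum|exact: tame_cst].
  move=> w; have w1 := normc_tpoint w; rewrite s'E//.
  have := sP _ w1; rewrite ler_norml; lra.
by move=> z z1; rewrite s'E//; have := sP _ z1; rewrite ler_norml; lra.
Qed.

(** Subharmonicity: a majorant on the torus is one on every smaller torus, and it has
    the same mean on both, namely its value at the origin. *)
Lemma lmean_contract b N t : (forall j, normc (t j) <= 1) ->
  lmean (fun n => b n * monom n.+1 t) N <= lmean b N.
Proof.
move=> t1; apply/ler_addgt0Pr => e e0.
have [s [rs sm sP]] := ln1D_psum_majorant b N e0.
pose s' : tpoly R := [seq (a.1 * chi a.2.1 a.2.2 t, a.2) | a <- s].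
have ps' : tpositive s' by rewrite /tpositive all_map; exact: reduced_positive.
have s'E z : teval s' z = teval s (fun j => t j * z j).
  rewrite /teval big_map; apply: eq_bigr => a _.
  by rewrite chi_mul mulrA.
have s'm : tmean s' = tmean s.
  rewrite /tmean big_map /= big_seq_cond [RHS]big_seq_cond.
  apply: eq_bigr => a /andP[/(allP rs)/and3P[_ _ cop] /eqP e1].
  move: cop; rewrite e1 /coprime gcdnn => /eqP->.
  by rewrite /chi !monom1 rmorph1 !mulr1.
apply: le_trans sm; rewrite -s'm -(mean_teval hm)//.
apply: mean_le => //; [exact: m_setT_gt0|exact: m_setT_lty|exact: tame_ln1D_psum|exact: tame_teval|].
move=> w; rewrite s'E -psum_mul; apply: majorant_polydisc => // j.
by rewrite normcM normc_tpoint mulr1.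
Qed.

(** Cauchy's estimate on the torus. *)
Lemma le_coef_psum b N n M : (n < N)%N ->
  (forall z, (forall j, normc (z j) = 1) -> normc (psum b N z) <= M) -> normc (b n) <= M.
Proof.
move=> nN bM; have [c c1 cb] := exists_phase (b n).
pose s : tpoly R := [seq (c * b (i : 'I_N), (i.+1, n.+1)) | i <- index_enum 'I_N].
have sE z : teval s z = c * psum b N z * (monom n.+1 z)^*%C.
  rewrite /teval big_map /psum mulr_sumr mulr_suml; apply: eq_bigr => i _.
  by rewrite /chi/= !mulrA.
have ps : tpositive s by rewrite /tpositive all_map; apply/allP.
have <- : complex.Re (tmean s) = normc (b n).
  by rewrite /tmean big_map /= (big_pred1 (Ordinal nN)) ?cb.
rewrite -(mean_teval hm)// -[leRHS](mean_cst measurableT (m_setT_gt0 m) (m_setT_lty m)).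
apply: mean_le => //; [exact: m_setT_gt0|exact: m_setT_lty|exact: tame_teval|exact: tame_cst|].
move=> w; have w1 := normc_tpoint w; apply: le_trans (ler_Re_normc _) _.
by rewrite sE !normcM normc_conj monom_unit// mulr1 c1 mul1r bM.
Qed.

(** A bound on the logarithmic mean bounds the coefficients: Harnack's inequality
    bounds the polynomial on a smaller polydisc, where Cauchy's estimate applies. *)
Lemma le_coef_lmean b N n r : (n < N)%N -> (forall j, 0 <= r j < 1) ->
  normc (b n) * monom n.+1 r <=
    expR ((\prod_(j < n.+1) harnack (r j)) * lmean b N) - 1.
Proof.
move=> nN r01; set H := \prod_(j < _) _.
have H1 : 1 <= H by rewrite /H; elim/big_ind : _ => // [x y x1 y1|j _];
  [rewrite mulr_ege1|exact: harnack_ge1].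
have H0 : 0 < H by exact: lt_le_trans H1.
pose t j : C := (trunc n.+1 r j)%:C.
have tE : t = trunc n.+1 (fun j => (r j)%:C).
  by apply/funext => j; rewrite /t /trunc; case: ifP => //; rewrite rmorph0.
have nr j : normc ((r j)%:C) = r j.
  by rewrite normc_real ger0_norm//; case/andP: (r01 j).
have bound z : (forall j, normc (z j) = 1) ->
    ln (1 + normc (psum b N (fun j => t j * z j))) <= H * lmean b N.
  move=> z1; apply/ler_addgt0Pr => e e0.
  have eH : 0 < e / H by rewrite divr_gt0.
  have [s [rs sm sP]] := ln1D_psum_majorant b N eH.
  have nz j : normc ((r j)%:C * z j) = r j by rewrite normcM z1 mulr1 nr.
  have zE : (fun j => t j * z j) = trunc n.+1 (fun j => (r j)%:C * z j).
    by apply/funext => j; rewrite tE /trunc; case: ifP => //; rewrite mul0r.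
  rewrite zE; apply: le_trans (majorant_polydisc rs sP _) _.
    move=> j; rewrite /trunc; case: ifP => _; rewrite ?normc0// nz ltW//.
    by case/andP: (r01 j).
  apply: le_trans (harnack_polydisc rs _ _ _) _.
  - by move=> z' z'1; apply: le_trans (sP _ z'1); rewrite ln1D_ge0 ?normc_ge0.
  - by move=> j; rewrite nz; case/andP: (r01 j).
  rewrite (eq_bigr (fun j : 'I_n.+1 => harnack (r j))) => [|j _]; last by rewrite nz.
  apply: le_trans (ler_wpM2l (ltW H0) sm) _.
  by rewrite mulrDr [H * (e / H)]mulrC divfK// gt_eqF.
have -> : normc (b n) * monom n.+1 r = normc (b n * monom n.+1 t).
  rewrite normcM; congr (_ * _); rewrite tE monom_trunc// -monom_real normc_real.
  by rewrite ger0_norm// monom_ge0// => j; case/andP: (r01 j).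
apply: (@le_coef_psum (fun n => b n * monom n.+1 t) N n) => // z z1.
rewrite -psum_mul lerBrDl -[leLHS]lnK ?ler_expR ?bound//.
by rewrite posrE ltr_pwDl// normc_ge0.
Qed.

End ManyVariables.

(** * Dirichlet series on vertical lines *)

Section VerticalLine.
Variable R : realType.
Local Notation C := R[i].
Local Notation mu := (@lebesgue_measure R).
Implicit Types (a b : nat -> C) (n k : nat) (s : C) (x y t theta : R).

Lemma npowE n x y :
  npow n (x +i* y) = (expR (- (x * ln n%:R)))%:C * cis (- (y * ln n%:R)).
Proof. by rewrite /npow /cexp /cis /=; simpc. Qed.

Lemma npow1 s : npow 1 s = 1.
Proof. by case: s => x y; rewrite npowE ln1 !mulr0 oppr0 expR0 cis0 mulr1. Qed.

Lemma npowM n k s : (0 < n)%N -> (0 < k)%N -> npow (n * k) s = npow n s * npow k s.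
Proof.
move=> n0 k0; case: s => x y; rewrite !npowE natrM lnM ?posrE ?ltr0n//.
by rewrite !mulrDr !opprD expRD cisD rmorphM/= mulrACA.
Qed.

Lemma npowD n s s' : npow n (s + s') = npow n s * npow n s'.
Proof.
case: s s' => x y [x' y']; rewrite -[Complex x y + _]/(Complex (x + x') (y + y')).
by rewrite !npowE !mulrDl !opprD expRD cisD rmorphM/= mulrACA.
Qed.

Lemma normc_npow n x y : normc (npow n (x +i* y)) = expR (- (x * ln n%:R)).
Proof. by rewrite npowE normcM normc_cis mulr1 normc_real ger0_norm// expR_ge0. Qed.

(** Bohr's correspondence: [n^(-s)] is the monomial of [n] at the point with
    coordinates [p^(-s)]. *)
Lemma monom_npow n s : (0 < n)%N -> monom n (fun j => npow (nth_prime j) s) = npow n s.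
Proof.
move=> n0; apply: (@monom_mult _ (fun k => npow k s) _ n0); first exact: npow1.
by move=> k l k0 l0; exact: npowM.
Qed.

Lemma series_dterm a s N :
  series (dterm a s) N = psum a N (fun j => npow (nth_prime j) s).
Proof.
by rewrite /series /= big_mkord; apply: eq_bigr => n _; rewrite monom_npow.
Qed.

Definition line t : nat -> C := fun j => npow (nth_prime j) (0 +i* t).

Lemma normc_line t j : normc (line t j) = 1.
Proof. by rewrite normc_npow mul0r oppr0 expR0. Qed.

Lemma chi_line n k t : (0 < n)%N -> (0 < k)%N ->
  chi n k (line t) = cis ((ln k%:R - ln n%:R) * t).
Proof.
move=> n0 k0; rewrite /chi !monom_npow// !npowE !mul0r oppr0 expR0 rmorph1 !mul1r.
by rewrite conj_cis -cisD; congr cis; ring.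
Qed.

Lemma cis_measurable theta : cmeasurable (fun t : R => cis (theta * t)).
Proof.
split; apply: continuous_measurable_fun => t.
  apply: (@continuous_comp _ _ _ ( *%R theta) cos); last exact: continuous_cos.
  exact: mulrl_continuous.
apply: (@continuous_comp _ _ _ ( *%R theta) sin); last exact: continuous_sin.
exact: mulrl_continuous.
Qed.

Lemma cmeasurable_line j : cmeasurable (fun t : R => line t j).
Proof.
have -> : (fun t => line t j) = (fun t => cis (- ln (nth_prime j)%:R * t)).
  apply/funext => t; rewrite /line npowE mul0r oppr0 expR0 rmorph1 mul1r.
  by congr cis; ring.
exact: cis_measurable.
Qed.

Definition segment T : set R := `[(- T)%R, T].

Lemma measurable_segment T : measurable (segment T).
Proof. exact: measurable_itv. Qed.

Lemma mu_segment T : 0 < T -> mu (segment T) = (2 * T)%:E.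
Proof.
move=> T0; rewrite /segment lebesgue_measure_itv/= lte_fin.
rewrite ifT; last lra.
by rewrite -EFinD; congr EFin; ring.
Qed.

Lemma mu_segment_gt0 T : 0 < T -> (0 < mu (segment T))%E.
Proof. by move=> T0; rewrite mu_segment// lte_fin mulr_gt0. Qed.

Lemma mu_segment_lty T : 0 < T -> (mu (segment T) < +oo)%E.
Proof. by move=> T0; rewrite mu_segment// ltry. Qed.

Lemma tame_chi_line c n k : tame (fun t : R => complex.Re (c * chi n k (line t))).
Proof.
apply: (@tame_Re_normc _ _ _ _ (normc c)).
  apply: cmeasurableM; first exact: cmeasurable_cst.
  apply: cmeasurableM; first exact: cmeasurable_monom cmeasurable_line.
  by apply: cmeasurable_conj; exact: cmeasurable_monom cmeasurable_line.
by move=> t; rewrite normcM normc_chi ?mulr1//; exact: normc_line.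
Qed.

Lemma time_mean_cis c theta T : theta != 0 -> 0 < T ->
  `|mean mu (segment T) (fun t => complex.Re (c * cis (theta * t)))| <=
  normc c / `|theta| / T.
Proof.
move=> th0 T0; case: c => a b.
set f := (fun t => _).
have fE : f = (fun t => a * cos (theta * t) - b * sin (theta * t)) by [].
pose F t := (a * sin (theta * t) + b * cos (theta * t)) / theta.
have dF t : is_derive t 1 F (f t).
  by apply: is_derive_eq; rewrite fE /= scaler0 add0r /GRing.scale /=; field.
have cont (G G' : R -> R) : (forall t, is_derive t 1 G (G' t)) -> continuous G.
  move=> dG t; apply/differentiable_continuous/derivable1_diffP.
  by have [] := dG t.
have cF : continuous F := cont F f dF.
have cf : continuous f.
  apply: (cont f (fun t => - theta * (a * sin (theta * t) + b * cos (theta * t)))) => t.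
  by rewrite fE; apply: is_derive_eq; rewrite /GRing.scale /=; ring.
have int : (\int[mu]_(t in segment T) (f t)%:E = (F T)%:E - (F (- T))%:E)%E.
  apply: continuous_FTC2; first lra.
  - exact: continuous_subspaceT.
  - split; first by move=> t _; have [] := dF t.
      by apply: cvg_at_right_filter; exact: cF.
    by apply: cvg_at_left_filter; exact: cF.
  - by move=> t _; rewrite derive1E; apply: derive_val.
have -> : mean mu (segment T) f = (2 * T)^-1 * (F T - F (- T)).
  rewrite /mean /Rintegral int -[X in (fine X)^-1]/(mu (segment T)).
  by rewrite mu_segment.
have -> : F T - F (- T) = 2 * a * sin (theta * T) / theta.
  by rewrite /F mulrN sinN cosN; field.
have -> : (2 * T)^-1 * (2 * a * sin (theta * T) / theta) = a * sin (theta * T) / theta / T.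
  by field; rewrite th0 gt_eqF.
rewrite !normrM !normfV (gtr0_norm T0) ler_wpM2r ?invr_ge0 ?(ltW T0)//.
rewrite ler_wpM2r ?invr_ge0//.
have := ler_absRe_normc (Complex a b); apply: le_trans => /=.
by rewrite -[leRHS]mulr1 ler_wpM2l// ler_norml sin_geN1 sin_le1.
Qed.

Lemma time_mean_chi c n k : (0 < n)%N -> (0 < k)%N -> exists A, forall T, 0 < T ->
  `|mean mu (segment T) (fun t => complex.Re (c * chi n k (line t))) -
    (if n == k then complex.Re c else 0)| <= A / T.
Proof.
move=> n0 k0; have [->|nk] := eqVneq n k.
  exists 0 => T T0; rewrite mul0r.
  have -> : (fun t => complex.Re (c * chi k k (line t))) = (fun=> complex.Re c).
    by apply/funext => t; rewrite chi_diag ?mulr1//; exact: normc_line.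
  rewrite mean_cst ?subrr ?normr0//; [exact: measurable_segment|
    exact: mu_segment_gt0|exact: mu_segment_lty].
pose theta : R := ln k%:R - ln n%:R.
have th0 : theta != 0.
  rewrite subr_eq0; apply: contra nk => /eqP/ln_inj e.
  by rewrite -(eqr_nat R) e// posrE ltr0n.
exists (normc c / `|theta|) => T T0; rewrite subr0.
under [X in mean _ _ X]eq_fun do rewrite chi_line//.
exact: time_mean_cis.
Qed.

Lemma tame_teval_line (l : tpoly R) : tame (fun t : R => complex.Re (teval l (line t))).
Proof.
apply: tame_Re_normc; last by move=> t; apply: normc_teval; exact: normc_line.
apply: cmeasurable_sum => c; apply: cmeasurableM; first exact: cmeasurable_cst.
apply: cmeasurableM; first exact: cmeasurable_monom cmeasurable_line.
by apply: cmeasurable_conj; exact: cmeasurable_monom cmeasurable_line.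
Qed.

(** The vertical line is equidistributed in the torus, by unique factorization:
    characters other than the constant one oscillate. *)
Lemma time_mean_teval (l : tpoly R) : tpositive l -> exists A, forall T, 0 < T ->
  `|mean mu (segment T) (fun t => complex.Re (teval l (line t))) - complex.Re (tmean l)| <=
  A / T.
Proof.
elim: l => [_|c l ih /= /andP[/andP[n0 k0] /ih[A AP]]].
  exists 0 => T T0; rewrite /teval /tmean big_nil /= mul0r subr0.
  under [X in mean _ _ X]eq_fun do rewrite big_nil.
  rewrite mean_cst ?normr0//; [exact: measurable_segment|
    exact: mu_segment_gt0|exact: mu_segment_lty].
have [B BP] := time_mean_chi c.1 n0 k0.
exists (B + A) => T T0; have {}AP := AP T T0; have {}BP := BP T T0.
have -> : (fun t => complex.Re (teval (c :: l) (line t))) =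
    (fun t => complex.Re (c.1 * chi c.2.1 c.2.2 (line t)) + complex.Re (teval l (line t))).
  by apply/funext => t; rewrite /teval big_cons Re_add.
rewrite meanD; [|exact: measurable_segment|exact: mu_segment_lty|
  exact: tame_chi_line|exact: tame_teval_line].
have -> : complex.Re (tmean (c :: l)) =
    (if c.2.1 == c.2.2 then complex.Re c.1 else 0) + complex.Re (tmean l).
  by rewrite /tmean big_cons; case: ifP; rewrite ?Re_add ?add0r.
rewrite opprD addrACA mulrDl; apply: le_trans (ler_normD _ _) _; exact: lerD.
Qed.

Lemma cmeasurable_psum_line b N : cmeasurable (fun t : R => psum b N (line t)).
Proof.
apply: cmeasurable_sum => n; apply: cmeasurableM; first exact: cmeasurable_cst.
exact: cmeasurable_monom cmeasurable_line.
Qed.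

Lemma tame_ln1D_psum_line b N : tame (fun t : R => ln (1 + normc (psum b N (line t)))).
Proof.
apply: tame_ln1D_normc; first exact: cmeasurable_psum_line.
by move=> t; apply: normc_psum_torus; exact: normc_line.
Qed.

Variable m : probability (Tinf_borel R) R.
Hypothesis hm : is_haar m.

(** Equidistribution, extended from trigonometric polynomials to their uniform
    limits. *)
Lemma time_mean_psum b N (e : R) : 0 < e -> exists2 T0, 0 < T0 & forall T, T0 <= T ->
  `|mean mu (segment T) (fun t => ln (1 + normc (psum b N (line t)))) - lmean m b N| <= e.
Proof.
move=> e0; have e3 : 0 < e / 3 by rewrite divr_gt0.
have [l rl lP] := ln1D_psum_approx b N e3.
have [A AP] := time_mean_teval (reduced_positive rl).
pose T0 := (`|A| + 1) / (e / 3).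
have T00 : 0 < T0 by rewrite divr_gt0// ltr_wpDl.
exists T0 => // T TT; have T1 : 0 < T := lt_le_trans T00 TT.
have AT : A / T <= e / 3.
  rewrite ler_pdivrMr// mulrC -ler_pdivrMr//; apply: le_trans TT.
  rewrite ler_wpM2r ?invr_ge0 ?(ltW e3)//; have := ler_norm A; lra.
have h1 : `|mean mu (segment T) (fun t => ln (1 + normc (psum b N (line t)))) -
    mean mu (segment T) (fun t => complex.Re (teval l (line t)))| <= e / 3.
  apply: mean_dist; [exact: measurable_segment|exact: mu_segment_gt0|exact: mu_segment_lty|
    exact: tame_ln1D_psum_line|exact: tame_teval_line|].
  by move=> t; apply: lP; exact: normc_line.
have h2 : `|lmean m b N - complex.Re (tmean l)| <= e / 3.
  rewrite -(mean_teval hm (reduced_positive rl)); apply: mean_dist => //;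
    [exact: m_setT_gt0|exact: m_setT_lty|exact: tame_ln1D_psum|exact: tame_teval|].
  by move=> w; apply: lP; exact: normc_tpoint.
have h3 := AP T T1.
have := le_trans h3 AT; move: h1 h2; rewrite /lmean.
move: (mean mu _ _) (mean mu _ _) (mean m _ _) (complex.Re _) => x1 x2 x3 x4.
rewrite !ler_norml; lra.
Qed.

End VerticalLine.

Section UniformConvergence.
Variable R : realType.
Local Notation C := R[i].
Local Notation mu := (@lebesgue_measure R).
Implicit Types (a b : nat -> C) (sigma : R).

Lemma cvgn_normc (u : nat -> C) (l : C) :
  (forall e : R, 0 < e -> exists N, forall n, (N <= n)%N -> normc (u n - l) <= e) ->
  u @ \oo --> l.
Proof.
move=> H; apply/(@cvgrPdist_le C C^o) => e e0.
have Re0 : e = (complex.Re e)%:C by rewrite RRe_real// gtr0_real.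
have e0' : 0 < complex.Re e by move: e0; rewrite {1}Re0 ltcR.
have [N NP] := H _ e0'; exists N => // n /= /NP.
by rewrite normc_distC Re0 lecR.
Qed.

Lemma limn_normc (u : nat -> C) (l : C) :
  (forall e : R, 0 < e -> exists N, forall n, (N <= n)%N -> normc (u n - l) <= e) ->
  limn u = l.
Proof. by move=> /cvgn_normc ul; exact: (@cvg_lim C^o). Qed.

Lemma cvgn_normcP (u : nat -> C) : cvgn u ->
  forall e : R, 0 < e -> exists N, forall n, (N <= n)%N -> normc (u n - limn u) <= e.
Proof.
move=> uc e e0; have /(@cvgrPdist_le C C^o) /(_ e%:C) : u @ \oo --> limn u by exact: uc.
rewrite ltcR => /(_ e0)[N _ NP]; exists N => n /NP /=.
by rewrite lecR normc_distC.
Qed.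

Lemma cauchy_normc (u : nat -> C) :
  (forall e : R, 0 < e -> exists N, forall n k, (N <= n)%N -> (N <= k)%N ->
     normc (u n - u k) <= e) -> cvgn u.
Proof.
move=> H.
have cR (f : C -> R) : (forall x y, `|f x - f y| <= normc (x - y)) -> cvgn (f \o u).
  move=> fl; apply/cauchy_cvgP/cauchy_exP => e e0.
  have e20 : 0 < e / 2 by rewrite divr_gt0.
  have [N NP] := H _ e20; exists (f (u N)); exists N => // n /= Nn.
  apply: le_lt_trans (fl _ _) _; apply: le_lt_trans (NP _ _ _ _) _ => //.
  by rewrite ltr_pdivrMr// ltr_pMr// ltrDl.
have cRe : cvgn (fun n => complex.Re (u n)).
  by apply: (cR (@complex.Re R)) => x y; rewrite -Re_opp -Re_add ler_absRe_normc.
have cIm : cvgn (fun n => complex.Im (u n)).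
  by apply: (cR (@complex.Im R)) => x y; rewrite -Im_opp -Im_add ler_absIm_normc.
apply/cvg_ex; exists (Complex (limn (fun n => complex.Re (u n))) (limn (fun n => complex.Im (u n)))).
apply: cvgn_normc => e e0; have e20 : 0 < e / 2 by rewrite divr_gt0.
have /cvgrPdist_le/(_ _ e20)[N1 _ P1] := cRe.
have /cvgrPdist_le/(_ _ e20)[N2 _ P2] := cIm.
exists (maxn N1 N2) => n; rewrite geq_max => /andP[/P1 h1 /P2 h2].
apply: le_trans (normc_le_ReIm _) _; rewrite Re_add Im_add Re_opp Im_opp /=.
rewrite [e](_ : _ = e / 2 + e / 2); last by field.
by rewrite (distrC _ (limn _)) (distrC (complex.Im _) (limn _)) lerD.
Qed.

Lemma unif_cvg_rightP a sigma (f : C -> C) :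
  {uniform [set s : C | sigma < complex.Re s],
    (fun n s => series (dterm a s) n) @ \oo --> f} ->
  forall e : R, 0 < e -> exists N, forall n, (N <= n)%N -> forall s, sigma < complex.Re s ->
    normc (series (dterm a s) n - f s) <= e.
Proof.
move=> H e e0.
have : nbhs (f : {uniform` [set s : C | sigma < complex.Re s] -> C^o})
   [set h | forall s, sigma < complex.Re s -> normc (h s - f s) <= e].
  apply/uniform_nbhs; exists [set xy : C^o * C^o | ball xy.1 e%:C xy.2]; split.
    have eC : (0 : C) < e%:C by rewrite ltcR.
    exact: (@entourage_ball C C^o (PosNum eC)).
  move=> h hP s /hP; rewrite /= /ball /= normc_distC => hs; apply: ltW; move: hs.
  by rewrite ltcR.
by move=> /H[N _ NP]; exists N => n /NP.
Qed.

Lemma psum_dshift a sigma N t :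
  psum (dshift sigma a) N (line t) = series (dterm a (sigma +i* t)) N.
Proof.
rewrite /series /= big_mkord; apply: eq_bigr => n _.
rewrite monom_npow// -mulrA -npowD; congr (_ * npow _ _).
by apply/eqP; rewrite eq_complex /= addr0 add0r !eqxx.
Qed.

Lemma uniform_line a sigma : (abscissa_u a <= 0)%E -> 0 < sigma ->
  forall e : R, 0 < e -> exists N, forall n, (N <= n)%N -> forall t,
    normc (psum (dshift sigma a) n (line t) - dsum (dshift sigma a) (0 +i* t)) <= e.
Proof.
move=> a0 s0.
have : (abscissa_u a < sigma%:E)%E by apply: le_lt_trans a0 _; rewrite lte_fin.
move=> /ereal_inf_lt[_ [s' [f fP] <-]]; rewrite lte_fin => ss.
have H := unif_cvg_rightP fP.
have dE t : dsum (dshift sigma a) (0 +i* t) = f (sigma +i* t).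
  apply: limn_normc => e /H[N NP]; exists N => n /NP.
  by rewrite series_dterm -/(line t) psum_dshift; apply.
by move=> e /H[N NP]; exists N => n /NP {}NP t; rewrite dE psum_dshift; apply: NP.
Qed.

Variable m : probability (Tinf_borel R) R.
Hypothesis hm : is_haar m.

Lemma psum_tail b N M z : (N <= M)%N ->
  psum (fun n => if (n < N)%N then 0 else b n) M z = psum b M z - psum b N z.
Proof.
move=> NM; rewrite /psum (big_ord_widen M (fun n => b n * monom n.+1 z) NM).
rewrite [X in _ = X - _](bigID (fun n : 'I_M => (n < N)%N))/= addrAC subrr add0r.
rewrite (bigID (fun n : 'I_M => (n < N)%N))/= big1 ?add0r => [|n ->]; last by rewrite mul0r.
by apply: eq_bigr => n /negbTE->.
Qed.

Lemma lmean_le_add b b1 b2 N N1 N2 :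
  (forall z, normc (psum b N z) <= normc (psum b1 N1 z) + normc (psum b2 N2 z)) ->
  lmean m b N <= lmean m b1 N1 + lmean m b2 N2.
Proof.
move=> H; have mT := m_setT_gt0 m; have mT' := m_setT_lty m.
rewrite /lmean -(meanD measurableT mT'); try exact: tame_ln1D_psum.
apply: mean_le => //; first exact: tame_ln1D_psum.
  by apply: tameD; exact: tame_ln1D_psum.
move=> w; apply: le_trans (ln1D_add (normc_ge0 _) (normc_ge0 _)).
by rewrite le_ln1D ?normc_ge0.
Qed.

Lemma lmean_tail_dist b N M : (N <= M)%N ->
  `|lmean m b N - lmean m b M| <= lmean m (fun n => if (n < N)%N then 0 else b n) M.
Proof.
move=> NM; set b' := fun n => _.
have E z : psum b' M z = psum b M z - psum b N z by exact: psum_tail.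
rewrite ler_distl lerBlDr; apply/andP; split; apply: lmean_le_add => z; rewrite E.
  by rewrite -[psum b M z in leLHS](subrK (psum b N z)) addrC ler_normcD.
rewrite (normc_distC (psum b M z)).
by rewrite -[psum b N z in leLHS](subrK (psum b M z)) addrC ler_normcD.
Qed.

(** Only the values of the partial sums on the vertical line are controlled by
    uniform convergence; equidistribution transfers the control to the torus. *)
Lemma lmean_tail a sigma : (abscissa_u a <= 0)%E -> 0 < sigma ->
  forall e : R, 0 < e -> exists N0, forall N M, (N0 <= N)%N -> (N <= M)%N ->
  lmean m (fun n => if (n < N)%N then 0 else dshift sigma a n) M <= e.
Proof.
move=> a0 s0 e e0; have e2 : 0 < e / 2 by rewrite divr_gt0.
have e4 : 0 < e / 4 by rewrite divr_gt0.
have [N0 NP] := uniform_line a0 s0 e4; exists N0 => N M N0N NM.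
set b' := fun n => _.
have [T T0 TP] := time_mean_psum hm b' M e2.
have := TP T (lexx _).
have : mean mu (segment T) (fun t => ln (1 + normc (psum b' M (line t)))) <= e / 2.
  rewrite -[leRHS](@mean_cst _ _ _ mu _ (measurable_segment T) (mu_segment_gt0 T0)
    (mu_segment_lty T0)).
  apply: mean_le; [exact: measurable_segment|exact: mu_segment_gt0|exact: mu_segment_lty|
    exact: tame_ln1D_psum_line|exact: tame_cst|].
  move=> t; apply: le_trans (ln1D_le (normc_ge0 _)) _.
  have -> : psum b' M (line t) = psum (dshift sigma a) M (line t) - psum (dshift sigma a) N (line t).
    exact: psum_tail.
  set d := dsum (dshift sigma a) (0 +i* t).
  rewrite -(subrK d (psum _ M _)) -addrA.
  apply: le_trans (ler_normcD _ _) _; rewrite (normc_distC d).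
  have h1 := NP M (leq_trans N0N NM) t; have h2 := NP N N0N t.
  have := lerD h1 h2; rewrite -/d; lra.
move: (mean mu _ _) (lmean m b' M) => x y; rewrite ler_norml; lra.
Qed.

(** The partial sums are uniformly close to the sum on the vertical line, so that the
    time means of the sum and the torus means of the partial sums have a common
    limit. *)
Lemma cvg_mean_log a sigma : (abscissa_u a <= 0)%E -> 0 < sigma ->
  exists2 L : R, mean_log (dshift sigma a) = L%:E &
    forall e : R, 0 < e -> exists N0, forall N, (N0 <= N)%N ->
      `|lmean m (dshift sigma a) N - L| <= e.
Proof.
move=> a0 s0; set b := dshift sigma a.
pose g t := ln (1 + normc (dsum b (0 +i* t))).
have tg : tame g.
  have [N NP] := uniform_line a0 s0 (ltr01).
  apply: (@tame_ln1D_normc _ _ _ _ (1 + \sum_(n < N) normc (b n))).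
    apply: (@cmeasurable_cvg _ _ _ (fun N t => psum b N (line t))).
      by move=> n; exact: cmeasurable_psum_line.
    by move=> t e /(uniform_line a0 s0)[N' N'P]; exists N' => n /N'P.
  move=> t; rewrite -(subrK (psum b N (line t)) (dsum b _)).
  apply: le_trans (ler_normcD _ _) _; apply: lerD.
    by rewrite normc_distC NP.
  by apply: normc_psum_torus; exact: normc_line.
pose A T := mean mu (segment T) g.
have near_A e : 0 < e -> exists N0, forall N, (N0 <= N)%N -> exists2 T0, 0 < T0 &
    forall T, T0 <= T -> `|A T - lmean m b N| <= e.
  move=> e0; have e2 : 0 < e / 2 by rewrite divr_gt0.
  have [N0 NP] := uniform_line a0 s0 e2; exists N0 => N N0N.
  have [T0 T00 TP] := time_mean_psum hm b N e2.
  exists T0 => // T T0T; have T1 := lt_le_trans T00 T0T.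
  have h : `|A T - mean mu (segment T) (fun t => ln (1 + normc (psum b N (line t))))| <= e / 2.
    apply: mean_dist; [exact: measurable_segment|exact: mu_segment_gt0|exact: mu_segment_lty|
      exact: tg|exact: tame_ln1D_psum_line|].
    move=> t; have hd := NP N N0N t.
    have h1 := ln1D_normc_le hd; rewrite normc_distC in hd; have h2 := ln1D_normc_le hd.
    by rewrite ler_distl lerBlDr /g h2 h1.
  have := TP T T0T; move: h.
  move: (A T) (mean mu _ _) (lmean m b N) => x y z; rewrite !ler_norml; lra.
have cauchyN e : 0 < e -> exists N0, forall N M, (N0 <= N)%N -> (N0 <= M)%N ->
    `|lmean m b N - lmean m b M| <= e.
  move=> e0; have e2 : 0 < e / 2 by rewrite divr_gt0.
  have [N0 NP] := near_A _ e2; exists N0 => N M /NP[T T0 TP] /NP[T' T0' TP'].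
  have := TP (Num.max T T'); rewrite le_max lexx => /(_ isT).
  have := TP' (Num.max T T'); rewrite le_max lexx orbT => /(_ isT).
  move: (A _) (lmean m b N) (lmean m b M) => x y z; rewrite !ler_norml; lra.
have cN : cvgn (lmean m b).
  apply/cauchy_cvgP/cauchy_exP => e e0; have e20 : 0 < e / 2 by rewrite divr_gt0.
  have [N NP] := cauchyN _ e20; exists (lmean m b N); exists N => // n /= Nn.
  apply: le_lt_trans (NP N n (leqnn _) Nn) _.
  by rewrite ltr_pdivrMr// ltr_pMr// ltrDl.
exists (limn (lmean m b)); last first.
  move=> e e0; have /cvgrPdist_le/(_ _ e0)[N0 _ NP] := cN; exists N0 => N /NP.
  by rewrite distrC.
apply: cvg_lim => //; apply: cvg_trans (_ : (fun T => (A T)%:E) @ +oo%R --> _); last first.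
  apply: cvg_EFin; first by near=> T.
  apply/cvgrPdist_le => e e0; have e2 : 0 < e / 2 by rewrite divr_gt0.
  have [N0 NP] := near_A _ e2.
  have /cvgrPdist_le/(_ _ e2)[N1 _ NP1] := cN.
  have [T0 T00 TP] := NP (maxn N0 N1) (leq_maxl _ _).
  exists T0; split; first exact: num_real.
  move=> T /ltW/TP; have := NP1 (maxn N0 N1) (leq_maxr _ _).
  rewrite -[(_ \o _) T]/(A T).
  move: (A T) (lmean m b _) (limn _) => x y z; rewrite !ler_norml; lra.
apply: near_eq_cvg; exists 0; split; first exact: num_real.
move=> T T0; rewrite /A /mean EFinM; congr (_ * _)%E.
  by rewrite -[X in (fine X)^-1]/(mu (segment T)) mu_segment.
rewrite /Rintegral fineK//; apply: integrable_fin_num; first exact: measurable_segment.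
exact: (@tame_integrable _ _ _ mu _ (measurable_segment T) (mu_segment_lty T0) _ tg).
Unshelve. all: by end_near. Qed.

End UniformConvergence.

(** * Coefficient estimates *)

Section CoefficientBound.
Variable R : realType.
Local Notation C := R[i].
Implicit Types (a b : nat -> C) (sigma : R) (r : nat -> R).

(** The growth of the coefficients of a power series of logarithmic norm at most
    [K]: Harnack's inequality followed by Cauchy's estimate on every polydisc. *)
Definition coef_bound (K : R) a : Prop :=
  forall n r, (forall j, 0 <= r j < 1) ->
    normc (a n) * monom n.+1 r <= expR ((\prod_(j < n.+1) harnack (r j)) * K) - 1.

Variable m : probability (Tinf_borel R) R.
Hypothesis hm : is_haar m.

Lemma lmean_ge0 b N : 0 <= lmean m b N.
Proof.
rewrite -(mean_cst measurableT (m_setT_gt0 m) (m_setT_lty m) 0).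
apply: mean_le => //; [exact: m_setT_gt0|exact: m_setT_lty|exact: tame_cst|exact: tame_ln1D_psum|].
by move=> w; rewrite ln1D_ge0// normc_ge0.
Qed.

Lemma lmean_dshift_le a sigma sigma' N : sigma <= sigma' ->
  lmean m (dshift sigma' a) N <= lmean m (dshift sigma a) N.
Proof.
move=> ss; pose t j := npow (nth_prime j) (sigma' - sigma)%:C.
have -> : dshift sigma' a = (fun n => dshift sigma a n * monom n.+1 t).
  apply/funext => n; rewrite /t monom_npow// -mulrA -npowD; congr (_ * npow _ _).
  by rewrite -rmorphD/= addrC subrK.
apply: lmean_contract => // j; rewrite normc_npow -[leRHS]expR0 ler_expR oppr_le0.
by rewrite mulr_ge0 ?subr_ge0// ln_ge0// ler1n prime_gt0// nth_prime_prime.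
Qed.

Lemma prod_harnack_ge1 n r : (forall j, 0 <= r j < 1) -> 1 <= \prod_(j < n) harnack (r j).
Proof.
move=> r01; elim/big_ind : _ => // [x y x1 y1|j _]; first by rewrite mulr_ege1.
exact: harnack_ge1.
Qed.

(** The estimate of [le_coef_lmean] holds for every shifted series; the shift tends
    to [0]. *)
Lemma norm0_coef_bound a K : (abscissa_u a <= 0)%E -> (norm0 a <= K%:E)%E -> coef_bound K a.
Proof.
move=> a0 aK n r r01; set H := \prod_(j < _) _.
have H1 : 1 <= H by exact: prod_harnack_ge1.
have H0 : 0 < H by exact: lt_le_trans H1.
set M := monom n.+1 r.
have M0 : 0 <= M by apply: monom_ge0 => j; case/andP: (r01 j).
have shifted sigma : 0 < sigma ->
    normc (a n) * M * expR (- (sigma * ln n.+1%:R)) <= expR (H * K) - 1.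
  move=> s0; have [L LE Llim] := cvg_mean_log hm a0 s0.
  have LK : L <= K.
    by rewrite -lee_fin -LE; apply: le_trans aK; apply: ereal_sup_ubound; exists sigma.
  have -> : normc (a n) * M * expR (- (sigma * ln n.+1%:R)) = normc (dshift sigma a n) * M.
    by rewrite /dshift normcM normc_npow mulrAC.
  set x := normc _ * M; have x0 : 0 <= x by rewrite mulr_ge0 ?normc_ge0.
  rewrite lerBrDl -[leLHS]lnK ?posrE ?ltr_pwDl// ler_expR.
  apply/ler_addgt0Pr => e e0; have eH : 0 < e / H by rewrite divr_gt0.
  have [N0 NP] := Llim _ eH.
  have /= := NP (maxn N0 n.+1) (leq_maxl _ _).
  rewrite ler_distl => /andP[_ hL].
  have nN : (n < maxn N0 n.+1)%N by rewrite leq_maxr.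
  have := le_coef_lmean hm (dshift sigma a) nN r01.
  rewrite -/M -/x -/H lerBrDl -{1}[1 + x]lnK ?posrE ?ltr_pwDl// ler_expR => h.
  apply: le_trans h _; apply: le_trans (_ : H * (L + e / H) <= _).
    by rewrite ler_wpM2l// ltW.
  by rewrite mulrDr [H * (e / H)]mulrC divfK ?gt_eqF// lerD2r ler_wpM2l// ltW.
set x := normc (a n) * M in shifted *; have x0 : 0 <= x by rewrite mulr_ge0 ?normc_ge0.
set l := ln n.+1%:R in shifted *; have l0 : 0 <= l by rewrite ln_ge0// ler1n.
apply/ler_addgt0Pr => e e0.
have xl : 0 < x * l + 1 by rewrite ltr_wpDl// mulr_ge0.
have s0 : 0 < e / (x * l + 1) by rewrite divr_gt0.
have := shifted _ s0; set s := e / _ in s0 *.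
have se : x * (s * l) <= e.
  rewrite (_ : x * (s * l) = e * (x * l) / (x * l + 1)); last by rewrite /s; field; rewrite gt_eqF.
  by rewrite ler_pdivrMr// ler_wpM2l ?(ltW e0)// lerDl.
have : x * (1 - s * l) <= x * expR (- (s * l)).
  by rewrite ler_wpM2l// expR_ge1Dx.
lra.
Qed.

Lemma Nu_abscissa a : Nu a -> (abscissa_u a <= 0)%E.
Proof. by case. Qed.

Lemma norm0_ge0 a : (abscissa_u a <= 0)%E -> (0 <= norm0 a)%E.
Proof.
move=> a0; have [L LE Llim] := cvg_mean_log hm a0 ltr01.
apply: le_trans (_ : L%:E <= _)%E; last by apply: ereal_sup_ubound; exists 1 => //=.
rewrite lee_fin; apply/ler_addgt0Pr => e /Llim[N /(_ N (leqnn _))].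
by rewrite ler_distl => /andP[_]; apply: le_trans; exact: lmean_ge0.
Qed.

(** The mean is nonincreasing in the abscissa, so that the upper limit at [0] bounds
    the supremum. *)
Lemma Nu_norm0 a : Nu a -> exists K : R, norm0 a = K%:E.
Proof.
move=> [a0]; rewrite limf_esupE => /ereal_inf_lt[_ [V V0 <-] Vy].
suff h : (norm0 a < +oo)%E.
  exists (fine (norm0 a)); rewrite fineK// fin_numElt h andbT.
  exact: lt_le_trans (norm0_ge0 a0).
apply: le_lt_trans Vy; apply: ge_ereal_sup => _ [sigma /= s0 <-].
have [s [s1 ss Vs]] : exists s, [/\ 0 < s, s <= sigma & V s].
  have : \forall s \near 0^'+, V s /\ 0 < s <= sigma.
    near=> s; split; first by near: s.
    apply/andP; split; first by near: s; exact: nbhs_right_gt.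
    by near: s; exact: nbhs_right_le.
  by move=> H; have /filter_ex[s [Vs /andP[? ?]]] := H; exists s.
apply: le_trans (_ : mean_log (dshift s a) <= _)%E; last by apply: ereal_sup_ubound; exists s.
have [L -> Llim] := cvg_mean_log hm a0 s0; have [L' -> L'lim] := cvg_mean_log hm a0 s1.
rewrite lee_fin; apply/ler_addgt0Pr => e e0; have e2 : 0 < e / 2 by rewrite divr_gt0.
have [N NP] := Llim _ e2; have [N' N'P] := L'lim _ e2.
have := NP _ (leq_maxl N N'); have := N'P _ (leq_maxr N N').
have := lmean_dshift_le a (maxn N N') ss.
move: (lmean m _ _) (lmean m _ _) => x y; rewrite !ler_norml; lra.
Unshelve. all: by end_near. Qed.

End CoefficientBound.

(** * Absolute convergence *)

Section Multinomial.
Variable R : realType.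
Implicit Types (n j T : nat) (x : R).

Lemma sum_dvdn (f : nat -> R) p N : (0 < p)%N ->
  \sum_(1 <= n < N.+1 | (p %| n)%N) f (n %/ p)%N = \sum_(1 <= n < (N %/ p).+1) f n.
Proof.
move=> p0; elim: N => [|N ih]; first by rewrite div0n !big_geq.
rewrite big_mkcond big_nat_recr//= -big_mkcond ih divnS//.
case: ifP => pN; rewrite ?addn0 ?addr0 ?add0n// add1n.
by rewrite [in RHS]big_nat_recr//= pN add1n.
Qed.

Lemma sum_dvdn_le (f : nat -> R) p N : (0 < p)%N -> (forall n, 0 <= f n) ->
  \sum_(1 <= n < N.+1 | (p %| n)%N) f (n %/ p)%N <= \sum_(1 <= n < N.+1) f n.
Proof.
move=> p0 f0; rewrite sum_dvdn// [leRHS](@big_cat_nat _ _ _ (N %/ p).+1)//=.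
  by rewrite lerDl sumr_ge0.
by rewrite ltnS leq_div.
Qed.

(** A weak form of Stirling's formula. *)
Lemma expn_le_fact T : T%:R ^+ T <= expR 1 ^+ T * T`!%:R :> R.
Proof.
elim: T => [|T ih]; first by rewrite !expr0 fact0 mulr1.
have [->|T0] := posnP T.
  by rewrite !expr1 factS fact0 muln1 mulr1 -expR0 ler_expR.
have T0' : 0 < T%:R :> R by rewrite ltr0n.
have step : T.+1%:R ^+ T <= expR 1 * T%:R ^+ T :> R.
  have -> : T.+1%:R = (1 + T%:R^-1) * T%:R :> R by rewrite mulrDl mul1r mulVf ?gt_eqF// -natr1.
  rewrite exprMn ler_pM2r ?exprn_gt0//.
  have -> : expR 1 = expR (T%:R^-1) ^+ T :> R.
    by rewrite -expRM_natl divff ?gt_eqF.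
  by rewrite lerXn2r ?nnegrE ?expR_ge0 ?expR_ge1Dx// addr_ge0// invr_ge0 ltW.
rewrite factS natrM exprS [leRHS]mulrCA ler_wpM2l// exprS -mulrA.
by apply: le_trans step _; rewrite ler_pM2l ?expR_gt0.
Qed.

Lemma fact_le_expn n : n`!%:R <= n%:R ^+ n :> R.
Proof.
rewrite -natrX ler_nat; elim: n => [|n ih]; first by rewrite expn0.
rewrite factS expnS leq_mul2l/=; apply: leq_trans ih _.
by case: (n) => // k; rewrite leq_exp2r.
Qed.

Variables (k J : nat) (v : nat -> R).
Hypotheses (kJ : (k <= J)%N) (v0 : forall j, 0 <= v j).
Local Notation alpha n j := (logn (nth_prime j) n).

Definition tdeg n := (\sum_(k <= j < J) alpha n j)%N.

Definition weight n : R := (tdeg n)`!%:R / \prod_(k <= j < J) (alpha n j)`!%:R.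

(** A monomial in the first [k] variables times a term of the expansion of
    [(v k + ... + v (J - 1)) ^ t], where [t = tdeg n]. *)
Definition multi n : R := weight n * \prod_(0 <= j < J) v j ^+ alpha n j.

Lemma prod_single (S : comNzRingType) (i l u : nat) (c : S) : (l <= i < u)%N ->
  \prod_(l <= j < u) (if j == i then c else 1) = c.
Proof.
move=> iu; rewrite (bigD1_seq i) ?mem_index_iota ?iota_uniq//= eqxx big1 ?mulr1//.
by move=> j /negbTE->.
Qed.

Lemma sum_single i (l u : nat) : (l <= i < u)%N ->
  (\sum_(l <= j < u) (j == i) = 1)%N.
Proof.
move=> iu; rewrite (bigD1_seq i) ?mem_index_iota ?iota_uniq//= eqxx big1//.
by move=> j /negbTE->.
Qed.

Lemma alphaM n i j : (0 < n)%N -> alpha (n * nth_prime i) j = (alpha n j + (j == i))%N.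
Proof.
move=> n0; have pi := nth_prime_prime i.
rewrite lognM ?(prime_gt0 pi)// (logn_prime _ pi).
by rewrite (inj_eq nth_prime_inj).
Qed.

Lemma prod_alphaM n i u : (0 < n)%N -> (i < u)%N ->
  \prod_(0 <= j < u) v j ^+ alpha (n * nth_prime i) j =
  v i * \prod_(0 <= j < u) v j ^+ alpha n j.
Proof.
move=> n0 iu; rewrite -[X in _ = X * _](@prod_single _ i 0 u (v i) iu) -big_split/=.
apply: eq_bigr => j _; rewrite alphaM//.
by case: eqVneq => [->|_]; [rewrite addn1 exprS|rewrite addn0 mul1r].
Qed.

Lemma multi_ge0 n : 0 <= multi n.
Proof.
rewrite mulr_ge0//; first by rewrite divr_ge0// prodr_ge0.
by apply: prodr_ge0 => j _; rewrite exprn_ge0.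
Qed.

Lemma multiM n i : (0 < n)%N -> (k <= i < J)%N ->
  (alpha (n * nth_prime i) i)%:R * multi (n * nth_prime i) =
  (tdeg (n * nth_prime i))%:R * (v i * multi n).
Proof.
move=> n0 iJ; rewrite /multi /weight.
have dE : tdeg (n * nth_prime i) = (tdeg n).+1.
  rewrite /tdeg (eq_bigr (fun j => alpha n j + (j == i))%N) => [|j _]; last exact: alphaM.
  by rewrite big_split/= sum_single// addn1.
have fE : \prod_(k <= j < J) (alpha (n * nth_prime i) j)`!%:R =
    (alpha (n * nth_prime i) i)%:R * \prod_(k <= j < J) (alpha n j)`!%:R :> R.
  rewrite -[X in _ = X * _](@prod_single _ i k J) // -big_split/=.
  apply: eq_bigr => j _; rewrite alphaM//; case: eqVneq => [->|_]; last by rewrite addn0 mul1r.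
  by rewrite alphaM// eqxx addn1 factS natrM.
have vE := @prod_alphaM n i J n0 (proj2 (andP iJ)).
have a0 : (alpha (n * nth_prime i) i)%:R != 0 :> R by rewrite alphaM// eqxx addn1 pnatr_eq0.
have p0 : \prod_(k <= j < J) (alpha n j)`!%:R != 0 :> R.
  by rewrite prodf_seq_neq0; apply/allP => j _; rewrite /= pnatr_eq0 -lt0n fact_gt0.
by rewrite vE fE dE factS natrM; field; rewrite a0 p0.
Qed.

(** Deleting one prime factor, in all possible ways, is the recursion of the
    multinomial coefficients. *)
Lemma multi_le n : (0 < n)%N -> (0 < tdeg n)%N ->
  multi n <= \sum_(k <= j < J | (nth_prime j %| n)%N) v j * multi (n %/ nth_prime j).
Proof.
move=> n0 t0; have t0' : 0 < (tdeg n)%:R :> R by rewrite ltr0n.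
rewrite -(ler_pM2l t0') mulr_sumr.
have -> : (tdeg n)%:R * multi n = \sum_(k <= j < J) (alpha n j)%:R * multi n.
  by rewrite /tdeg natr_sum mulr_suml.
rewrite (bigID (fun j => nth_prime j %| n)%N)/=.
rewrite [X in _ + X]big1 ?addr0 => [|j pn]; last first.
  by rewrite lognE (negbTE pn) !andbF mul0r.
rewrite big_nat_cond [leRHS]big_nat_cond.
apply: ler_sum => j /andP[jJ /dvdnP[n' nE]].
have n'0 : (0 < n')%N by move: n0; rewrite nE muln_gt0 => /andP[].
by rewrite nE mulnK ?multiM// prime_gt0// nth_prime_prime.
Qed.

Variable N : nat.
Hypothesis NJ : (N <= J)%N.

(** By [multi_le], the sum is at most its part without the later variables, plus
    [theta] times itself. *)
Lemma sum_multi_tail (theta : R) : theta < 1 -> \sum_(k <= j < J) v j <= theta ->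
  \sum_(1 <= n < N.+1) multi n <=
  (\sum_(1 <= n < N.+1 | tdeg n == 0%N) multi n) / (1 - theta).
Proof.
move=> th1 vth; rewrite ler_pdivlMr ?subr_gt0// mulrBr mulr1 lerBlDr.
rewrite {1}(bigID (fun n => tdeg n == 0%N))/= lerD2l.
apply: le_trans (_ : \sum_(1 <= n < N.+1) \sum_(k <= j < J | (nth_prime j %| n)%N)
    v j * multi (n %/ nth_prime j) <= _).
  rewrite big_mkcond /= big_nat_cond [leRHS]big_nat_cond.
  apply: ler_sum => n /andP[/andP[n0 _] _]; case: ifP => tn.
    by apply: multi_le => //; rewrite lt0n.
  by apply: sumr_ge0 => j _; rewrite mulr_ge0 ?multi_ge0.
rewrite (exchange_big_dep xpredT)//=.
apply: le_trans (_ : \sum_(k <= j < J) v j * \sum_(1 <= n < N.+1) multi n <= _).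
  apply: ler_sum => j _; rewrite -mulr_sumr ler_wpM2l//.
  by apply: sum_dvdn_le; [rewrite prime_gt0// nth_prime_prime|exact: multi_ge0].
rewrite -mulr_suml [leRHS]mulrC ler_wpM2r// sumr_ge0// => n _; exact: multi_ge0.
Qed.

Lemma multi_smooth n : tdeg n = 0%N -> multi n = \prod_(0 <= j < k) v j ^+ alpha n j.
Proof.
move=> tn; rewrite /multi /weight tn fact0 div1r.
have a0 j : (k <= j < J)%N -> alpha n j = 0%N.
  move=> jJ; move/eqP: tn; rewrite /tdeg (bigD1_seq j) ?mem_index_iota ?iota_uniq//=.
  by rewrite addn_eq0 => /andP[/eqP].
rewrite big_nat_cond big1 ?invr1 ?mul1r => [|j /andP[/a0-> _]]; last by rewrite fact0.
have e : \prod_(k <= j < J) v j ^+ alpha n j = 1.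
  by rewrite big_nat_cond big1// => j /andP[/a0-> _]; rewrite expr0.
by rewrite (@big_cat_nat _ _ _ k)//= e mulr1.
Qed.

(** The primes before the [k]-th are allowed one after the other. Each contributes a
    geometric factor, by splitting the integers according to divisibility by it. *)
Lemma sum_smooth (q : R) : 0 <= q < 1 -> (forall j, (j < k)%N -> v j <= q) ->
  \sum_(1 <= n < N.+1 | tdeg n == 0%N) multi n <= (1 - q)^-1 ^+ k.
Proof.
move=> /andP[q0 q1] vq.
pose A i := \sum_(1 <= n < N.+1 | (\sum_(i <= j < J) alpha n j)%N == 0%N)
    \prod_(0 <= j < i) v j ^+ alpha n j.
have A0 i : 0 <= A i.
  by apply: sumr_ge0 => n _; apply: prodr_ge0 => j _; rewrite exprn_ge0.
rewrite (_ : \sum_(_ <= _ < _ | _) _ = A k); last first.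
  by apply: eq_bigr => n /eqP; exact: multi_smooth.
suff h i : (i <= k)%N -> A i <= (1 - q)^-1 ^+ i by exact: h.
elim: i => [_|i ih ik].
  rewrite expr0 /A; apply: le_trans (_ : \sum_(1 <= n < N.+1 | n == 1%N) 1 <= _).
    rewrite big_mkcond [leRHS]big_mkcond /= big_nat_cond [leRHS]big_nat_cond.
    apply: ler_sum => n /andP[/andP[n0 nN] _]; rewrite [\prod_(0 <= j < 0) _]big_geq//.
    have [->|n1] := eqVneq n 1%N; first by case: ifP.
    case: ifP => // /eqP s0; exfalso.
    have n1' : (1 < n)%N by rewrite ltn_neqAle eq_sym n1.
    have [j pE] := nth_prime_surj (pdiv_prime n1').
    have jJ : (j < J)%N.
      apply: leq_trans (nth_prime_gtn j) _; rewrite pE.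
      by apply: leq_trans (dvdn_leq n0 (pdiv_dvd n)) _; apply: leq_trans NJ.
    move/eqP: s0; rewrite (bigD1_seq j) ?mem_index_iota ?iota_uniq//= addn_eq0 => /andP[+ _].
    by apply/negP; rewrite -lt0n logn_gt0 pE mem_primes pdiv_prime// n0 pdiv_dvd.
  case: N => [|N']; first by rewrite big_geq.
  rewrite big_ltn_cond//= big_nat_cond big1 ?addr0// => n /andP[/andP[n1 _] /eqP ne].
  by move: n1; rewrite ne.
have iJ : (i < J)%N by exact: leq_trans ik kJ.
suff H : A i.+1 <= A i + q * A i.+1.
  have q1' : 0 < 1 - q by rewrite subr_gt0.
  rewrite exprSr ler_pdivlMr//; apply: le_trans (ih (ltnW ik)).
  rewrite mulrBr mulr1 lerBlDr mulrC; exact: H.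
rewrite {1}/A (bigID (fun n => nth_prime i %| n)%N)/= addrC; apply: lerD.
  rewrite /A big_mkcond [leRHS]big_mkcond big_nat_cond [leRHS]big_nat_cond/=.
  apply: ler_sum => n /andP[/andP[n0 _] _].
  have [pn|pn] := boolP (nth_prime i %| n)%N; rewrite ?andbF ?andbT.
    by case: ifP => // _; apply: prodr_ge0 => j _; rewrite exprn_ge0.
  have ai : alpha n i = 0%N by rewrite lognE (negbTE pn) !andbF.
  by rewrite [in leRHS](big_ltn iJ) ai add0n big_nat_recr//= ai expr0 mulr1.
pose f n := if (\sum_(i.+1 <= j < J) alpha n j)%N == 0%N
  then \prod_(0 <= j < i.+1) v j ^+ alpha n j else 0.
have f0 n : 0 <= f n.
  by rewrite /f; case: ifP => // _; apply: prodr_ge0 => j _; rewrite exprn_ge0.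
apply: le_trans (_ : \sum_(1 <= n < N.+1 | (nth_prime i %| n)%N) q * f (n %/ nth_prime i)%N <= _);
  last first.
  rewrite -mulr_sumr ler_wpM2l// /A [leRHS]big_mkcond.
  by apply: sum_dvdn_le => //; rewrite prime_gt0// nth_prime_prime.
rewrite big_mkcond [leRHS]big_mkcond big_nat_cond [leRHS]big_nat_cond/=.
apply: ler_sum => n /andP[/andP[n0 _] _].
have [/dvdnP[n' nE]|pn] := boolP (nth_prime i %| n)%N; rewrite ?andbF ?andbT//.
have n'0 : (0 < n')%N by move: n0; rewrite nE muln_gt0 => /andP[].
rewrite nE mulnK ?prime_gt0 ?nth_prime_prime// /f.
have -> : (\sum_(i.+1 <= j < J) alpha (n' * nth_prime i) j =
           \sum_(i.+1 <= j < J) alpha n' j)%N.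
  rewrite !big_nat; apply: eq_bigr => j /andP[ij _].
  by rewrite alphaM// gtn_eqF// addn0.
case: ifP => _; last by rewrite mulr0.
by rewrite prod_alphaM// ler_wpM2r ?vq// prodr_ge0// => j _; rewrite exprn_ge0.
Qed.

Lemma sum_multi (theta q : R) : theta < 1 -> \sum_(k <= j < J) v j <= theta ->
  0 <= q < 1 -> (forall j, (j < k)%N -> v j <= q) ->
  \sum_(1 <= n < N.+1) multi n <= (1 - q)^-1 ^+ k / (1 - theta).
Proof.
move=> th1 vth q01 vq; apply: le_trans (sum_multi_tail th1 vth) _.
by rewrite ler_pM2r ?invr_gt0 ?subr_gt0// sum_smooth.
Qed.

End Multinomial.

Section LocalBound.
Variable R : realType.
Local Notation C := R[i].
Local Notation E := (expR 1 : R).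
Implicit Types (a : nat -> C) (x d r : nat -> R) (n j k J N : nat).
Local Notation alpha n j := (logn (nth_prime j) n).

(** On the variables from the [k]-th on, these radii maximize the monomial of [n]
    among those of sum [1 / 2]. *)
Definition radii k J (rho : R) n j : R :=
  if (j < k)%N then rho else (alpha n j)%:R / (2 * (tdeg k J n)%:R).

Definition weights k (q : R) x j : R := if (j < k)%N then q else 2 * E * x j.

Lemma alpha_le_tdeg k J n j : (k <= j < J)%N -> (alpha n j <= tdeg k J n)%N.
Proof.
by move=> jJ; rewrite /tdeg (bigD1_seq j) ?mem_index_iota ?iota_uniq//= leq_addr.
Qed.

Lemma radii_tail k J rho n j : (n <= J)%N -> (k <= j)%N -> 0 <= radii k J rho n j <= 1 / 2.
Proof.
move=> nJ kj; rewrite /radii ltnNge kj /= divr_ge0//=.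
have [Jj|jJ] := leqP J j.
  by rewrite logn_nth_prime_small ?mul0r//; exact: leq_trans nJ Jj.
have := alpha_le_tdeg n (introT andP (conj kj jJ)).
have [->|t0] := posnP (tdeg k J n); first by rewrite leqn0 => /eqP->; rewrite mul0r.
move=> le; rewrite ler_pdivrMr ?mulr_gt0 ?ltr0n//.
by rewrite mulrA div1r mulVf// mul1r ler_nat.
Qed.

Lemma radii01 k J rho n j : (n <= J)%N -> 0 <= rho < 1 -> 0 <= radii k J rho n j < 1.
Proof.
move=> nJ rho01; have [jk|kj] := ltnP j k; first by rewrite /radii jk.
have /andP[-> /le_lt_trans->//] := radii_tail rho nJ kj; lra.
Qed.

Lemma sum_radii_tail k J rho n : \sum_(k <= j < J) radii k J rho n j <= 1 / 2.
Proof.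
rewrite big_nat (eq_bigr (fun j => (alpha n j)%:R / (2 * (tdeg k J n)%:R))); last first.
  by move=> j /andP[kj _]; rewrite /radii ltnNge kj.
rewrite -big_nat -mulr_suml -natr_sum -/(tdeg k J n).
have [->|t0] := posnP (tdeg k J n); first by rewrite mul0r divr_ge0.
by rewrite invfM mulrCA divff ?mulr1 ?div1r// pnatr_eq0 -lt0n.
Qed.

Lemma harnack_le_expR (r : R) : 0 <= r <= 1 / 2 -> harnack r <= expR (4 * r).
Proof.
move=> /andP[r0 r1]; apply: le_trans (expR_ge1Dx _).
by rewrite /harnack ler_pdivrMr; nra.
Qed.

(** Because the sum of the later radii is bounded, the product of their Harnack
    constants is bounded independently of the number of variables. *)
Lemma prod_harnack_radii k J rho n : (n <= J)%N -> (k <= J)%N -> 0 <= rho < 1 ->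
  \prod_(j < n) harnack (radii k J rho n j) <= harnack rho ^+ k * expR 2.
Proof.
move=> nJ kJ rho01; pose h j := harnack (radii k J rho n j).
have h1 j : 1 <= h j by apply: harnack_ge1; exact: radii01.
have h0 j : 0 <= h j by exact: le_trans (h1 j).
rewrite -(big_mkord xpredT h).
apply: le_trans (_ : \prod_(0 <= j < J) h j <= _).
  rewrite [leRHS](@big_cat_nat _ _ _ n)//= ler_peMr ?prodr_ge0//.
  by elim/big_ind : _ => // [y z y1 z1]; rewrite mulr_ege1.
rewrite (@big_cat_nat _ _ _ k)//=.
have -> : \prod_(0 <= j < k) h j = harnack rho ^+ k.
  rewrite big_nat (eq_bigr (fun=> harnack rho)) => [|j /andP[_ jk]].
    by rewrite -big_nat prodr_const_nat subn0.
  by rewrite /h /radii jk.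
rewrite ler_wpM2l ?exprn_ge0//; first by rewrite (le_trans ler01)// harnack_ge1.
apply: le_trans (_ : expR (4 * \sum_(k <= j < J) radii k J rho n j) <= _).
  rewrite mulr_sumr (big_morph expR (@expRD R) (@expR0 R)) !big_nat.
  apply: ler_prod => j /andP[kj _]; rewrite h0 /h harnack_le_expR//.
  exact: radii_tail.
by rewrite ler_expR; have := sum_radii_tail k J rho n; lra.
Qed.

(** The largest value of the later part of the monomial of [n] is the product of the
    powers [(alpha_j / 2 t) ^ alpha_j], where [t] is the sum of the exponents. By
    Stirling's formula it is, up to the factor [(2 e) ^ t], at least the inverse of a
    multinomial coefficient; the factor [2 e] in [weights] compensates for it. *)
Lemma monom_le_multi k J rho q x n : (0 < n)%N -> (n <= J)%N -> (k <= J)%N ->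
  0 <= rho -> 0 <= q -> (forall j, 0 <= x j) -> (forall j, (j < k)%N -> x j <= q * rho) ->
  monom n x <= multi k J (weights k q x) n * monom n (radii k J rho n).
Proof.
move=> n0 nJ kJ rho0 q0 x0 xq.
rewrite (monom_widen x nJ) (monom_widen (radii k J rho n) nJ) /multi -mulrA.
rewrite -!(big_mkord xpredT (fun j => _ j ^+ alpha n j)) -big_split/=.
rewrite (@big_cat_nat _ _ _ k)//= [in leRHS](@big_cat_nat _ _ _ k 0 J)//= mulrCA.
apply: ler_pM; try by apply: prodr_ge0 => j _; rewrite exprn_ge0.
  rewrite !big_nat; apply: ler_prod => j /andP[_ jk].
  rewrite exprn_ge0//= /weights /radii jk -exprMn lerXn2r ?nnegrE ?mulr_ge0//.
  exact: xq.
set t := tdeg k J n; pose A := \prod_(k <= j < J) x j ^+ alpha n j.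
have A0 : 0 <= A by apply: prodr_ge0 => j _; rewrite exprn_ge0.
have -> : \prod_(k <= j < J) (weights k q x j ^+ alpha n j * radii k J rho n j ^+ alpha n j) =
    A * ((E / t%:R) ^+ t * \prod_(k <= j < J) (alpha n j)%:R ^+ alpha n j).
  have -> : (E / t%:R) ^+ t = \prod_(k <= j < J) (E / t%:R) ^+ alpha n j.
    by rewrite [in LHS]/t /tdeg (big_morph _ (@exprD _ _) (expr0 _)).
  rewrite /A -!big_split/= !big_nat; apply: eq_bigr => j /andP[kj _].
  rewrite /weights /radii ltnNge kj /= -!exprMn; congr (_ ^+ _).
  by rewrite -/t invfM; move: (t%:R^-1 : R) => u; field.
rewrite mulrCA ler_peMr// /weight -/t.
set F := \prod_(_ <= _ < _) _; set P := \prod_(_ <= _ < _) _.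
have F0 : 0 < F by apply: prodr_gt0 => j _; rewrite ltr0n fact_gt0.
have FP : F <= P.
  by rewrite /F /P; apply: ler_prod => j _; rewrite ler0n fact_le_expn.
have [t0|t0] := posnP t.
  by rewrite t0 fact0 expr0 !mul1r mulrC ler_pdivlMr// mul1r.
have t0' : 0 < t%:R :> R by rewrite ltr0n.
have -> : t`!%:R / F * ((E / t%:R) ^+ t * P) = (E ^+ t * t`!%:R / t%:R ^+ t) * (P / F).
  by rewrite expr_div_n; field; rewrite expf_neq0 ?gt_eqF.
rewrite mulr_ege1// ler_pdivlMr ?exprn_gt0// mul1r//.
exact: expn_le_fact.
Qed.

Lemma small_tail x S : (forall j, 0 <= x j) -> (forall J, \sum_(0 <= j < J) x j <= S) ->
  forall e : R, 0 < e -> exists k, forall J, \sum_(k <= j < J) x j <= e.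
Proof.
move=> x0 xS e e0; pose A := [set \sum_(0 <= j < J) x j | J in [set: nat]].
have hA : has_sup A.
  by split; [exists 0, 0%N => //; rewrite big_geq|exists S => _ [J _ <-]].
have [_ [k _ <-] kP] := sup_adherent e0 hA.
exists k => J; have [Jk|kJ] := leqP J k; first by rewrite big_geq// ltW.
have : \sum_(0 <= j < J) x j <= sup A by apply: ub_le_sup; [case: hA|exists J].
by rewrite (@big_cat_nat _ _ _ k)//=; [lra|exact: ltnW].
Qed.

Lemma finite_lt1 x k : (forall j, 0 <= x j < 1) ->
  exists2 tau : R, 0 <= tau < 1 & forall j, (j < k)%N -> x j <= tau.
Proof.
move=> x01; elim: k => [|k [tau /andP[t0 t1] tP]]; first by exists 0; rewrite ?lexx ?ltr01.
have /andP[xk0 xk1] := x01 k.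
exists (Num.max tau (x k)); first by rewrite le_max t0 gt_max t1.
move=> j; rewrite ltnS leq_eqVlt le_max => /orP[/eqP->|/tP->//].
by rewrite lexx orbT.
Qed.

(** Near a point of the domain, the power series converges absolutely and
    uniformly. The Cauchy estimates are applied on a polydisc depending on the
    monomial: radii close to [1] for finitely many variables, and for the others the
    radii of sum [1 / 2] that are optimal for this monomial. What remains is a
    geometric series in the first variables times a multinomial series in the
    others, whose sum is small. *)
Lemma local_bound x0 S : (forall j, 0 <= x0 j < 1) ->
  (forall J, \sum_(0 <= j < J) x0 j <= S) ->
  exists e K1 K2 : R, [/\ 0 < e, 0 <= K1, 0 <= K2 &
    forall K a, 0 <= K -> coef_bound K a ->
    forall x d, (forall j, 0 <= x j <= x0 j + d j) -> (forall j, 0 <= d j) ->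
      (forall J, \sum_(0 <= j < J) d j <= e) ->
    forall N, \sum_(n < N) normc (a n) * monom n.+1 x <= K1 * (expR (K2 * K) - 1)].
Proof.
move=> x01 x0S.
have E0 : 0 < E by exact: expR_gt0.
have eps0 : 0 < (8 * E)^-1 by rewrite invr_gt0 mulr_gt0.
have x00 j : 0 <= x0 j by case/andP: (x01 j).
have [k kP] := small_tail x00 x0S eps0.
have [tau /andP[t0 t1] tauP] := finite_lt1 k x01.
pose rho := (1 + tau) / 2; pose q := (1 + 3 * tau) / 4 / rho.
have rho0 : 0 < rho by rewrite /rho; lra.
have rho1 : rho < 1 by rewrite /rho; lra.
have q0 : 0 <= q by rewrite /q divr_ge0 ?ltW//; lra.
have q1 : q < 1 by rewrite /q ltr_pdivrMr// mul1r /rho; lra.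
pose K2 := harnack rho ^+ k * expR 2.
have K20 : 0 <= K2.
  by rewrite mulr_ge0 ?expR_ge0// exprn_ge0// (le_trans ler01)// harnack_ge1// ltW.
pose K1 := (1 - q)^-1 ^+ k / (1 - 1 / 2).
have K10 : 0 <= K1.
  by rewrite /K1 divr_ge0// ?exprn_ge0// ?invr_ge0 ?subr_ge0 ?ltW//; lra.
exists (Num.min ((1 - tau) / 4) (8 * E)^-1), K1, K2; split=> //.
  by rewrite lt_min eps0 andbT; lra.
move=> K a K0 aK x d xd d0 dS N; pose J := (N + k)%N.
have kJ : (k <= J)%N by rewrite leq_addl.
have NJ : (N <= J)%N by rewrite leq_addr.
have x0' j : 0 <= x j by case/andP: (xd j).
have dj j : d j <= (1 - tau) / 4.
  have := dS j.+1; rewrite big_nat_recr//= le_min => /andP[+ _]; apply: le_trans.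
  by rewrite lerDr sumr_ge0.
have dtail : \sum_(k <= j < J) d j <= (8 * E)^-1.
  have := dS J; rewrite (@big_cat_nat _ _ _ k)//= le_min => /andP[_]; apply: le_trans.
  by rewrite lerDr sumr_ge0.
pose v := weights k q x.
have v0 j : 0 <= v j by rewrite /v /weights; case: ifP => // _; rewrite !mulr_ge0 ?(ltW E0).
have vk j : (j < k)%N -> v j <= q by rewrite /v /weights => ->.
have vtail : \sum_(k <= j < J) v j <= 1 / 2.
  apply: le_trans (_ : 2 * E * \sum_(k <= j < J) (x0 j + d j) <= _).
    rewrite mulr_sumr !big_nat; apply: ler_sum => j /andP[kj _].
    rewrite /v /weights ltnNge kj /= ler_wpM2l ?mulr_ge0 ?(ltW E0)//.
    by case/andP: (xd j).
  rewrite big_split/=; have := lerD (kP J) dtail => h.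
  apply: le_trans (ler_wpM2l _ h) _; first by rewrite mulr_ge0// ltW.
  by rewrite le_eqVlt; apply/orP; left; apply/eqP; field; rewrite gt_eqF.
have xq j : (j < k)%N -> x j <= q * rho.
  move=> jk; rewrite /q divfK ?gt_eqF//; have /andP[_ h] := xd j.
  have := tauP j jk; have := dj j; lra.
rewrite -(big_mkord xpredT (fun n => normc (a n) * monom n.+1 x)).
rewrite -(big_add1 _ _ 0 N.+1 xpredT (fun n => normc (a n.-1) * monom n x))/=.
apply: le_trans (_ : \sum_(1 <= n < N.+1) (expR (K2 * K) - 1) * multi k J v n <= _).
  rewrite !big_nat; apply: ler_sum => n /andP[n0 nN].
  have nJ : (n <= J)%N by exact: leq_trans NJ.
  apply: le_trans (ler_wpM2l (normc_ge0 _)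
    (monom_le_multi n0 nJ kJ (ltW rho0) q0 x0' xq)) _.
  rewrite mulrCA mulrC ler_wpM2r ?multi_ge0//.
  have r01 j : 0 <= radii k J rho n j < 1 by apply: radii01 => //; rewrite (ltW rho0).
  have := aK n.-1 _ r01; rewrite prednK// => /le_trans; apply.
  rewrite lerD2r ler_expR ler_wpM2r//.
  by apply: prod_harnack_radii => //; rewrite (ltW rho0).
rewrite -mulr_sumr mulrC ler_wpM2r//.
  by rewrite subr_ge0 -expR0 ler_expR mulr_ge0.
by apply: sum_multi => //; [lra|rewrite q0].
Qed.

End LocalBound.

(** * The sum of the power series is holomorphic *)

Section AbsoluteConvergence.
Variable R : realType.
Local Notation C := R[i].
Implicit Types (u : nat -> C) (A : nat -> R).

Lemma absolute_cvg u A S : (forall n, normc (u n) <= A n) ->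
  (forall J, \sum_(0 <= j < J) A j <= S) -> cvgn (series u).
Proof.
move=> uA AS; have A0 n : 0 <= A n := le_trans (normc_ge0 _) (uA n).
apply: cauchy_normc => e e0.
have e2 : 0 < e / 2 by rewrite divr_gt0.
have [k kP] := small_tail A0 AS e2.
have near n : (k <= n)%N -> normc (series u n - series u k) <= e / 2.
  move=> kn; rewrite /series /= (@big_cat_nat _ _ _ k)//= addrAC subrr add0r.
  apply: le_trans (ler_normc_sum _ _ _) _; apply: le_trans (kP n).
  exact: ler_sum.
exists k => n n' /near h /near h'.
rewrite -(subrK (series u k) (series u n)) -addrA.
apply: le_trans (ler_normcD _ _) _; rewrite (normc_distC (series u k)).
by have := lerD h h'; lra.
Qed.

Lemma absolute_tail u A S k e : (forall n, normc (u n) <= A n) ->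
  (forall J, \sum_(0 <= j < J) A j <= S) -> (forall J, \sum_(k <= j < J) A j <= e) ->
  normc (limn (series u) - series u k) <= e.
Proof.
move=> uA AS Ae; apply/ler_addgt0Pr => d d0.
have [N NP] := cvgn_normcP (absolute_cvg uA AS) d0.
set n := maxn N k; have := NP n (leq_maxl _ _) => h.
rewrite -(subrK (series u n) (limn _)) -addrA addrC.
apply: le_trans (ler_normcD _ _) _; rewrite (normc_distC (limn _)); apply: lerD => //.
rewrite /series /= (@big_cat_nat _ _ _ k 0 n)//= ?leq_maxr// addrAC subrr add0r.
apply: le_trans (ler_normc_sum _ _ _) _; apply: le_trans (Ae n).
exact: ler_sum.
Qed.

Lemma limn_le u S : (forall J, \sum_(0 <= j < J) normc (u j) <= S) ->
  normc (limn (series u)) <= S.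
Proof.
move=> uS; have := absolute_tail (fun n => lexx (normc (u n))) uS uS.
by rewrite /series /= big_geq// subr0.
Qed.

Lemma limn_seriesB u u' : cvgn (series u) -> cvgn (series u') ->
  limn (series (fun n => u n - u' n)) = limn (series u) - limn (series u').
Proof.
move=> cu cu'; apply: limn_normc => e e0; have e2 : 0 < e / 2 by rewrite divr_gt0.
have [N NP] := cvgn_normcP cu e2; have [N' N'P] := cvgn_normcP cu' e2.
exists (maxn N N') => n; rewrite geq_max => /andP[/NP h /N'P h'].
have -> : series (fun n => u n - u' n) n = series u n - series u' n.
  by rewrite /series /= sumrB.
rewrite (_ : _ - _ - _ = (series u n - limn (series u)) - (series u' n - limn (series u')));
  last by ring.
apply: le_trans (ler_normcD _ _) _; rewrite normc_opp.
by have := lerD h h'; lra.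
Qed.

End AbsoluteConvergence.

(** The weighted [l^1] norm of the coefficients is submultiplicative, and controls
    the second order Taylor remainder. *)
Section PolynomialNorm.
Variable R : realType.
Local Notation C := R[i].
Implicit Types (p q : {poly C}) (eta : R) (h : C).

Definition absp p : {poly R} := \poly_(i < size p) normc p`_i.

Lemma coef_absp p i : (absp p)`_i = normc p`_i.
Proof.
rewrite coef_poly; case: ltnP => // pi; first by rewrite nth_default// normc0.
Qed.

Lemma horner_le (A B : {poly R}) eta : 0 <= eta -> (forall i, A`_i <= B`_i) ->
  A.[eta] <= B.[eta].
Proof.
move=> eta0 AB; rewrite (@horner_coef_wide _ (maxn (size A) (size B)))// ?leq_maxl//.
rewrite (@horner_coef_wide _ (maxn (size A) (size B)) B)// ?leq_maxr//.
by apply: ler_sum => i _; rewrite ler_wpM2r// exprn_ge0.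
Qed.

Lemma absp_ge0 p eta : 0 <= eta -> 0 <= (absp p).[eta].
Proof.
move=> eta0; rewrite -(horner0 eta); apply: horner_le => // i.
by rewrite coef0 coef_absp normc_ge0.
Qed.

Lemma abspM p q eta : 0 <= eta -> (absp (p * q)).[eta] <= (absp p).[eta] * (absp q).[eta].
Proof.
move=> eta0; rewrite -hornerM; apply: horner_le => // i.
rewrite coef_absp !coefM; apply: le_trans (ler_normc_sum _ _ _) _.
by apply: ler_sum => j _; rewrite normcM !coef_absp.
Qed.

Lemma absp1 eta : (absp 1).[eta] = 1.
Proof.
have -> : absp 1 = 1.
  by apply/polyP => i; rewrite coef_absp !coef1; case: (_ == _); rewrite ?normc1 ?normc0.
by rewrite hornerC.
Qed.

Lemma absp_linear (y x : C) eta :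
  (absp (y%:P + x%:P * 'X)).[eta] = normc y + eta * normc x.
Proof.
have -> : absp (y%:P + x%:P * 'X) = (normc y)%:P + (normc x)%:P * 'X.
  apply/polyP => i; rewrite coef_absp !coefD !coefC !coefMX !coefC.
  case: i => [|[|i]] /=; rewrite ?addr0// ?add0r//.
  by rewrite expr0n addr0 sqrtr0.
by rewrite hornerD hornerM !hornerC hornerX mulrC.
Qed.

Lemma absp_monom n (f : nat -> {poly C}) eta : 0 <= eta ->
  (absp (monom n f)).[eta] <= monom n (fun j => (absp (f j)).[eta]).
Proof.
move=> eta0; rewrite /monom.
elim: (index_enum _) => [|j l ih]; first by rewrite !big_nil absp1.
rewrite !big_cons; apply: le_trans (abspM _ _ eta0) _.
apply: ler_pM; rewrite ?absp_ge0// {ih}.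
elim: (logn _ _) => [|k ih]; first by rewrite !expr0 absp1.
rewrite !exprS; apply: le_trans (abspM _ _ eta0) _.
by apply: ler_pM; rewrite ?absp_ge0.
Qed.

Lemma coef1_le p eta : 0 < eta -> normc p`_1 <= (absp p).[eta] / eta.
Proof.
move=> eta0; rewrite ler_pdivlMr//.
have -> : normc p`_1 * eta = ((normc p`_1)%:P * 'X).[eta].
  by rewrite hornerM hornerC hornerX.
apply: horner_le; first exact: ltW.
move=> i; rewrite coefMX coefC coef_absp; case: i => [|[|i]] //=; exact: normc_ge0.
Qed.

Lemma taylor_remainder p eta h : 0 < eta -> normc h <= eta ->
  normc (p.[h] - p`_0 - h * p`_1) <= (normc h / eta) ^+ 2 * (absp p).[eta].
Proof.
move=> eta0 heta; set N := (size p).+2.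
have pN : (size p <= N)%N by rewrite /N -addn2 leq_addr.
rewrite (horner_coef_wide _ pN) !big_ord_recl /= expr0 mulr1 expr1.
rewrite (_ : _ - _ - _ = \sum_(i < size p) p`_(bump 0 (bump 0 i)) * h ^+ bump 0 (bump 0 i));
  last by ring.
apply: le_trans (ler_normc_sum _ _ _) _.
have aN : (size (absp p) <= N)%N by apply: leq_trans pN; exact: size_poly.
rewrite (horner_coef_wide _ aN) !big_ord_recl /= !coef_absp !mulrDr mulr_sumr.
rewrite !addrA; apply: le_trans (_ : \sum_(i < size p) (normc h / eta) ^+ 2 *
    ((absp p)`_(bump 0 (bump 0 i)) * eta ^+ bump 0 (bump 0 i)) <= _); last first.
  by rewrite lerDr addr_ge0// !mulr_ge0 ?invr_ge0 ?normc_ge0 ?exprn_ge0 ?(ltW eta0).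
apply: ler_sum => i _; rewrite coef_absp normcM normcX [leRHS]mulrCA ler_wpM2l ?normc_ge0//.
rewrite (_ : bump 0 (bump 0 i) = (2 + i)%N)//.
have -> : (normc h / eta) ^+ 2 * eta ^+ (2 + i) = normc h ^+ 2 * eta ^+ i.
  by rewrite exprD; field; rewrite gt_eqF.
by rewrite exprD ler_wpM2l ?sqr_ge0// lerXn2r ?nnegrE ?normc_ge0 ?(ltW eta0).
Qed.

End PolynomialNorm.

Section Holomorphic.
Variable R : realType.
Local Notation C := R[i].
Implicit Types (a : nat -> C) (x y zeta : nat -> C).

Lemma norm1_partial x : ell1 x -> exists2 S : R, norm1 x = S%:E &
  forall J, \sum_(0 <= j < J) normc (x j) <= S.
Proof.
rewrite /ell1 /= => xoo.
have x0 n : (0 <= (normc (x n))%:E)%E by rewrite lee_fin normc_ge0.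
have nx0 : (0 <= norm1 x)%E by exact: nneseries_ge0.
exists (fine (norm1 x)); first by rewrite fineK// ge0_fin_numE.
move=> J; rewrite -lee_fin fineK ?ge0_fin_numE// -sumEFin.
exact: nneseries_lim_ge.
Qed.

Lemma norm1_lt x (e : R) : (norm1 x < e%:E)%E ->
  forall J, \sum_(0 <= j < J) normc (x j) <= e.
Proof.
move=> xe J; have [|S SE SP] := @norm1_partial x; first exact: lt_trans xe (ltry _).
apply: le_trans (SP J) _; apply: ltW.
by rewrite -lte_fin -SE.
Qed.

Lemma normc_bohr_term a x n :
  normc (bohr_term a x n) = normc (a n) * monom n.+1 (fun j => normc (x j)).
Proof. by rewrite normcM bohr_monomialE normc_monom. Qed.

Lemma Dinf1_bound x0 : Dinf1 x0 -> exists e K1 K2 : R, [/\ 0 < e, 0 <= K1, 0 <= K2 &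
  forall K a, 0 <= K -> coef_bound K a ->
  forall (x d : nat -> R), (forall j, 0 <= x j <= normc (x0 j) + d j) -> (forall j, 0 <= d j) ->
    (forall J, \sum_(0 <= j < J) d j <= e) ->
  forall N, \sum_(n < N) normc (a n) * monom n.+1 x <= K1 * (expR (K2 * K) - 1)].
Proof.
move=> [x0l x01]; have [S _ SP] := norm1_partial x0l.
by apply: local_bound SP => j; rewrite normc_ge0 x01.
Qed.

Lemma Dinf1_bound_at zeta : Dinf1 zeta -> exists K1 K2 : R, [/\ 0 <= K1, 0 <= K2 &
  forall K a, 0 <= K -> coef_bound K a ->
  forall N, \sum_(0 <= n < N) normc (a n) * monom n.+1 (fun j => normc (zeta j)) <=
    K1 * (expR (K2 * K) - 1)].
Proof.
move=> /Dinf1_bound[e [K1 [K2 [e0 K10 K20 H]]]]; exists K1, K2; split=> //.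
move=> K a K0 aK N; rewrite big_mkord; apply: (H K a K0 aK _ (fun=> 0)) => //.
  by move=> j; rewrite normc_ge0 addr0 lexx.
by move=> J; rewrite big1 ?ltW.
Qed.

Lemma bohr_cvg K a zeta : 0 <= K -> coef_bound K a -> Dinf1 zeta ->
  cvgn (series (bohr_term a zeta)).
Proof.
move=> K0 aK /Dinf1_bound_at[K1 [K2 [_ _ /(_ K a K0 aK) H]]].
by apply: (@absolute_cvg _ _ _ (K1 * (expR (K2 * K) - 1)) _ H) => n; rewrite normc_bohr_term.
Qed.

Lemma bohr_locally_bounded K a : 0 <= K -> coef_bound K a -> locally_bounded (bohr a).
Proof.
move=> K0 aK x0 /Dinf1_bound[e [K1 [K2 [e0 K10 K20 H]]]].
exists e => //; exists (K1 * (expR (K2 * K) - 1)) => x xD xe.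
apply: limn_le => J; under eq_bigr do rewrite normc_bohr_term; rewrite big_mkord.
apply: (H K a K0 aK _ (fun j => normc (x j - x0 j))) => [j|j|].
- by rewrite normc_ge0 /= addrC -{1}(subrK (x0 j) (x j)) ler_normcD.
- exact: normc_ge0.
- exact: norm1_lt.
Qed.

(** On a line through [y] each term is a polynomial, whose coefficients are dominated
    by the expansion of the same monomial in [|y| + eta |x|]. This point is close to
    [|y|], so that the bound of [Dinf1_bound] makes the second order remainders
    summable, and the derivative is the sum of the first order coefficients. *)
Lemma bohr_derivable K a x0 x z : 0 <= K -> coef_bound K a -> ell1 x ->
  Dinf1 (fun n => x0 n + z * x n) ->
  derivable (fun z : C => bohr a (fun n => x0 n + z * x n)) z 1.
Proof.
move=> K0 aK xl; set y := (fun n => _) => yD.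
have [e [K1 [K2 [e0 K10 K20 H]]]] := Dinf1_bound yD.
have [S _ SP] := norm1_partial xl.
have S0 : 0 <= S by have := SP 0%N; rewrite big_geq.
pose eta := e / (S + 1).
have eta0 : 0 < eta by rewrite divr_gt0// ltr_wpDl.
pose M := K1 * (expR (K2 * K) - 1).
pose Q n := normc (a n) * monom n.+1 (fun j => normc (y j) + eta * normc (x j)).
have QM J : \sum_(0 <= n < J) Q n <= M.
  rewrite big_mkord; apply: (H K a K0 aK _ (fun j => eta * normc (x j))) => [j|j|J'].
  - by rewrite lexx addr_ge0 ?normc_ge0// mulr_ge0 ?normc_ge0// ltW.
  - by rewrite mulr_ge0 ?normc_ge0// ltW.
  - rewrite -mulr_sumr; apply: le_trans (ler_wpM2l (ltW eta0) (SP J')) _.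
    by rewrite /eta mulrAC ler_pdivrMr ?ltr_wpDl// ler_wpM2l ?(ltW e0)// lerDl.
pose G n : {poly C} := monom n.+1 (fun j => (y j)%:P + (x j)%:P * 'X).
have GE n h : (G n).[h] = monom n.+1 (fun j => y j + h * x j).
  rewrite /G (@monom_morph _ _ (fun p : {poly C} => p.[h])); last by rewrite hornerC.
    by apply: eq_monom => j _; rewrite hornerD hornerM !hornerC hornerX mulrC.
  by move=> p q; rewrite hornerM.
have GQ n : normc (a n) * (absp (G n)).[eta] <= Q n.
  rewrite ler_wpM2l ?normc_ge0//; apply: le_trans (absp_monom _ _ (ltW eta0)) _.
  by rewrite le_eqVlt (eq_monom (fun j _ => absp_linear (y j) (x j) eta)) eqxx.
have shift h n : bohr_term a (fun j => x0 j + (h + z) * x j) n = a n * (G n).[h].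
  by rewrite /bohr_term bohr_monomialE GE; congr (_ * _); apply: eq_monom => j _; rewrite /y; ring.
have rem h : normc h <= eta ->
    forall n, normc (a n * (G n).[h] - a n * (G n)`_0 - h * (a n * (G n)`_1)) <=
      (normc h / eta) ^+ 2 * Q n.
  move=> heta n.
  rewrite (_ : _ - _ - _ = a n * ((G n).[h] - (G n)`_0 - h * (G n)`_1)); last by ring.
  rewrite normcM; apply: le_trans (ler_wpM2l (normc_ge0 _) (taylor_remainder _ eta0 heta)) _.
  by rewrite mulrCA ler_wpM2l ?sqr_ge0.
have Q0 n : 0 <= Q n.
  apply: le_trans (GQ n); rewrite mulr_ge0 ?normc_ge0// absp_ge0// ltW//.
have cG h : normc h <= eta -> cvgn (series (fun n => a n * (G n).[h])).
  move=> heta; apply: (absolute_cvg _ QM) => n; rewrite normcM; apply: le_trans (GQ n).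
  rewrite ler_wpM2l ?normc_ge0// horner_coef; apply: le_trans (ler_normc_sum _ _ _) _.
  rewrite (@horner_coef_wide _ (size (G n)) (absp (G n)))//; last exact: size_poly.
  apply: ler_sum => i _; rewrite normcM normcX coef_absp ler_wpM2l ?normc_ge0//.
  by rewrite lerXn2r ?nnegrE ?normc_ge0// ltW.
pose D := limn (series (fun n => a n * (G n)`_1)).
have cD : cvgn (series (fun n => a n * (G n)`_1)).
  apply: (@absolute_cvg _ _ (fun n => Q n / eta) (M / eta)) => [n|J].
    rewrite normcM; apply: le_trans (ler_wpM2l (normc_ge0 _) (coef1_le _ eta0)) _.
    by rewrite mulrA ler_wpM2r// invr_ge0 ltW.
  by rewrite -mulr_suml ler_wpM2r ?invr_ge0 ?(ltW eta0).
have h00 : normc (0 : C) <= eta by rewrite normc0 ltW.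
have key h : normc h <= eta ->
    normc (bohr a (fun j => x0 j + (h + z) * x j) - bohr a y - h * D) <=
    (normc h / eta) ^+ 2 * M.
  move=> heta.
  have -> : bohr a (fun j => x0 j + (h + z) * x j) = limn (series (fun n => a n * (G n).[h])).
    by rewrite /bohr; congr (limn (series _)); apply/funext => n; exact: shift.
  have -> : bohr a y = limn (series (fun n => a n * (G n).[0])).
    rewrite /bohr; congr (limn (series _)); apply/funext => n.
    by rewrite -shift; congr bohr_term; apply/funext => j; rewrite add0r.
  have -> : h * D = limn (series (fun n => h * (a n * (G n)`_1))).
    apply/esym/limn_normc => d d0.
    have d1 : 0 < d / (normc h + 1) by rewrite divr_gt0// ltr_wpDl ?normc_ge0.
    have [N NP] := cvgn_normcP cD d1; exists N => n /NP.
    rewrite /series /= -mulr_sumr -mulrBr normcM -/D => hd.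
    apply: le_trans (ler_wpM2l (normc_ge0 _) hd) _.
    rewrite mulrCA ler_piMr ?(ltW d0)// ler_pdivrMr ?ltr_wpDl ?normc_ge0// mul1r lerDl//.
  have chD : cvgn (series (fun n => h * (a n * (G n)`_1))).
    apply: (@absolute_cvg _ _ (fun n => normc h * (Q n / eta)) (normc h * (M / eta))) => [n|J].
      rewrite !normcM ler_wpM2l ?normc_ge0//.
      apply: le_trans (ler_wpM2l (normc_ge0 _) (coef1_le _ eta0)) _.
      by rewrite mulrA ler_wpM2r// invr_ge0 ltW.
    by rewrite -mulr_sumr ler_wpM2l ?normc_ge0// -mulr_suml ler_wpM2r ?invr_ge0 ?(ltW eta0).
  have cB : cvgn (series (fun n => a n * (G n).[h] - a n * (G n).[0])).
    apply: (@absolute_cvg _ _ (fun n => normc (a n * (G n).[h] - a n * (G n).[0]))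
      ((normc h / eta) ^+ 2 * M + normc h * (M / eta))) => // J.
    apply: le_trans (_ : \sum_(0 <= n < J) ((normc h / eta) ^+ 2 * Q n +
        normc h * (Q n / eta)) <= _).
      apply: ler_sum => n _; rewrite horner_coef0.
      rewrite -[X in normc X](subrK (h * (a n * (G n)`_1))).
      apply: le_trans (ler_normcD _ _) _; apply: lerD; first exact: rem.
      rewrite !normcM ler_wpM2l ?normc_ge0//.
      apply: le_trans (ler_wpM2l (normc_ge0 _) (coef1_le _ eta0)) _.
      by rewrite mulrA ler_wpM2r// invr_ge0 ltW.
    rewrite big_split/= -!mulr_sumr; apply: lerD; rewrite ler_wpM2l ?sqr_ge0 ?normc_ge0//.
    by rewrite -mulr_suml ler_wpM2r ?invr_ge0 ?(ltW eta0).
  rewrite -(limn_seriesB (cG h heta) (cG 0 h00)) -(limn_seriesB cB chD).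
  apply: limn_le => J.
  apply: le_trans (_ : \sum_(0 <= n < J) (normc h / eta) ^+ 2 * Q n <= _).
    by apply: ler_sum => n _; rewrite horner_coef0; exact: rem.
  by rewrite -mulr_sumr ler_wpM2l ?sqr_ge0.
have M0 : 0 <= M by have := QM 0%N; rewrite big_geq.
rewrite /derivable; apply/cvg_ex; exists (D : C^o).
apply/(@cvgrPdist_le C C^o) => d d0.
have dE : d = (complex.Re d)%:C by rewrite RRe_real// gtr0_real.
have {}d0 : 0 < complex.Re d by move: d0; rewrite {1}dE ltcR.
pose delta := Num.min eta (complex.Re d * eta ^+ 2 / (M + 1)).
have delta0 : 0 < delta.
  rewrite lt_min eta0 /= divr_gt0 ?ltr_wpDl//.
  by apply: mulr_gt0 => //; exact: exprn_gt0.
exists delta%:C; first by rewrite /= ltcR.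
move=> h /=; rewrite sub0r normrN /= ltcR lt_min => /andP[heta hd] h0.
rewrite dE lecR.
have hn0 : 0 < normc h by rewrite lt_def normc_eq0P h0 normc_ge0.
have := key h (ltW heta).
rewrite /GRing.scale /= mulr1 -/y.
rewrite (_ : D - _ = - (h^-1 * (bohr a (fun j => x0 j + (h + z) * x j) - bohr a y - h * D)));
  last by field.
rewrite normc_opp normcM normcV => hk.
apply: le_trans (ler_wpM2l _ hk) _; first by rewrite invr_ge0 ltW.
have -> : (normc h)^-1 * ((normc h / eta) ^+ 2 * M) = normc h * M / eta ^+ 2.
  by field; rewrite !gt_eqF.
rewrite ler_pdivrMr ?exprn_gt0//.
apply: le_trans (_ : complex.Re d * eta ^+ 2 / (M + 1) * M <= _).
  by rewrite ler_wpM2r// ltW.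
rewrite mulrAC ler_pdivrMr ?ltr_wpDl// ler_wpM2l ?lerDl//.
by rewrite mulr_ge0 ?exprn_ge0// ltW.
Qed.

Lemma bohr_holomorphic K a : 0 <= K -> coef_bound K a -> holomorphic (bohr a).
Proof.
move=> K0 aK; split; first exact: bohr_locally_bounded aK.
by move=> x0 x _ xl z yD; exact: (bohr_derivable K0 aK).
Qed.

End Holomorphic.

(** * Equality of the norms *)

Section Dilations.
Variable R : realType.
Local Notation C := R[i].
Implicit Types (a b : nat -> C) (r K e sigma : R) (w : Tinf R).

Definition dpoint r w : nat -> C := fun j => (r ^+ j.+1)%:C * tpoint w j.

Definition dcoef r a : nat -> C := fun n => a n * monom n.+1 (fun j => (r ^+ j.+1)%:C).

Lemma dilateE a r w : dilate (bohr a) r w = bohr a (dpoint r w).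
Proof. by []. Qed.

Lemma normc_dpoint r w j : 0 < r -> normc (dpoint r w j) = r ^+ j.+1.
Proof.
move=> r0; rewrite normcM normc_tpoint mulr1 normc_real ger0_norm//.
by rewrite exprn_ge0// ltW.
Qed.

Lemma Dinf1_dpoint r w : 0 < r < 1 -> Dinf1 (dpoint r w).
Proof.
move=> /andP[r0 r1]; split; last first.
  by move=> n; rewrite normc_dpoint// exprn_ilt1// ltW.
have sumE J : \sum_(0 <= j < J) normc (dpoint r w j) = (r - r ^+ J.+1) / (1 - r).
  apply: (canRL (mulfK _)); first by rewrite subr_eq0 gt_eqF.
  elim: J => [|J ih]; first by rewrite big_geq// mul0r expr1 subrr.
  by rewrite big_nat_recr//= mulrDl ih normc_dpoint// !exprS; ring.
rewrite /ell1 /= /norm1.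
apply: le_lt_trans (_ : (r / (1 - r))%:E < _)%E; last exact: ltry.
apply: lime_le; first by apply: is_cvg_nneseries => n _ _; rewrite lee_fin normc_ge0.
near=> J; rewrite sumEFin lee_fin sumE.
by rewrite ler_wpM2r ?invr_ge0 ?subr_ge0 ?(ltW r1)// lerBlDr lerDl exprn_ge0// ltW.
Unshelve. all: by end_near. Qed.

Lemma psum_dcoef a r N w : psum a N (dpoint r w) = psum (dcoef r a) N (tpoint w).
Proof. exact: psum_mul. Qed.

Lemma dpoint_bound r : 0 < r < 1 -> exists K1 K2 : R, [/\ 0 <= K1, 0 <= K2 &
  forall K a, 0 <= K -> coef_bound K a ->
  forall N, \sum_(0 <= n < N) normc (a n) * monom n.+1 (fun j => r ^+ j.+1) <=
    K1 * (expR (K2 * K) - 1)].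
Proof.
move=> r01; have w : Tinf R := point.
have [K1 [K2 [K10 K20 H]]] := Dinf1_bound_at (Dinf1_dpoint w r01).
exists K1, K2; split=> // K a K0 aK N; apply: le_trans (H K a K0 aK N).
apply: ler_sum => n _; rewrite ler_wpM2l ?normc_ge0// le_eqVlt (eq_monom (x := fun j => r ^+ j.+1)
  (y := fun j => normc (dpoint r w j))) ?eqxx// => j _.
by rewrite normc_dpoint//; case/andP: r01.
Qed.

Lemma normc_bohr_term_dpoint a r w n : 0 < r ->
  normc (bohr_term a (dpoint r w) n) = normc (a n) * monom n.+1 (fun j => r ^+ j.+1).
Proof.
move=> r0; rewrite normc_bohr_term; congr (_ * _).
by apply: eq_monom => j _; exact: normc_dpoint.
Qed.

Lemma dilate_tail K a r : 0 <= K -> coef_bound K a -> 0 < r < 1 ->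
  forall e, 0 < e -> exists N, [/\
    forall J, \sum_(N <= n < J) normc (a n) * monom n.+1 (fun j => r ^+ j.+1) <= e &
    forall w, normc (dilate (bohr a) r w - psum (dcoef r a) N (tpoint w)) <= e].
Proof.
move=> K0 aK r01 e e0; have /andP[r0 r1] := r01.
have [K1 [K2 [_ _ /(_ K a K0 aK) H]]] := dpoint_bound r01.
have A0 n : 0 <= normc (a n) * monom n.+1 (fun j => r ^+ j.+1).
  by rewrite mulr_ge0 ?normc_ge0// monom_ge0// => j; rewrite exprn_ge0// ltW.
have [N NP] := small_tail A0 H e0; exists N; split=> // w.
rewrite -psum_dcoef -psumE dilateE.
by apply: (absolute_tail (S := K1 * (expR (K2 * K) - 1)) (A := fun n =>
  normc (a n) * monom n.+1 (fun j => r ^+ j.+1))) => // n; rewrite normc_bohr_term_dpoint.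
Qed.

Lemma normc_dilate_le K a r S w : 0 <= K -> coef_bound K a -> 0 < r < 1 ->
  (forall N, \sum_(0 <= n < N) normc (a n) * monom n.+1 (fun j => r ^+ j.+1) <= S) ->
  normc (dilate (bohr a) r w) <= S.
Proof.
move=> K0 aK /andP[r0 r1] aS; apply: limn_le => J; apply: le_trans (aS J).
by apply: ler_sum => n _; rewrite (normc_bohr_term_dpoint a w n r0).
Qed.

Variable m : probability (Tinf_borel R) R.
Hypothesis hm : is_haar m.

Definition dmean a r : R :=
  mean m setT (fun w : Tinf_borel R => ln (1 + normc (dilate (bohr a) r w))).

Lemma cmeasurable_dilate K a r : 0 <= K -> coef_bound K a -> 0 < r < 1 ->
  cmeasurable (fun w : Tinf_borel R => dilate (bohr a) r w).
Proof.
move=> K0 aK r01.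
apply: (@cmeasurable_cvg _ (Tinf_borel R) R
  (fun N w => psum (dcoef r a) N (tpoint w))).
  by move=> N; exact: cmeasurable_psum.
move=> w e /(cvgn_normcP (bohr_cvg K0 aK (Dinf1_dpoint w r01)))[N NP].
exists N => n /NP; rewrite psumE psum_dcoef; apply.
Qed.

Lemma tame_dilate K a r : 0 <= K -> coef_bound K a -> 0 < r < 1 ->
  tame (fun w : Tinf_borel R => ln (1 + normc (dilate (bohr a) r w))).
Proof.
move=> K0 aK r01; have [K1 [K2 [_ _ /(_ K a K0 aK) H]]] := dpoint_bound r01.
apply: tame_ln1D_normc; first exact: cmeasurable_dilate aK r01.
by move=> w; exact: (normc_dilate_le _ K0 aK r01 H).
Qed.

Lemma integral_dmean K a r : 0 <= K -> coef_bound K a -> 0 < r < 1 ->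
  (\int[m]_w (ln (1 + normc (dilate (bohr a) r w)))%:E)%E = (dmean a r)%:E.
Proof.
move=> K0 aK r01; rewrite /dmean /mean -[X in (fine X)^-1]/(m setT) probability_setT /= invr1 mul1r /Rintegral fineK//.
apply: integrable_fin_num => //.
exact: (tame_integrable measurableT (m_setT_lty m) (tame_dilate K0 aK r01)).
Qed.

(** The bound vanishes at [K = 0], so that coefficientwise smallness makes the mean
    small at every fixed radius. *)
Lemma dmean_small r : 0 < r < 1 -> exists K1 K2 : R, [/\ 0 <= K1, 0 <= K2 &
  forall K a, 0 <= K -> coef_bound K a -> dmean a r <= K1 * (expR (K2 * K) - 1)].
Proof.
move=> r01; have [K1 [K2 [K10 K20 H]]] := dpoint_bound r01.
exists K1, K2; split=> // K a K0 aK.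
rewrite -[leRHS](mean_cst measurableT (m_setT_gt0 m) (m_setT_lty m)).
apply: mean_le => //; [exact: m_setT_gt0|exact: m_setT_lty|exact: tame_dilate aK r01|
  exact: tame_cst|].
move=> w; apply: le_trans (ln1D_le (normc_ge0 _)) _.
exact: (normc_dilate_le _ K0 aK r01 (H K a K0 aK)).
Qed.

Lemma dmean_lmean K a r : 0 <= K -> coef_bound K a -> 0 < r < 1 ->
  forall e, 0 < e -> exists N0, forall N, (N0 <= N)%N ->
    `|dmean a r - lmean m (dcoef r a) N| <= e.
Proof.
move=> K0 aK r01 e e0; have e2 : 0 < e / 2 by rewrite divr_gt0.
have [N0 [N0A N0P]] := dilate_tail K0 aK r01 e2; exists N0 => N NN.
apply: mean_dist => //; [exact: m_setT_gt0|exact: m_setT_lty|exact: tame_dilate aK r01|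
  exact: tame_ln1D_psum|].
move=> w.
have d : normc (dilate (bohr a) r w - psum (dcoef r a) N (tpoint w)) <= e.
  rewrite -(subrK (psum (dcoef r a) N0 (tpoint w)) (dilate _ _ _)) -addrA.
  apply: le_trans (ler_normcD _ _) _; rewrite [leRHS](_ : _ = e / 2 + e / 2); last by field.
  apply: lerD; first exact: N0P.
  rewrite -!psum_dcoef -!psumE normc_distC /series /= (@big_cat_nat _ _ _ N0 0 N)//=.
  rewrite addrAC subrr add0r; apply: le_trans (ler_normc_sum _ _ _) _.
  apply: le_trans (N0A N); apply: ler_sum => n _.
  by rewrite normc_bohr_term_dpoint//; case/andP: r01.
rewrite ler_distl lerBlDr; apply/andP; split.
  by apply: ln1D_normc_le; rewrite normc_distC.
exact: ln1D_normc_le.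
Qed.

Lemma npow_radius sigma j : npow (nth_prime j) sigma%:C =
  (expR (- (sigma * ln (nth_prime j)%:R)))%:C.
Proof. by rewrite npowE mul0r oppr0 cis0 mulr1. Qed.

Definition pradius sigma j : R := expR (- (sigma * ln (nth_prime j)%:R)).

Lemma monom_pradius sigma n : (monom n.+1 (pradius sigma))%:C = npow n.+1 sigma%:C.
Proof.
rewrite monom_real -(monom_npow sigma%:C (ltn0Sn n)); apply: eq_monom => j _.
by rewrite npow_radius.
Qed.

(** Radii need only be compared on finitely many variables if the other variables are
    set to [0]. *)
Lemma lmean_radii_le a (x y : nat -> R) N M : (forall j, 0 <= x j) -> (forall j, 0 < y j) ->
  (forall j, (j < N)%N -> x j <= y j) ->
  lmean m (fun n => a n * monom n.+1 (fun j => (trunc N x j)%:C)) M <=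
  lmean m (fun n => a n * monom n.+1 (fun j => (y j)%:C)) M.
Proof.
move=> x0 y0 xy; pose t j : C := (trunc N x j / y j)%:C.
have -> : (fun n => a n * monom n.+1 (fun j => (trunc N x j)%:C)) =
    (fun n => a n * monom n.+1 (fun j => (y j)%:C) * monom n.+1 t).
  apply/funext => n; rewrite -mulrA -monom_mul; congr (_ * _).
  apply: eq_monom => j _; rewrite -rmorphM /= mulrC divfK// gt_eqF//.
apply: lmean_contract => // j; rewrite normc_real /trunc; case: ifP => [jN|_].
  by rewrite ger0_norm ?divr_ge0 ?(ltW (y0 j))// ler_pdivrMr// mul1r xy.
by rewrite mul0r normr0.
Qed.

(** The norm of the Dirichlet series dominates: up to small tails, only finitely
    many variables matter, for which the radii [r, r ^ 2, ...] are less than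
    [p ^ (- sigma)] when [sigma] is small. *)
Lemma dmean_le_norm0 a K r : (abscissa_u a <= 0)%E -> norm0 a = K%:E -> 0 < r < 1 ->
  dmean a r <= K.
Proof.
move=> a0 aK r01; have /andP[r0 r1] := r01.
have K0 : 0 <= K by rewrite -lee_fin -aK; exact: (norm0_ge0 hm a0).
have bK : coef_bound K a by apply: (norm0_coef_bound hm) => //; rewrite aK.
apply/ler_addgt0Pr => e e0; have e4 : 0 < e / 4 by rewrite divr_gt0.
have [N [NA NP]] := dilate_tail K0 bK r01 e4.
pose P : R := (nth_prime N)%:R.
have P1 : 1 < P by rewrite ltr1n prime_gt1// nth_prime_prime.
pose sigma := - ln r / ln P.
have lnP : 0 < ln P by rewrite ln_gt0.
have s0 : 0 < sigma by rewrite divr_gt0// oppr_gt0 ln_lt0// r0.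
have rj j : (j < N)%N -> r ^+ j.+1 <= pradius sigma j.
  move=> jN; apply: le_trans (_ : r <= _).
    by rewrite exprS ler_piMr ?(ltW r0)// exprn_ile1// ltW.
  have lp : ln (nth_prime j)%:R <= ln P :> R.
    rewrite ler_ln ?posrE ?ltr0n ?prime_gt0 ?nth_prime_prime// ler_nat ltnW//.
    by rewrite nth_prime_mono.
  rewrite /pradius -[leLHS]lnK ?posrE// ler_expR.
  have -> : - (sigma * ln (nth_prime j)%:R) = ln r * (ln (nth_prime j)%:R / ln P).
    by rewrite /sigma; field; rewrite gt_eqF.
  rewrite -[leLHS]mulr1 ler_wnM2l//; first by rewrite ltW// ln_lt0// r0.
  by rewrite ler_pdivrMr// mul1r.
have [L LE Llim] := cvg_mean_log hm a0 s0.
have LK : L <= K by rewrite -lee_fin -LE -aK; apply: ereal_sup_ubound; exists sigma.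
have [N' N'P] := Llim _ e4.
pose M := maxn N N'; have NM : (N <= M)%N by rewrite leq_maxl.
pose b n := a n * monom n.+1 (fun j => (trunc N (fun j => r ^+ j.+1) j)%:C).
have trE : (fun j => (trunc N (fun j => r ^+ j.+1) j)%:C) = trunc N (fun j => (r ^+ j.+1)%:C) :> (nat -> C).
  by apply/funext => j; rewrite /trunc; case: ifP => //; rewrite rmorph0.
have h1 : dmean a r <= lmean m b M + e / 2.
  rewrite /lmean -(meanDc measurableT (m_setT_gt0 m) (m_setT_lty m)); last exact: tame_ln1D_psum.
  apply: mean_le => //; [exact: m_setT_gt0|exact: m_setT_lty|exact: tame_dilate bK r01| |].
    by apply: tameD; [exact: tame_ln1D_psum|exact: tame_cst].
  move=> w; apply: ln1D_normc_le.
  rewrite -(subrK (psum (dcoef r a) N (tpoint w)) (dilate _ _ _)) -addrA.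
  apply: le_trans (ler_normcD _ _) _; rewrite [leRHS](_ : _ = e / 4 + e / 4); last by field.
  apply: lerD; first exact: NP.
  have -> : psum (dcoef r a) N (tpoint w) = psum b N (tpoint w).
    by apply: eq_bigr => n _; rewrite /b trE monom_trunc.
  rewrite normc_distC -psum_tail//.
  apply: le_trans (ler_normc_sum _ _ _) _; apply: le_trans (NA M).
  rewrite -(big_mkord xpredT (fun n => normc ((if (n < N)%N then 0 else b n) * monom n.+1 (tpoint w)))).
  rewrite (@big_cat_nat _ _ _ N)//= [X in X + _]big_nat big1 ?add0r; last first.
    by move=> n /andP[_ ->]; rewrite mul0r normc0.
  rewrite !big_nat; apply: ler_sum => n /andP[Nn _]; rewrite ltnNge Nn /=.
  rewrite normcM monom_unit ?mulr1 /b; last by move=> j; exact: normc_tpoint.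
  rewrite normcM ler_wpM2l ?normc_ge0// normc_monom; apply: le_monom => j.
  rewrite normc_ge0 normc_real andTb /trunc; case: ifP => _; rewrite ?normr0 ?exprn_ge0 ?(ltW r0)//.
  by rewrite ger0_norm ?exprn_ge0 ?(ltW r0).
have h2 : lmean m b M <= lmean m (dshift sigma a) M.
  have -> : dshift sigma a = (fun n => a n * monom n.+1 (fun j => (pradius sigma j)%:C)).
    by apply/funext => n; rewrite /dshift -monom_pradius monom_real.
  apply: lmean_radii_le => // j; [rewrite exprn_ge0// ltW//|exact: expR_gt0].
have := N'P M (leq_maxr _ _); rewrite ler_norml => /andP[_ h3].
by move: h1 h2 h3 LK; move: (dmean a r) (lmean m b M) (lmean m _ M) => x y z; lra.
Qed.

(** Conversely, a partial sum of the shifted series that is long enough involves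
    finitely many variables, on which the radii [r, r ^ 2, ...] exceed
    [p ^ (- sigma)] when [r] is close to [1]; setting the other variables to [0]
    keeps the later terms negligible, by [lmean_contract]. *)
Lemma norm0_le_dmean a K B : (abscissa_u a <= 0)%E -> norm0 a = K%:E ->
  (forall r, 0 < r < 1 -> dmean a r <= B) -> K <= B.
Proof.
move=> a0 aK aB; rewrite -lee_fin -aK; apply: ge_ereal_sup => _ [sigma /= s0 <-].
have K0 : 0 <= K by rewrite -lee_fin -aK; exact: (norm0_ge0 hm a0).
have bK : coef_bound K a by apply: (norm0_coef_bound hm) => //; rewrite aK.
have [L -> Llim] := cvg_mean_log hm a0 s0; rewrite lee_fin.
apply/ler_addgt0Pr => e e0; have e3 : 0 < e / 3 by rewrite divr_gt0.
have [N1 N1P] := Llim _ e3; have [N2 N2P] := lmean_tail hm a0 s0 e3.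
pose N := maxn N1 N2; pose b := dshift sigma a.
pose r := expR (- (sigma * ln 2) / N.+1%:R).
have ln2 : 0 < ln 2 :> R by rewrite ln_gt0// ltr1n.
have N0 : 0 < N.+1%:R :> R by rewrite ltr0n.
have r01 : 0 < r < 1.
  rewrite expR_gt0 /= -expR0 ltr_expR mulNr oppr_lt0 divr_gt0// mulr_gt0//.
have rj j : (j < N)%N -> pradius sigma j <= r ^+ j.+1.
  move=> jN; rewrite /r -expRM_natl ler_expR.
  have -> : j.+1%:R * (- (sigma * ln 2) / N.+1%:R) = - (sigma * ln 2 * j.+1%:R / N.+1%:R) :> R.
    by field; rewrite gt_eqF.
  rewrite lerN2; apply: le_trans (_ : sigma * ln 2 <= _).
    rewrite ler_pdivrMr// ler_wpM2l ?mulr_ge0 ?(ltW s0) ?(ltW ln2)//.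
    by rewrite ler_nat ltnW// ltnS.
  rewrite ler_pM2l// ler_ln ?posrE ?ltr0n ?prime_gt0 ?nth_prime_prime//.
  by rewrite ler_nat prime_gt1// nth_prime_prime.
have [N3 N3P] := dmean_lmean K0 bK r01 e3.
pose M := maxn N N3; have NM : (N <= M)%N by rewrite leq_maxl.
pose t : nat -> C := trunc N (fun=> 1).
pose bt n := b n * monom n.+1 t.
have t1 j : normc (t j) <= 1 by rewrite /t /trunc; case: ifP; rewrite ?normc1 ?normc0.
have h1 : lmean m b N = lmean m bt N.
  rewrite /lmean; congr mean; apply/funext => w; congr (ln (1 + normc _)).
  apply: eq_bigr => n _; congr (_ * _); rewrite /bt /t monom_trunc// /monom.
  by rewrite big1 ?mulr1// => j _; exact: expr1n.
have h2 : lmean m bt N <= lmean m bt M + e / 3.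
  have := lmean_tail_dist m bt NM.
  have le : lmean m (fun n => if (n < N)%N then 0 else bt n) M <= e / 3.
    apply: le_trans (N2P N M (leq_maxr _ _) NM).
    rewrite (_ : (fun n => _) = (fun n => (if (n < N)%N then 0 else b n) * monom n.+1 t)).
      exact: lmean_contract.
    by apply/funext => n; case: ifP => // _; rewrite mul0r.
  by move=> /le_trans/(_ le); rewrite ler_norml => /andP[_]; rewrite lerBlDl.
have h3 : lmean m bt M <= lmean m (dcoef r a) M.
  have -> : bt = (fun n => a n * monom n.+1 (fun j => (trunc N (pradius sigma) j)%:C)).
    apply/funext => n; rewrite /bt /b /dshift -monom_pradius monom_real -mulrA -monom_mul.
    congr (_ * _); apply: eq_monom => j _.
    by rewrite /t /trunc; case: ifP => _; rewrite ?mulr1// mulr0 rmorph0.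
  apply: (@lmean_radii_le a (pradius sigma) (fun j => r ^+ j.+1)) => // j.
    exact: ltW (expR_gt0 _).
  by rewrite exprn_gt0// expR_gt0.
have := N1P N (leq_maxl _ _); have := N3P M (leq_maxr _ _); have := aB r r01.
move: h1 h2 h3; rewrite -/b.
move: (dmean a r) (lmean m _ _) (lmean m _ _) (lmean m _ _) (lmean m _ _) => x y z u v.
rewrite !ler_norml; lra.
Qed.

Lemma logp_le (x : R) : 0 <= x -> logp x <= ln (1 + x).
Proof.
move=> x0; rewrite /logp ge_max ln1D_ge0//=.
move: x0; rewrite le_eqVlt => /orP[/eqP<-|x0]; first by rewrite ln0// addr0 ln1.
by rewrite ler_ln ?posrE ?lerDr// ltr_pwDl// ltW.
Qed.

Lemma nevanlinna_bohr K a B : 0 <= K -> coef_bound K a ->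
  (forall r, 0 < r < 1 -> dmean a r <= B) -> nevanlinna m (bohr a).
Proof.
move=> K0 aK aB; split; first exact: bohr_holomorphic aK.
apply: le_lt_trans (ltry B); apply: ge_ereal_sup => _ [r /= r01 <-].
apply: le_trans (_ : \int[m]_w (ln (1 + normc (dilate (bohr a) r w)))%:E <= _)%E; last first.
  by rewrite (integral_dmean K0 aK r01) lee_fin aB.
have mf := cmeasurable_dilate K0 aK r01.
apply: ge0_le_integral => //.
- by move=> w _; rewrite lee_fin /logp le_max lexx.
- apply/measurable_EFinP; apply: (@measurable_maxr _ (Tinf_borel R) R setT (cst 0)
    (fun w : Tinf_borel R => ln (normc (dilate (bohr a) r w)))); first exact: measurable_cst.
  apply: (@measurableT_comp _ _ _ _ _ _ (@ln R)); first exact: measurable_ln.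
  exact: measurable_normc.
- by apply/measurable_EFinP; exact: measurable_ln1D_normc.
- by move=> w _; rewrite lee_fin logp_le// normc_ge0.
Qed.

Lemma nevanlinna_norm0E K a : 0 <= K -> coef_bound K a ->
  nevanlinna_norm0 m (bohr a) = ereal_sup [set (dmean a r)%:E | r in [set r : R | 0 < r < 1]].
Proof.
move=> K0 aK; rewrite /nevanlinna_norm0; congr ereal_sup; apply/seteqP; split=> _ [r /= r01 <-];
  by exists r => //; rewrite (integral_dmean K0 aK r01).
Qed.

Lemma norm_equality a K : (abscissa_u a <= 0)%E -> norm0 a = K%:E ->
  nevanlinna_norm0 m (bohr a) = norm0 a.
Proof.
move=> a0 aK.
have K0 : 0 <= K by rewrite -lee_fin -aK; exact: (norm0_ge0 hm a0).
have bK : coef_bound K a by apply: (norm0_coef_bound hm) => //; rewrite aK.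
rewrite (nevanlinna_norm0E K0 bK) aK; apply/eqP; rewrite eq_le; apply/andP; split.
  by apply: ge_ereal_sup => _ [r /= r01 <-]; rewrite lee_fin; exact: dmean_le_norm0 r01.
set s := ereal_sup _.
have s_ub r : 0 < r < 1 -> ((dmean a r)%:E <= s)%E.
  by move=> r01; apply: ereal_sup_ubound; exists r.
case: s s_ub => [B s_ub|_|s_ub]; [|exact: leey|].
- rewrite lee_fin; apply: (norm0_le_dmean a0 aK) => r r01.
  by rewrite -lee_fin s_ub.
- by have := s_ub (1 / 2); rewrite leNgt ltNyr => H; suff : false by []; apply: H; lra.
Qed.

End Dilations.

(** * The completion *)

Section Completion.
Variable R : realType.
Local Notation C := R[i].
Implicit Types (a b c : nat -> C) (r K e sigma : R).

Lemma unif_cvg_rightI a sigma (f : C -> C) :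
  (forall e, 0 < e -> exists N, forall n, (N <= n)%N -> forall s : C, sigma < complex.Re s ->
    normc (series (dterm a s) n - f s) <= e) ->
  {uniform [set s : C | sigma < complex.Re s],
    (fun n s => series (dterm a s) n) @ \oo --> f}.
Proof.
move=> H P /uniform_nbhs[E [entE EP]].
have [e e0 eE] : exists2 e : R, 0 < e &
    [set xy : C^o * C^o | ball xy.1 e%:C xy.2] `<=` E.
  have := entE; rewrite -(@entourage_ballE C C^o) => -[e /= e0 eE].
  have eR : e = (complex.Re e)%:C by rewrite RRe_real// gtr0_real.
  exists (complex.Re e); first by move: e0; rewrite {1}eR ltcR.
  by rewrite -eR.
have e2 : 0 < e / 2 by rewrite divr_gt0.
have [N NP] := H _ e2; exists N => // n /= Nn; apply: EP => s /= ss; apply: eE.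
rewrite /= /ball /= ltcR normc_distC; apply: le_lt_trans (NP n Nn s ss) _.
by rewrite ltr_pdivrMr// ltr_pMr// ltr1n.
Qed.

Lemma abscissaB a b : (abscissa_u a <= 0)%E -> (abscissa_u b <= 0)%E ->
  (abscissa_u (fun n => (a n - b n)%R) <= 0)%E.
Proof.
move=> a0 b0; apply/lee_addgt0Pr => e e0; rewrite add0e.
apply: ereal_inf_lbound; exists e => //.
have ex (u : nat -> C) : (abscissa_u u <= 0)%E -> exists f : C -> C, forall d, 0 < d ->
    exists N, forall n, (N <= n)%N -> forall s : C, e < complex.Re s ->
      normc (series (dterm u s) n - f s) <= d.
  move=> u0; have : (abscissa_u u < e%:E)%E by apply: le_lt_trans u0 _; rewrite lte_fin.
  move=> /ereal_inf_lt[_ [s' [f fP] <-]]; rewrite lte_fin => se.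
  exists f => d /(unif_cvg_rightP fP)[N NP]; exists N => n /NP {}NP s es.
  by apply: NP; exact: lt_trans se es.
have [f fP] := ex _ a0; have [g gP] := ex _ b0.
exists (fun s => f s - g s); apply: unif_cvg_rightI => d d0.
have d2 : 0 < d / 2 by rewrite divr_gt0.
have [N NP] := fP _ d2; have [M MP] := gP _ d2.
exists (maxn N M) => n; rewrite geq_max => /andP[/NP {}NP /MP {}MP] s es.
have -> : series (dterm (fun n => a n - b n) s) n =
    series (dterm a s) n - series (dterm b s) n.
  by rewrite /series /= -sumrB; apply: eq_bigr => k _; rewrite /dterm mulrBl.
rewrite (_ : _ - _ - _ = (series (dterm a s) n - f s) - (series (dterm b s) n - g s));
  last by ring.
apply: le_trans (ler_normcD _ _) _; rewrite normc_opp.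
by have := lerD (NP s es) (MP s es); lra.
Qed.

Lemma coef_boundB K K' a b : 0 <= K -> 0 <= K' -> coef_bound K a -> coef_bound K' b ->
  coef_bound (K + K') (fun n => a n - b n).
Proof.
move=> K0 K'0 aK bK n r r01; set H := \prod_(j < _) _.
have H0 : 0 <= H by apply: le_trans ler01 _; exact: prod_harnack_ge1.
have M0 : 0 <= monom n.+1 r by apply: monom_ge0 => j; case/andP: (r01 j).
apply: le_trans (_ : (normc (a n) + normc (b n)) * monom n.+1 r <= _).
  by rewrite ler_wpM2r// -(normc_opp (b n)) ler_normcD.
rewrite mulrDl; apply: le_trans (lerD (aK n r r01) (bK n r r01)) _; rewrite -/H.
rewrite mulrDr expRD.
have : 1 <= expR (H * K) by rewrite -expR0 ler_expR mulr_ge0.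
have : 1 <= expR (H * K') by rewrite -expR0 ler_expR mulr_ge0.
nra.
Qed.

Lemma eq_of_coef_bound0 a b : coef_bound 0 (fun n => a n - b n) -> a = b.
Proof.
move=> ab; apply/funext => n; apply/eqP; rewrite -subr_eq0 -normc_eq0P.
have r01 (j : nat) : 0 <= (1 / 2 : R) < 1 by apply/andP; split; lra.
have := ab n _ r01; rewrite mulr0 expR0 subrr.
have M0 : 0 < monom n.+1 (fun=> 1 / 2 : R) by apply: monom_gt0 => j; rewrite divr_gt0.
by rewrite pmulr_lle0// => h; rewrite eq_le h normc_ge0.
Qed.

(** Coefficient bounds are closed under pointwise limits. This is how they pass to
    the completion, where no Dirichlet series is at hand. *)
Lemma coef_bound_closed K a : 0 <= K ->
  (forall n e, 0 < e -> exists b K', [/\ coef_bound K' b, K' <= K + e & normc (a n - b n) <= e]) ->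
  coef_bound K a.
Proof.
move=> K0 H n r r01; set P := \prod_(j < _) _.
have P1 : 1 <= P by exact: prod_harnack_ge1.
have P0 : 0 < P := lt_le_trans ltr01 P1.
set M := monom n.+1 r.
have M0 : 0 <= M by apply: monom_ge0 => j; case/andP: (r01 j).
set Y := expR (P * K); have Y0 : 0 < Y by exact: expR_gt0.
apply/ler_addgt0Pr => d d0.
have D0 : 0 < M + 2 * P * Y by rewrite ltr_wpDl// !mulr_gt0.
pose e := Num.min (1 / (2 * P)) (d / (M + 2 * P * Y)).
have e0 : 0 < e by rewrite lt_min !divr_gt0// mulr_gt0.
have [b [K' [bK KK ab]]] := H n e e0.
have := bK n r r01; rewrite -/P -/M => hb.
have Pe : P * e <= 1 / 2.
  apply: le_trans (_ : P * (1 / (2 * P)) <= _); last first.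
    by rewrite le_eqVlt; apply/orP; left; apply/eqP; field; rewrite gt_eqF.
  by rewrite ler_pM2l// ge_min lexx.
have de : (M + 2 * P * Y) * e <= d.
  apply: le_trans (_ : (M + 2 * P * Y) * (d / (M + 2 * P * Y)) <= _).
    by rewrite ler_pM2l// ge_min lexx orbT.
  by rewrite mulrCA divff ?mulr1// gt_eqF.
have exp_le : expR (P * K') <= Y * (1 + 2 * (P * e)).
  apply: le_trans (_ : expR (P * K) * expR (P * e) <= _).
    by rewrite -expRD ler_expR -mulrDr ler_pM2l.
  rewrite ler_pM2l//.
  have Pe0 : 0 <= P * e by rewrite mulr_ge0// ltW.
  have := expR_ge1Dx (- (P * e)); rewrite expRN => h.
  have X0 := expR_gt0 (P * e).
  have : (1 - P * e) * expR (P * e) <= 1.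
    by rewrite -ler_pdivlMr// div1r.
  move: h X0; set X := expR (P * e) => _ X0 h.
  have : (1 + 2 * (P * e)) * (1 - P * e) >= 1 by nra.
  move=> h2; have pe1 : 0 < 1 - P * e by lra.
  by rewrite -(ler_pM2r pe1) mulrC (le_trans h).
have : normc (a n) * M <= normc (b n) * M + e * M.
  rewrite -mulrDl ler_wpM2r// -{1}(subrK (b n) (a n)) addrC.
  by apply: le_trans (ler_normcD _ _) _; rewrite lerD2l.
move: exp_le de hb; nra.
Qed.

Variable m : probability (Tinf_borel R) R.
Hypothesis hm : is_haar m.

Definition admissible a : Prop := exists2 K, 0 <= K & coef_bound K a.

Lemma bohrB a b zeta : admissible a -> admissible b -> Dinf1 zeta ->
  bohr (fun n => a n - b n) zeta = bohr a zeta - bohr b zeta.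
Proof.
move=> [K K0 aK] [K' K'0 bK'] zD.
rewrite -(limn_seriesB (bohr_cvg K0 aK zD) (bohr_cvg K'0 bK' zD)).
by congr (limn (series _)); apply/funext => n; rewrite /bohr_term mulrBl.
Qed.

Lemma admissibleB a b : admissible a -> admissible b -> admissible (fun n => a n - b n).
Proof.
move=> [K K0 aK] [K' K'0 bK']; exists (K + K'); first exact: addr_ge0.
exact: coef_boundB.
Qed.

Lemma Nu_admissible a : Nu a -> admissible a.
Proof.
move=> aN; have [K aK] := Nu_norm0 hm aN; have a0 := Nu_abscissa aN; exists K.
  by rewrite -lee_fin -aK; exact: (norm0_ge0 hm a0).
by apply: (norm0_coef_bound hm) => //; rewrite aK.
Qed.

(** The distance of two power series on the torus of radii [r, r ^ 2, ...]. *)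
Definition ddist a b r : R := dmean m (fun n => a n - b n) r.

Lemma ddistE a b r : admissible a -> admissible b -> 0 < r < 1 ->
  ddist a b r = mean m setT (fun w : Tinf_borel R =>
    ln (1 + normc (dilate (bohr a) r w - dilate (bohr b) r w))).
Proof.
move=> aa ab r01; rewrite /ddist /dmean; congr mean; apply/funext => w.
by rewrite !dilateE bohrB//; exact: Dinf1_dpoint.
Qed.

Lemma tame_ddist a b r : admissible a -> admissible b -> 0 < r < 1 ->
  tame (fun w : Tinf_borel R =>
    ln (1 + normc (dilate (bohr a) r w - dilate (bohr b) r w))).
Proof.
move=> aa ab r01; have [K K0 abK] := admissibleB aa ab.
have := tame_dilate K0 abK r01; congr tame; apply/funext => w.
by rewrite !dilateE bohrB//; exact: Dinf1_dpoint.
Qed.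

Lemma ddist_sym a b r : admissible a -> admissible b -> 0 < r < 1 ->
  ddist a b r = ddist b a r.
Proof.
move=> aa ab r01; rewrite (ddistE aa ab r01) (ddistE ab aa r01).
by congr mean; apply/funext => w; rewrite normc_distC.
Qed.

Lemma ddist_triangle b a c r : admissible a -> admissible b -> admissible c -> 0 < r < 1 ->
  ddist a c r <= ddist a b r + ddist b c r.
Proof.
move=> aa ab ac r01; rewrite (ddistE aa ac r01) (ddistE aa ab r01) (ddistE ab ac r01).
rewrite -(meanD measurableT (m_setT_lty m)); try exact: tame_ddist.
apply: mean_le => //; [exact: m_setT_gt0|exact: m_setT_lty|exact: tame_ddist|
  by apply: tameD; exact: tame_ddist|].
move=> w; apply: le_trans (ln1D_normcD _ _).
by rewrite addrA subrK.
Qed.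

Variables (N : metricType R) (iota : @Nu R -> N).
Hypothesis iotaP : is_completion iota.

Lemma NuP (f : @Nu R) : Nu (val f).
Proof. by case: f => f /= /set_mem. Qed.

Lemma iota_near (x : N) e : 0 < e -> exists f : @Nu R, mdist (iota f) x < e.
Proof.
move=> e0; have := completion_dense iotaP.
move=> /(_ (ball x e)^°) [].
- by exists x; apply: nbhsx_ballx.
- exact: open_interior.
- move=> y [/interior_subset xy [f _ fy]]; exists f.
  by rewrite fy metric_sym; move: xy; rewrite ballEmdist.
Qed.

Lemma iota_dist (f g : @Nu R) :
  norm0 (fun n => val f n - val g n) = (mdist (iota f) (iota g))%:E.
Proof. by rewrite (completion_isometry iotaP). Qed.

Lemma abscissa_diff (f g : @Nu R) : (abscissa_u (fun n => (val f n - val g n)%R) <= 0)%E.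
Proof. by apply: abscissaB; apply: Nu_abscissa; exact: NuP. Qed.

Lemma iota_coef_bound (f g : @Nu R) :
  coef_bound (mdist (iota f) (iota g)) (fun n => val f n - val g n).
Proof.
by apply: (norm0_coef_bound hm); [exact: abscissa_diff|rewrite iota_dist].
Qed.

(** By [iota_coef_bound] the coefficients depend continuously on the series, so that
    those of a sequence tending to [x] converge. *)
Lemma completion_coef (x : N) : exists a, forall f : @Nu R,
  coef_bound (mdist (iota f) x) (fun n => val f n - a n).
Proof.
have pos k : 0 < (k.+1%:R)^-1 :> R by rewrite invr_gt0 ltr0n.
have small e : 0 < e -> exists k0 : nat, forall k, (k0 <= k)%N -> (k.+1%:R)^-1 <= e.
  move=> e0; exists (Num.truncn e^-1) => k kk.
  rewrite -[leRHS]invrK lef_pV2 ?posrE ?invr_gt0// ?ltr0n//.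
  apply: ltW; apply: lt_le_trans (truncnS_gt _) _; by rewrite ler_nat.
have /choice[f fx] : forall k : nat, exists f : @Nu R, mdist (iota f) x < (k.+1%:R)^-1.
  by move=> k; exact: iota_near.
have dist_f k l : mdist (iota (f k)) (iota (f l)) <= (k.+1%:R)^-1 + (l.+1%:R)^-1.
  apply: le_trans (metric_triangle _ x _) _; apply: lerD; first exact: ltW.
  by rewrite metric_sym ltW.
have cvg_coef n : cvgn (fun k => val (f k) n).
  apply: cauchy_normc => e e0.
  have r01 (j : nat) : 0 <= (1 / 2 : R) < 1 by apply/andP; split; lra.
  set H := \prod_(j < n.+1) harnack (1 / 2 : R).
  have H0 : 0 < H by apply: lt_le_trans ltr01 _; exact: (prod_harnack_ge1 n.+1 r01).
  set M := monom n.+1 (fun=> 1 / 2 : R).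
  have M0 : 0 < M by apply: monom_gt0 => j; rewrite divr_gt0.
  have l0 : 0 < ln (1 + e * M) by rewrite ln_gt0// ltrDl mulr_gt0.
  have d0 : 0 < ln (1 + e * M) / H / 2 by rewrite !divr_gt0.
  have [k0 k0P] := small _ d0; exists k0 => k l kk ll.
  have := @iota_coef_bound (f k) (f l) n (fun=> 1 / 2) r01; rewrite -/H -/M => h.
  rewrite -(ler_pM2r M0); apply: le_trans h _.
  rewrite lerBlDl -[leRHS]lnK ?posrE ?addr_gt0 ?mulr_gt0// ler_expR mulrC -ler_pdivlMr//.
  apply: le_trans (dist_f k l) _; have := lerD (k0P k kk) (k0P l ll).
  by rewrite -splitr.
pose a n := limn (fun k => val (f k) n).
exists a => g; apply: coef_bound_closed; first exact: mdist_ge0.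
move=> n e e0; have [k0 k0P] := small _ e0; have [k1 k1P] := cvgn_normcP (cvg_coef n) e0.
pose k := maxn k0 k1.
exists (fun n => val g n - val (f k) n), (mdist (iota g) (iota (f k))); split.
- exact: iota_coef_bound.
- apply: le_trans (metric_triangle _ x _) _; rewrite lerD2l metric_sym.
  by apply: le_trans (ltW (fx k)) _; apply: k0P; exact: leq_maxl.
- rewrite opprB addrC addrA subrK; apply: k1P; exact: leq_maxr.
Qed.

Lemma coef_admissible (x : N) a :
  (forall f : @Nu R, coef_bound (mdist (iota f) x) (fun n => val f n - a n)) -> admissible a.
Proof.
move=> aP; have [f _] := iota_near x ltr01.
have [K K0 fK] := Nu_admissible (NuP f).
exists (K + mdist (iota f) x); first by rewrite addr_ge0// mdist_ge0.
have := coef_boundB K0 (mdist_ge0 _ _) fK (aP f).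
by congr coef_bound; apply/funext => n; ring.
Qed.

Lemma ddist_iota (f g : @Nu R) r : 0 < r < 1 ->
  ddist (val f) (val g) r <= mdist (iota f) (iota g).
Proof.
by apply: (dmean_le_norm0 hm); [exact: abscissa_diff|exact: iota_dist].
Qed.

Lemma le_of_exp_small (x y K1 K2 : R) : 0 <= K1 -> 0 <= K2 ->
  (forall e, 0 < e -> x <= y + e + K1 * (expR (K2 * e) - 1)) -> x <= y.
Proof.
move=> K10 K20 H; apply/ler_addgt0Pr => d d0.
pose e := Num.min (1 / (2 * (K2 + 1))) (d / (1 + 2 * K1 * (K2 + 1))).
have K2' : 0 < K2 + 1 by rewrite ltr_wpDl.
have D0 : 0 < 1 + 2 * K1 * (K2 + 1) by rewrite ltr_pwDl// !mulr_ge0// ltW.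
have e0 : 0 < e by rewrite lt_min !divr_gt0// mulr_gt0.
apply: le_trans (H e e0) _; rewrite -addrA lerD2l.
have Ke : (K2 + 1) * e <= 1 / 2.
  apply: le_trans (_ : (K2 + 1) * (1 / (2 * (K2 + 1))) <= _).
    by rewrite ler_pM2l// ge_min lexx.
  by rewrite le_eqVlt; apply/orP; left; apply/eqP; field; rewrite gt_eqF.
have de : (1 + 2 * K1 * (K2 + 1)) * e <= d.
  apply: le_trans (_ : (1 + 2 * K1 * (K2 + 1)) * (d / (1 + 2 * K1 * (K2 + 1))) <= _).
    by rewrite ler_pM2l// ge_min lexx orbT.
  by rewrite mulrCA divff ?mulr1// gt_eqF.
have ex : expR (K2 * e) - 1 <= 2 * ((K2 + 1) * e).
  have h := @expR_ge1Dx R (- (K2 * e)); rewrite expRN in h.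
  have X0 := expR_gt0 (K2 * e); have KE : K2 * e <= (K2 + 1) * e by rewrite ler_pM2r// lerDl.
  have h1 : (1 - K2 * e) * expR (K2 * e) <= 1 by rewrite -ler_pdivlMr// div1r.
  have Ke0 : 0 <= K2 * e by rewrite mulr_ge0// ltW.
  have pe1 : 0 < 1 - K2 * e by lra.
  rewrite lerBlDl -(ler_pM2r pe1) mulrC (le_trans h1)//; nra.
have := ler_wpM2l K10 ex; nra.
Qed.

(** Let [g] approach [x] in the completion. The distance from [g] to [a] tends to [0]
    at the fixed radius [r], by [dmean_small]. *)
Lemma ddist_iota_coef (f : @Nu R) (x : N) a r :
  (forall f : @Nu R, coef_bound (mdist (iota f) x) (fun n => val f n - a n)) ->
  0 < r < 1 -> ddist (val f) a r <= mdist (iota f) x.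
Proof.
move=> aP r01; have [K1 [K2 [K10 K20 KP]]] := dmean_small m r01.
have aa := coef_admissible aP.
apply: (le_of_exp_small K10 K20) => e e0.
have [g gx] := iota_near x e0.
apply: le_trans (ddist_triangle (Nu_admissible (NuP f)) (Nu_admissible (NuP g)) aa r01) _.
apply: lerD.
  apply: le_trans (ddist_iota f g r01) _; apply: le_trans (metric_triangle _ x _) _.
  by rewrite lerD2l metric_sym ltW.
apply: le_trans (KP _ _ (mdist_ge0 _ _) (aP g)) _.
by rewrite ler_wpM2l// lerD2r ler_expR ler_wpM2l// ltW.
Qed.

(** Both inequalities follow by density from the case of Dirichlet series, since at
    each radius the distances to the representatives are controlled by
    [ddist_iota_coef]. *)
Lemma completion_norm (x y : N) a b :
  (forall f : @Nu R, coef_bound (mdist (iota f) x) (fun n => val f n - a n)) ->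
  (forall f : @Nu R, coef_bound (mdist (iota f) y) (fun n => val f n - b n)) ->
  nevanlinna_norm0 m (bohr a \- bohr b) = (mdist x y)%:E.
Proof.
move=> aP bP; have aa := coef_admissible aP; have ab := coef_admissible bP.
have [K K0 abK] := admissibleB aa ab.
have -> : nevanlinna_norm0 m (bohr a \- bohr b) =
    nevanlinna_norm0 m (bohr (fun n => a n - b n)).
  rewrite /nevanlinna_norm0; congr ereal_sup; apply/seteqP; split=> _ [r /= r01 <-];
  exists r => //; apply: eq_integral => w _; congr (ln (1 + normc _))%:E.
    by rewrite !dilateE bohrB//; exact: Dinf1_dpoint.
  by rewrite dilateE bohrB//; exact: Dinf1_dpoint.
rewrite (nevanlinna_norm0E m K0 abK); apply/eqP; rewrite eq_le; apply/andP; split.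
  apply: ge_ereal_sup => _ [r /= r01 <-]; rewrite lee_fin.
  apply/ler_addgt0Pr => e e0; have e4 : 0 < e / 4 by rewrite divr_gt0.
  have [f fx] := iota_near x e4; have [g gy] := iota_near y e4.
  have af := Nu_admissible (NuP f); have ag := Nu_admissible (NuP g).
  have h1 := ddist_triangle aa af ab r01.
  have h2 := ddist_triangle af ag ab r01.
  have h3 := ddist_iota_coef f aP r01; have h4 := ddist_iota_coef g bP r01.
  have h5 := ddist_iota f g r01; rewrite (ddist_sym aa af r01) in h1.
  have h6 := metric_triangle (iota f) x (iota g).
  have h7 := metric_triangle x y (iota g); rewrite (metric_sym y) in h7.
  move: h1 h2 h3 h4 h5 h6 h7 fx gy; rewrite /ddist.
  move: (dmean _ _ _) (dmean _ _ _) (dmean _ _ _) (dmean _ _ _) (dmean _ _ _) => d1 d2 d3 d4 d5.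
  move: (mdist _ _) (mdist _ _) (mdist _ _) (mdist _ _) (mdist _ _) => d6 d7 d8 d9 d10.
  lra.
set s := ereal_sup _.
have s_ub r : 0 < r < 1 -> ((ddist a b r)%:E <= s)%E.
  by move=> r01; apply: ereal_sup_ubound; exists r.
case: s s_ub => [B s_ub|_|s_ub]; [|exact: leey|]; last first.
  by have := s_ub (1 / 2); rewrite leNgt ltNyr => H; suff : false by []; apply: H; lra.
rewrite lee_fin; apply/ler_addgt0Pr => e e0; have e4 : 0 < e / 4 by rewrite divr_gt0.
have [f fx] := iota_near x e4; have [g gy] := iota_near y e4.
have af := Nu_admissible (NuP f); have ag := Nu_admissible (NuP g).
have : mdist (iota f) (iota g) <= B + e / 2.
  apply: (norm0_le_dmean hm (abscissa_diff f g) (iota_dist f g)) => r r01.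
  have h1 := ddist_triangle af aa ag r01.
  have h2 := ddist_triangle aa ab ag r01.
  have h3 := ddist_iota_coef f aP r01; have h4 := ddist_iota_coef g bP r01.
  rewrite (ddist_sym ab ag r01) in h2.
  have h5 : ddist a b r <= B by rewrite -lee_fin s_ub.
  move: h1 h2 h3 h4 h5 fx gy; rewrite /ddist.
  move: (dmean _ _ _) (dmean _ _ _) (dmean _ _ _) (dmean _ _ _) (dmean _ _ _) => d1 d2 d3 d4 d5.
  move: (mdist _ _) (mdist _ _) => d6 d7; lra.
have h6 := metric_triangle x (iota f) y; rewrite (metric_sym x (iota f)) in h6.
have h7 := metric_triangle (iota f) (iota g) y.
move: h6 h7 fx gy.
move: (mdist _ _) (mdist _ _) (mdist _ _) (mdist _ _) (mdist _ _) => d6 d7 d8 d9 d10; lra.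
Qed.

Lemma completion_nevanlinna (x : N) a :
  (forall f : @Nu R, coef_bound (mdist (iota f) x) (fun n => val f n - a n)) ->
  nevanlinna m (bohr a).
Proof.
move=> aP; have aa := coef_admissible aP; have [K K0 aK] := aa.
have [f _] := iota_near x ltr01.
have af := Nu_admissible (NuP f); have [L fL] := Nu_norm0 hm (NuP f).
apply: (nevanlinna_bohr (B := mdist (iota f) x + L) K0 aK) => r r01.
have a0 : admissible (fun=> 0).
  by exists 0 => // n t t01; rewrite normc0 mul0r mulr0 expR0 subrr.
have d0 c : ddist c (fun=> 0) r = dmean m c r.
  have c0 : (fun n => c n - 0) = c by apply/funext => n; rewrite subr0.
  by rewrite /ddist c0.
rewrite -d0; apply: le_trans (ddist_triangle aa af a0 r01) _; apply: lerD.
  by rewrite ddist_sym//; exact: ddist_iota_coef aP r01.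
rewrite d0; exact: (dmean_le_norm0 hm (Nu_abscissa (NuP f)) fL r01).
Qed.

End Completion.

Theorem theorem4p1 (R : realType) (m : probability (Tinf_borel R) R)
    (hm : is_haar m) :
  (forall a : dseries R, Nu a ->
    [/\ forall zeta, Dinf1 zeta -> cvgn (series (bohr_term a zeta)),
        nevanlinna m (bohr a) &
        nevanlinna_norm0 m (bohr a) = norm0 a]) /\
  (forall (N : metricType R) (iota : @Nu R -> N), is_completion iota ->
    exists Phi : N -> ((nat -> R[i]) -> R[i]),
      [/\ forall x, nevanlinna m (Phi x),
          forall (f : @Nu R) zeta, Dinf1 zeta ->
            Phi (iota f) zeta = bohr (val f) zeta &
          forall x y : N,
            nevanlinna_norm0 m (Phi x \- Phi y) = (mdist x y)%:E]).
Proof.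
split=> [a aN|N iota iotaP].
  have a0 := Nu_abscissa aN; have [K aK] := Nu_norm0 hm aN.
  have [L L0 aL] := Nu_admissible hm aN.
  split; first by move=> zeta; exact: bohr_cvg aL.
    by apply: (nevanlinna_bohr L0 aL) => r; exact: (dmean_le_norm0 hm a0 aK).
  exact: (norm_equality hm a0 aK).
have /choice[a aP] := completion_coef hm iotaP.
exists (fun x => bohr (a x)); split=> [x|f zeta _|x y].
- exact: (completion_nevanlinna hm iotaP (aP x)).
- have := aP (iota f) f; rewrite mdistxx => /eq_of_coef_bound0 e.
  by rewrite -e.
- exact: (completion_norm hm iotaP (aP x) (aP y)).
Qed.
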